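(* Let $X$ be a compact Riemann surface of genus $g\ge 2$, uniformized by a Schottky group $\Gamma=\rho(F_g)\subset \mathrm{PGL}(2,\mathbf{C})$ with limit set $\Lambda$. Then the triple $\mathcal{S}_X=(A,H,D)$ associated to $X$ (defined in the context) is a $1$-summable spectral triple.
   Context: Schottky uniformization. $F_g$ is the free group on $g\ge 2$ generators in a fixed alphabet. A Schottky group of rank $g$ is given by an injective homomorphism $\rho:F_g\hookrightarrow \mathrm{PGL}(2,\mathbf{C})$ with discrete image $\Gamma$ and limit set $\Lambda\subset \mathbf{P}^1(\mathbf{C})$; every compact Riemann surface $X$ of genus $g\ge2$ can be written as $X=\Gamma\backslash(\mathbf{P}^1(\mathbf{C})-\Lambda)$ for such a group, and $\mathcal{S}_X$ is built from a choice of such $\rho$. Words and ends. All words are reduced words in the generators of $F_g$ and their inverses; $|w|$ is the word length, $e$ the empty word, and $i(w)$, $t(w)$ the initial and terminal letters. For a word $w$ and a word or infinite word $v$, write $w\subseteq v$ if $v=w\cdot w_0$ for some $w_0$ with $t(w)\ne i(w_0)^{-1}$ (no cancellation). Let $Y_g$ be the Cayley graph of $F_g$, in which the edge between words $a$ and $b$ is given length $\min\{|a|^{-2},|b|^{-2}\}$ (with $|e|^{-2}:=1$); let $\bar Y_g$ be its metric completion and $\bar F_g=\bar Y_g-Y_g$ (its points are the infinite reduced words, as limits of finite words). The map $\iota_\rho:\bar F_g\to\Lambda$, $\lim_i w_i\mapsto\lim_i\rho(w_i)(x_0)$, for a base point $x_0\in\mathbf{P}^1(\mathbf{C})\setminus\Lambda$,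 is a continuous bijection (Floyd). For a word $w$, put $\overrightarrow{w}_\rho=\{\iota_\rho(v): v\in\bar F_g,\ w\subseteq v\}\subseteq\Lambda$. The triple. $A=C(\Lambda)$, and $A_\infty=C(\Lambda,\mathbf{Z})\otimes_{\mathbf{Z}}\mathbf{C}$ is the dense subalgebra of locally constant functions, i.e. the span of the characteristic functions $\chi_{\overrightarrow{w}_\rho}$, $w\in F_g$. Let $\mu=\mu_\Lambda$ be the Patterson–Sullivan measure on $\Lambda$, normalized to be a probability measure; it satisfies $(\gamma^*d\mu)(x)=|\gamma'(x)|^{\delta_H}d\mu(x)$ for $\gamma\in\Gamma$, where $\delta_H$ is the Hausdorff dimension of $\Lambda$. Let $\tau(a)=\int_\Lambda a\,d\mu$. $H$ is the GNS representation space: the completion of $A$ for $\langle a|b\rangle=\tau(b^*a)$, with $A$ acting by multiplication. For $n\ge0$, $A_n$ is the span of the $\chi_{\overrightarrow{w}_\rho}$ with $|w|\le n$, $H_n$ is the corresponding subspace of $H$, and $P_n$ is the orthogonal projection of $H$ onto $H_n$. The Dirac operator is $D=\lambda_0P_0+\sum_{n\ge1}\lambda_n(P_n-P_{n-1})$ with $\lambda_n=(\dim A_n)^3$. Terminology. $(A,H,D)$ is a spectral triple if $A$ is a $C^*$-algebra acting by bounded operators on the Hilbert space $H$, $D$ is an unbounded self-adjoint operator on $H$ with $(D-z)^{-1}$ compact for $z\notin\mathbf{R}$, and $[D,a]$ is bounded for all $a$ in a dense involutive subalgebra of $A$ (here $A_\infty$). It is $1$-summable if $\mathrm{tr}((1+D^2)^{-1/2})<\infty$.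 *)

(* Defs.v *)
From HB Require Import structures.
From mathcomp Require Import all_boot all_order all_algebra.
From mathcomp Require Import complex sesquilinear.
From mathcomp Require Import all_classical all_reals all_analysis.

Set Implicit Arguments.
Unset Strict Implicit.
Unset Printing Implicit Defensive.

Import Order.TTheory GRing.Theory Num.Theory numFieldNormedType.Exports.

Local Open Scope classical_set_scope.
Local Open Scope ring_scope.

(* mathcomp-analysis puts the norm topology on a concrete numFieldType F only
   through the alias F^o; we transport it to R[i] itself. *)
Set Warnings "-redundant-canonical-projection".
HB.instance Definition _ (R : realType) :=
  PseudoPointedMetric.copy R[i] (R[i])^o.
HB.instance Definition _ (R : realType) := NormedModule.copy R[i] (R[i])^o.
Set Warnings "redundant-canonical-projection".

Section LinearSpan.
Context {R : realType} {V : lmodType R[i]}.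

Definition lspan (S : set V) : set V :=
  [set v | exists n (c : 'I_n -> R[i]) (s : 'I_n -> V),
     (forall i, S (s i)) /\ v = \sum_i c i *: s i].

(* The dimension of a finite-dimensional subspace W of V (a junk value if W is
   not a finite-dimensional subspace). *)
Definition lin_dim (W : set V) : nat :=
  xget 0%N [set n | exists b : 'I_n -> V,
    (forall c : 'I_n -> R[i], \sum_i c i *: b i = 0 -> forall i, c i = 0) /\
    lspan (range b) = W].

End LinearSpan.

(** * C*-algebras, Hilbert spaces and spectral triples *)

Section SpectralTriples.
Context {R : realType}.
Local Notation C := R[i].

Record star_algebra := StarAlgebra {
  sa_sort :> lmodType C ;
  sa_mul : sa_sort -> sa_sort -> sa_sort ;
  sa_star : sa_sort -> sa_sort ;
  sa_norm : sa_sort -> R }.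

Record cstar_algebra (A : star_algebra) : Prop := CstarAlgebra {
  cstar_mulA : associative (@sa_mul A) ;
  cstar_mul_linearl : forall b : A, linear (fun a : A => sa_mul a b) ;
  cstar_mul_linearr : forall a : A, linear (sa_mul a) ;
  cstar_starK : involutive (@sa_star A) ;
  cstar_star_semilinear : forall (c : C) (a b : A),
    sa_star (c *: a + b) = c^* *: sa_star a + sa_star b ;
  cstar_starM : forall a b : A,
    sa_star (sa_mul a b) = sa_mul (sa_star b) (sa_star a) ;
  cstar_norm_eq0 : forall a : A, sa_norm a = 0 -> a = 0 ;
  cstar_normD : forall a b : A, sa_norm (a + b) <= sa_norm a + sa_norm b ;
  cstar_normZ : forall (c : C) (a : A),
    sa_norm (c *: a) = Normc.normc c * sa_norm a ;
  cstar_normM : forall a b : A, sa_norm (sa_mul a b) <= sa_norm a * sa_norm b ;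
  cstar_norm_star : forall a : A, sa_norm (sa_mul (sa_star a) a) = sa_norm a ^+ 2 ;
  cstar_complete : forall u : nat -> A,
    (forall e : R, 0 < e -> exists N, forall m n, (N <= m)%N -> (N <= n)%N ->
       sa_norm (u m - u n) < e) ->
    exists l : A, forall e : R, 0 < e -> exists N, forall n, (N <= n)%N ->
       sa_norm (u n - l) < e }.

Definition dense_star_subalgebra (A : star_algebra) (B : set A) : Prop :=
  [/\ B 0,
      forall (c : C) (a b : A), B a -> B b -> B (c *: a + b),
      forall a b : A, B a -> B b -> B (sa_mul a b),
      forall a : A, B a -> B (sa_star a) &
      forall (a : A) (e : R), 0 < e -> exists2 b, B b & sa_norm (a - b) < e].

(* A Hilbert space is a completeNormedModType whose norm comes from an inner
   product ip, linear in the first argument. *)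
Definition hilbert_norm (H : completeNormedModType C)
    (ip : {dot H for (@Num.conj C)}) : Prop :=
  forall x : H, ip x x = `|x| ^+ 2.

Section Operators.
Context (H : completeNormedModType C) (ip : {dot H for (@Num.conj C)}).

Definition bounded_operator (T : H -> H) : Prop :=
  linear T /\ exists M : R, forall x, `|T x| <= M%:C%C * `|x|.

Definition compact_operator (T : H -> H) : Prop :=
  linear T /\ precompact (T @` [set x | `|x| <= 1]).

Definition positive_operator (T : H -> H) : Prop := forall x, 0 <= ip (T x) x.

(* A partially defined operator; op_fun is only meaningful on op_dom. *)
Record operator := Operator { op_dom : set H ; op_fun : H -> H }.

Definition densely_defined (D : operator) : Prop :=
  [/\ op_dom D 0,
      forall (c : C) x y, op_dom D x -> op_dom D y ->
        op_dom D (c *: x + y) /\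
        op_fun D (c *: x + y) = c *: op_fun D x + op_fun D y &
      closure (op_dom D) = setT].

(* D = D^*, where y is in the domain of D^* with D^* y = z iff
   <D x, y> = <x, z> for all x in the domain of D. *)
Definition self_adjoint (D : operator) : Prop :=
  densely_defined D /\
  forall y z : H, (forall x, op_dom D x -> ip (op_fun D x) y = ip x z) <->
    (op_dom D y /\ op_fun D y = z).

Definition unbounded (D : operator) : Prop :=
  ~ exists M : R, forall x, op_dom D x -> `|op_fun D x| <= M%:C%C * `|x|.

Definition compact_resolvent (D : operator) : Prop :=
  forall z : C, complex.Im z != 0 -> exists T : H -> H,
    [/\ compact_operator T,
        forall y, op_dom D (T y) /\ op_fun D (T y) - z *: T y = y &
        forall x, op_dom D x -> T (op_fun D x - z *: x) = x].

Definition star_representation (A : star_algebra) (pi : A -> H -> H) : Prop :=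
  [/\ forall a, bounded_operator (pi a),
      forall (c : C) (a b : A) x, pi (c *: a + b) x = c *: pi a x + pi b x,
      forall (a b : A) x, pi (sa_mul a b) x = pi a (pi b x) &
      forall (a : A) x y, ip (pi a x) y = ip x (pi (sa_star a) y)].

Definition bounded_commutator (D : operator) (T : H -> H) : Prop :=
  (forall x, op_dom D x -> op_dom D (T x)) /\
  exists M : R, forall x, op_dom D x ->
    `|op_fun D (T x) - T (op_fun D x)| <= M%:C%C * `|x|.

Record spectral_triple (A : star_algebra) (Ainf : set A) (pi : A -> H -> H)
    (D : operator) : Prop := SpectralTriple {
  st_cstar : cstar_algebra A ;
  st_hilbert : hilbert_norm ip ;
  st_rep : star_representation pi ;
  st_self_adjoint : self_adjoint D ;
  st_unbounded : unbounded D ;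
  st_compact_resolvent : compact_resolvent D ;
  st_dense : dense_star_subalgebra Ainf ;
  st_commutator : forall a, Ainf a -> bounded_commutator D (pi a) }.

(* B = (1 + D^2)^{-1/2}: the positive square root of the bounded inverse of
   1 + D^2, whose domain is that of D^2. *)
Definition inv_sqrt_one_plus_sq (D : operator) (B : H -> H) : Prop :=
  [/\ bounded_operator B,
      positive_operator B,
      forall y, [/\ op_dom D (B (B y)), op_dom D (op_fun D (B (B y))) &
        B (B y) + op_fun D (op_fun D (B (B y))) = y] &
      forall x, op_dom D x -> op_dom D (op_fun D x) ->
        B (B (x + op_fun D (op_fun D x))) = x].

Definition orthonormal_basis (E : set H) : Prop :=
  [/\ forall e, E e -> ip e e = 1,
      forall e f, E e -> E f -> e <> f -> ip e f = 0 &
      closure (lspan E) = setT].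

(* For a positive bounded operator T the value of the trace does not depend on
   the orthonormal basis E. *)
Definition finite_trace (T : H -> H) : Prop :=
  exists2 E : set H, orthonormal_basis E &
    (\esum_(e in E) (complex.Re (ip (T e) e))%:E < +oo)%E.

Definition one_summable (D : operator) : Prop :=
  exists2 B, inv_sqrt_one_plus_sq D B & finite_trace B.

Definition orth_proj (W : set H) (x : H) : H :=
  xget 0 [set y | W y /\ forall z, W z -> ip (x - y) z = 0].

End Operators.

(* (H, eta, pi) is the GNS representation of (A, tau): eta exhibits the Hilbert
   space H as the completion of A for <a | b> = tau (b^* a), and pi extends the
   left multiplication of A on itself. *)
Definition GNS (A : star_algebra) (tau : A -> C) (H : completeNormedModType C)
    (ip : {dot H for (@Num.conj C)}) (eta : A -> H) (pi : A -> H -> H) : Prop :=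
  [/\ hilbert_norm ip,
      linear eta,
      forall a b : A, ip (eta a) (eta b) = tau (sa_mul (sa_star b) a),
      closure (range eta) = setT &
      forall a : A, bounded_operator (pi a) /\
        forall b : A, pi a (eta b) = eta (sa_mul a b)].

End SpectralTriples.

(** * The algebra of continuous complex functions *)

Section ContinuousFunctions.
Context (R : realType) (X : topologicalType).
Local Notation C := R[i].

Definition continuous_pred : {pred X -> C} := mem [set f : X -> C | continuous f].

Lemma continuous_pred_submod : GRing.submod_closed continuous_pred.
Proof.
split=> [|c f g /set_mem cf /set_mem cg]; apply/mem_set => x.
  exact: cst_continuous.
apply: (@cvgD _ _ _ _ _ (c *: f) g _ _ _ (cg x)).
exact: (@cvgZl_tmp _ _ _ _ _ c f _ (cf x)).
Qed.

HB.instance Definition _ := GRing.isSubmodClosed.Build C (X -> C)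
  continuous_pred continuous_pred_submod.

(* C(X) *)
Record cfun := Cfun { cfun_val :> X -> C ; _ : cfun_val \in continuous_pred }.

HB.instance Definition _ := [isSub for cfun_val].
HB.instance Definition _ := [Choice of cfun by <:].
HB.instance Definition _ := [SubChoice_isSubLmodule of cfun by <:].

Lemma cfun_continuous (f : cfun) : continuous f.
Proof. by case: f => f cf; exact: set_mem cf. Qed.

Lemma conjC_continuous : continuous (@Num.conj C).
Proof.
move=> x; have Fx : Filter (nbhs x) by exact: nbhs_filter.
apply/(@cvgrPdist_lt _ C _ _ Fx) => e e0.
apply: filterS (@nbhsx_ballx C C x e e0) => y.
by rewrite -ball_normE /= -rmorphB norm_conjC.
Qed.

Lemma cfun_mul_subproof (f g : cfun) :
  (fun x => f x * g x) \in continuous_pred.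
Proof.
apply/mem_set => x.
exact: (@cvgM _ _ _ _ f g _ _ (@cfun_continuous f x) (@cfun_continuous g x)).
Qed.

Lemma cfun_star_subproof (f : cfun) : (fun x => (f x)^*) \in continuous_pred.
Proof.
apply/mem_set => x; apply: continuous_comp; first exact: cfun_continuous.
exact: conjC_continuous.
Qed.

(* Pointwise operations and the supremum norm. *)
Definition cfun_alg : star_algebra := @StarAlgebra R cfun
  (fun f g => Cfun (cfun_mul_subproof f g))
  (fun f => Cfun (cfun_star_subproof f))
  (fun f => sup (range (fun x => Normc.normc (f x)))).

End ContinuousFunctions.

(** * The Riemann sphere and its Moebius transformations *)

Section RiemannSphere.
Context {R : realType}.
Local Notation C := R[i].

(* P^1(C) = C + {oo}; Some z is the point [z : 1] and None is [1 : 0]. *)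
Definition P1 : Type := one_point_compactification C.

HB.instance Definition _ := Topological.on P1.
HB.instance Definition _ := Pointed.on P1.

(* P^1(C) with its Borel sigma-algebra *)
Definition P1borel := g_sigma_algebraType (@open P1).

Definition homog (x : P1) : C * C := if x is Some z then (z, 1) else (1, 0).

(* The point [u : v]. *)
Definition proj_pt (p : C * C) : P1 :=
  if p.2 == 0 then None else Some (p.1 / p.2).

Definition lin_act (A : 'M[C]_2) (p : C * C) : C * C :=
  (A 0 0 * p.1 + A 0 1 * p.2, A 1 0 * p.1 + A 1 1 * p.2).

Definition moebius (A : 'M[C]_2) (x : P1) : P1 := proj_pt (lin_act A (homog x)).

(* Equality in PGL(2, C) of the classes of two invertible matrices. *)
Definition pgl_eq (A B : 'M[C]_2) : Prop := exists2 c : C, c != 0 & A = c *: B.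

Definition sqnorm2 (p : C * C) : R := Normc.normc p.1 ^+ 2 + Normc.normc p.2 ^+ 2.

Definition chordal_dist (x y : P1) : R :=
  let p := homog x in let q := homog y in
  2 * Normc.normc (p.1 * q.2 - p.2 * q.1) / Num.sqrt (sqnorm2 p * sqnorm2 q).

(* |A'(x)|, the factor by which A scales the spherical metric at x:
   by det(Ap, Aq) = det A * det(p, q) it is the limit of
   chordal_dist (A y) (A x) / chordal_dist y x as y tends to x. *)
Definition spherical_deriv (A : 'M[C]_2) (x : P1) : R :=
  Normc.normc (\det A) * sqnorm2 (homog x) / sqnorm2 (lin_act A (homog x)).

Definition chordal_diam (U : set P1) : R :=
  sup [set r | exists x y, [/\ U x, U y & r = chordal_dist x y]].

Definition hausdorff_premeasure (s d : R) (E : set P1) : \bar R :=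
  ereal_inf [set (\sum_(0 <= k <oo) ((chordal_diam (U k)) `^ s)%:E)%E
    | U in [set U : nat -> set P1 | E `<=` \bigcup_k U k /\
                                    forall k, chordal_diam (U k) <= d]].

Definition hausdorff_measure (s : R) (E : set P1) : \bar R :=
  ereal_sup [set hausdorff_premeasure s d E | d in [set d : R | 0 < d]].

Definition hausdorff_dim (E : set P1) : R :=
  inf [set s : R | 0 < s /\ hausdorff_measure s E = 0%E].

Definition jordan_curve (J : set P1) : Prop :=
  exists f : R -> P1,
    [/\ {within `[0, 1], continuous f}, f 0 = f 1,
        forall s t, 0 <= s < 1 -> 0 <= t < 1 -> f s = f t -> s = t &
        J = f @` `[0, 1]].

(* The two sides of a Jordan curve J not passing through p. *)
Definition curve_exterior (p : P1) (J : set P1) : set P1 :=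
  connected_component (~` J) p.

Definition curve_interior (p : P1) (J : set P1) : set P1 :=
  ~` (J `|` curve_exterior p J).

End RiemannSphere.

Arguments P1 : clear implicits.
Arguments P1borel : clear implicits.

(** * Words in the free group *)

Section Words.
Context (g : nat).

(* (i, false) is the i-th generator, (i, true) its inverse. *)
Definition letter : Type := 'I_g * bool.

Definition inv_letter (a : letter) : letter := (a.1, ~~ a.2).

Definition reduced (w : seq letter) : bool :=
  sorted (fun a b => b != inv_letter a) w.

(* The points of the boundary of F_g, as infinite reduced words. *)
Definition reduced_inf (v : nat -> letter) : Prop :=
  forall n, v n.+1 != inv_letter (v n).

(* For reduced v, this is v = w w_0 without cancellation. *)
Definition word_prefix (w : seq letter) (v : nat -> letter) : Prop :=
  w = mkseq v (size w).

End Words.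

(** * Schottky groups *)

Section Schottky.
Context {R : realType} {g : nat}.
Local Notation C := R[i].

Definition letter_mx (M : 'I_g -> 'M[C]_2) (a : letter g) : 'M[C]_2 :=
  if a.2 then invmx (M a.1) else M a.1.

(* The homomorphism rho : F_g -> PGL(2, C) sending the i-th generator to the
   class of M i; word_mx M w is a matrix representing rho(w). *)
Definition word_mx (M : 'I_g -> 'M[C]_2) (w : seq (letter g)) : 'M[C]_2 :=
  \prod_(a <- w) letter_mx M a.

Definition rho_injective (M : 'I_g -> 'M[C]_2) : Prop :=
  forall u v, reduced u -> reduced v ->
    pgl_eq (word_mx M u) (word_mx M v) -> u = v.

(* PGL(2, C) carries the quotient topology of GL(2, C): every element of the
   image has a neighbourhood containing no other element of the image. *)
Definition rho_discrete (M : 'I_g -> 'M[C]_2) : Prop :=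
  forall w, exists2 V : set 'M[C]_2, nbhs (word_mx M w) V &
    forall v (c : C), c != 0 -> V (c *: word_mx M v) ->
      pgl_eq (word_mx M v) (word_mx M w).

(* There are 2g disjoint Jordan curves J (i, false), J (i, true), with disjoint
   interiors, such that T i maps the exterior of the first onto the interior of
   the second. *)
Definition schottky_generators (T : 'I_g -> 'M[C]_2) : Prop :=
  (forall i, T i \in unitmx) /\
  exists (p : P1 R) (J : letter g -> set (P1 R)),
    [/\ forall a, jordan_curve (J a) /\ ~ J a p,
        forall a b, a != b -> J a `&` J b = set0,
        forall a b, a != b ->
          curve_interior p (J a) `&` curve_interior p (J b) = set0 &
        forall i, moebius (T i) @` curve_exterior p (J (i, false)) =
                  curve_interior p (J (i, true))].

Definition same_pgl_subgroup (M T : 'I_g -> 'M[C]_2) : Prop :=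
  (forall u, exists v, pgl_eq (word_mx M u) (word_mx T v)) /\
  (forall v, exists u, pgl_eq (word_mx T v) (word_mx M u)).

(* rho is injective with discrete image, and its image is a Schottky group;
   the given free generators of the image need not be the ones paired with
   Jordan curves. *)
Definition schottky (M : 'I_g -> 'M[C]_2) : Prop :=
  [/\ forall i, M i \in unitmx,
      rho_injective M,
      rho_discrete M &
      exists2 T, schottky_generators T & same_pgl_subgroup M T].

(* The accumulation points of orbits, along pairwise distinct group elements. *)
Definition limit_set (M : 'I_g -> 'M[C]_2) : set (P1 R) :=
  [set x | exists (z : P1 R) (w : nat -> seq (letter g)),
     (forall m n, pgl_eq (word_mx M (w m)) (word_mx M (w n)) -> m = n) /\
     (fun n => moebius (word_mx M (w n)) z) @ \oo --> x].

Definition iota_rho (M : 'I_g -> 'M[C]_2) (x0 : P1 R) (v : nat -> letter g) : P1 R :=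
  limn (fun n => moebius (word_mx M (mkseq v n)) x0).

Definition cylinder (M : 'I_g -> 'M[C]_2) (x0 : P1 R) (w : seq (letter g)) :
    set (P1 R) :=
  [set iota_rho M x0 v | v in [set v | reduced_inf v /\ word_prefix w v]].

(* A Borel probability measure carried by the limit set, conformal of dimension
   the Hausdorff dimension of the limit set. *)
Definition patterson_sullivan (M : 'I_g -> 'M[C]_2)
    (mu : probability (P1borel R) R) : Prop :=
  mu (limit_set M) = 1%E /\
  forall (w : seq (letter g)) (B : set (P1borel R)),
    measurable B -> B `<=` limit_set M ->
    mu (moebius (word_mx M w) @` B) =
    (\int[mu]_(x in B)
       ((spherical_deriv (word_mx M w) x) `^ hausdorff_dim (limit_set M))%:E)%E.

End Schottky.

(** * Riemann surfaces and uniformization *)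

Record riemann_surface (R : realType) := RiemannSurface {
  rs_space :> topologicalType ;
  rs_atlas : set (set rs_space * (rs_space -> R[i])) ;
  rs_hausdorff : hausdorff_space rs_space ;
  rs_connected : connected [set: rs_space] ;
  rs_cover : forall p : rs_space, exists2 c, rs_atlas c & c.1 p ;
  rs_chart : forall c, rs_atlas c ->
    [/\ open c.1,
        forall p, c.1 p -> {for p, continuous c.2},
        forall p q, c.1 p -> c.1 q -> c.2 p = c.2 q -> p = q &
        forall V, open V -> V `<=` c.1 -> open (c.2 @` V)] ;
  (* complex differentiability of the transition map c.2 p |-> d.2 p *)
  rs_transition : forall c d, rs_atlas c -> rs_atlas d ->
    exists t : R[i] -> R[i], forall p, c.1 p -> d.1 p ->
      t (c.2 p) = d.2 p /\ derivable t (c.2 p) 1 }.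

(* X is the Riemann surface Gamma \ (P^1(C) - Lambda), with quotient map p. *)
Definition uniformizes (R : realType) (g : nat) (M : 'I_g -> 'M[R[i]]_2)
    (X : riemann_surface R) (p : P1 R -> X) : Prop :=
  let Omega := ~` limit_set M in
  [/\ forall x, Omega x -> {for x, continuous p},
      forall q, exists2 x, Omega x & p x = q,
      forall x y, Omega x -> Omega y ->
        (p x = p y <-> exists w, y = moebius (word_mx M w) x),
      forall c z, rs_atlas c -> Omega (Some z) -> c.1 (p (Some z)) ->
        derivable (fun t : R[i] => c.2 (p (Some t))) z 1 &
      forall c, rs_atlas c -> Omega None -> c.1 (p None) ->
        derivable (fun t : R[i] => c.2 (p (proj_pt (1, t)))) 0 1].

(** * The triple of a Schottky uniformization *)

Section Triple.
Context {R : realType} {g : nat} (M : 'I_g -> 'M[R[i]]_2).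
Local Notation C := R[i].
Local Notation Lambda := (limit_set M).

Definition CLambda : star_algebra := cfun_alg R (set_type Lambda).

(* tau(a) is the integral of a over Lambda; 'valL_ 0 a' is the extension of a by
   zero to P^1(C). *)
Definition tau (mu : probability (P1borel R) R) (a : CLambda) : C :=
  Complex (\int[mu]_(x in Lambda) complex.Re (valL_ 0 (a : cfun _ _) x))
          (\int[mu]_(x in Lambda) complex.Im (valL_ 0 (a : cfun _ _) x)).

Definition chi (x0 : P1 R) (w : seq (letter g)) : set_type Lambda -> C :=
  fun x => (\val x \in cylinder M x0 w)%:R.

(* A_oo *)
Definition loc_const : set CLambda :=
  [set a | forall x : set_type Lambda,
     \forall y \near x, (a : cfun _ _) y = (a : cfun _ _) x].

(* A_n *)
Definition Afilt (x0 : P1 R) (n : nat) : set CLambda :=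
  [set a | lspan [set chi x0 w | w in [set w | reduced w && (size w <= n)%N]]
             (cfun_val (a : cfun _ _))].

Definition eigval (x0 : P1 R) (n : nat) : C := ((lin_dim (Afilt x0 n)) ^ 3)%:R.

Section Dirac.
Context (H : completeNormedModType C) (ip : {dot H for (@Num.conj C)}).
Context (eta : CLambda -> H) (x0 : P1 R).

Definition proj_n (n : nat) : H -> H := orth_proj ip (eta @` Afilt x0 n).

Definition dirac_term (x : H) (n : nat) : H :=
  if n is m.+1 then eigval x0 n *: (proj_n n x - proj_n m x)
  else eigval x0 0 *: proj_n 0 x.

(* D = lambda_0 P_0 + sum_(n >= 1) lambda_n (P_n - P_(n-1)), on the vectors where
   the series converges. *)
Definition dirac_op : operator H :=
  Operator [set x | cvgn (series (dirac_term x))]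
           (fun x => limn (series (dirac_term x))).

End Dirac.

End Triple.

Arguments loc_const {R g} M.

(* Main.v *)
Require Import Defs.
From HB Require Import structures.
From mathcomp Require Import all_boot all_order all_algebra.
From mathcomp Require Import complex sesquilinear.
From mathcomp Require Import all_classical all_reals all_analysis.
From mathcomp Require Import ring lra zify.
Set Implicit Arguments.
Unset Strict Implicit.
Unset Printing Implicit Defensive.
Import Order.TTheory GRing.Theory Num.Theory numFieldNormedType.Exports.
Local Open Scope classical_set_scope.
Local Open Scope ring_scope.

(** The proof has a part about Hilbert spaces and a part about limit sets.

    Hilbert spaces. Let W_0 < W_1 < ... be a strictly increasing chain of finite-dimensional
    subspaces of H with dense union, P_n the orthogonal projection onto W_n, and
    lambda_n = (dim W_n)^3. Gram-Schmidt yields an orthonormal sequence e whose first dim W_n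
    terms span W_n (adapted_orthonormal_sequence). In this basis D is diagonal, and each e k
    belongs to the block of the first n with k < dim W_n, so that its eigenvalue is at least
    (k+1)^3 (eigen_ge). Everything asked of D follows from this growth: the resolvents and
    (1 + D^2)^(-1/2) are diagonal with coefficients at most a multiple of 1/((k+1)(k+2)), the
    terms of a telescoping series. A bounded operator that commutes with P_n for all n >= m
    commutes with all but the first m+1 terms of D, whose sum is bounded; hence its commutator
    with D is bounded.

    Limit sets. The required chain is formed by the images of the A_n in the GNS space, and
    all that has to be known about it results from schottky_coding: the limit set is
    homeomorphic to the space of infinite reduced words through the boundary map. Hence A_n
    consists of the functions that depend on the first n letters only (AfiltP). These form an
    increasing chain of *-algebras, strictly increasing because g >= 2; multiplication by an
    element of A_m preserves A_n for n >= m; by compactness the union of the A_n is the algebra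
    of locally constant functions, and it is uniformly dense in C(Lambda). The uniform norm
    dominates the GNS norm (eta_norm_le), so density passes to H. Finally the GNS map is
    injective on A_n (eta_inj), since no cylinder is a null set (cylinder_pos): the measure is
    conformal, so the measures of the one-letter cylinders vanish together if one of them
    does, and they cover the limit set.

    The coding. For generators T that pair Jordan curves, the complements of the exteriors of
    the curves are closed and disjoint and the group plays ping-pong with them
    (schottky_ping_pong); to see this one needs that a Jordan curve has empty interior
    (jordan_no_interior). Nested images of these sets are indexed by reduced words, and an
    infinite word determines one point (itinerary_inj): by discreteness the normalized matrices
    of the inverses of its prefixes have singular limits, so that they contract all points but
    one, and two points with the same itinerary would contradict the disjointness of the sets.
    The points with an itinerary form the limit set (limit_set_lim_kset). The given generators
    may form another free basis than T; rewriting reduced words from one basis into the other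
    changes boundedly many last letters when a letter is appended, so it extends to infinite
    words (boundary, boundaryK). *)

(** * Inner products and limits *)

Section RealToComplex.
Context (R : realType).
Implicit Types x y : R.

Lemma RtoCD x y : (x + y)%:C%C = x%:C%C + y%:C%C.
Proof. exact: rmorphD. Qed.

Lemma RtoCM x y : (x * y)%:C%C = x%:C%C * y%:C%C.
Proof. exact: rmorphM. Qed.

Lemma RtoCV x : (x^-1)%:C%C = (x%:C%C)^-1.
Proof. exact: fmorphV. Qed.

End RealToComplex.

Lemma posC_real (R : realType) (e : R[i]) : 0 < e ->
  exists2 r : R, 0 < r & e = r%:C%C.
Proof.
case: e => a b; rewrite ltcE /= => /andP[/eqP -> a0].
by exists a.
Qed.

Lemma normC_real (R : realType) (V : normedModType R[i]) (x : V) :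
  exists2 r : R, 0 <= r & `|x| = r%:C%C.
Proof.
have := normr_ge0 x; case: (`|x|) => a b; rewrite lecE /= => /andP[/eqP -> a0].
by exists a.
Qed.

Lemma cvg_eps (R : realType) (V : normedModType R[i]) (T : Type) (F : set_system T)
    {FF : Filter F} (f : T -> V) (l : V) :
  (forall e : R, 0 < e -> \forall t \near F, `|l - f t| < e%:C%C) ->
  f @ F --> l.
Proof.
move=> h; apply/cvgrPdist_lt => e /posC_real[r r0 ->].
exact: h.
Qed.

Lemma cvg_norm_le (R : realType) (V : normedModType R[i]) (T : Type)
    (F : set_system T) {FF : ProperFilter F} (f : T -> V) (l : V) (b : R) :
  f @ F --> l -> (\forall t \near F, `|f t| <= b%:C%C) -> `|l| <= b%:C%C.
Proof.
move=> fl fb; have [r r0 lr] := normC_real l; rewrite lr lecR leNgt; apply/negP => br.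
have rb : 0 < (r - b)%:C%C :> R[i] by rewrite ltcR subr_gt0.
have [t [lt ft]] : exists t, `|l - f t| < (r - b)%:C%C /\ `|f t| <= b%:C%C.
  by apply: (@filter_ex _ F); apply: filterI => //; move/cvgrPdist_lt: fl; exact.
have : `|l| < (r - b)%:C%C + b%:C%C.
  by rewrite -{1}(subrK (f t) l) (le_lt_trans (ler_normD _ _))// ltr_leD.
by rewrite -rmorphD subrK lr ltxx.
Qed.

Lemma normed_cvg_unique (R : realType) (V : normedModType R[i]) (T : Type)
    (F : set_system T) {FF : ProperFilter F} (f : T -> V) (a b : V) :
  f @ F --> a -> f @ F --> b -> a = b.
Proof. exact: (@cvg_unique _ (@norm_hausdorff _ V)). Qed.

Section HilbertSpace.
Context (R : realType) (H : completeNormedModType R[i]).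
Context (ip : {dot H for (@Num.conj R[i])}).
Hypothesis hip : hilbert_norm ip.
Local Notation C := R[i].

Lemma ipC x y : ip x y = (ip y x)^*.
Proof. by have := hermC ip x y; rewrite expr0 mul1r. Qed.

Lemma ipZl a x y : ip (a *: x) y = a * ip x y.
Proof. exact: linearZl_LR. Qed.

Lemma ipZr a x y : ip x (a *: y) = a^* * ip x y.
Proof. exact: linearZr_LR. Qed.

Lemma ipDl x y z : ip (x + y) z = ip x z + ip y z.
Proof. exact: linearDl. Qed.

Lemma ipDr x y z : ip z (x + y) = ip z x + ip z y.
Proof. exact: linearDr. Qed.

Lemma ipBl x y z : ip (x - y) z = ip x z - ip y z.
Proof. exact: linearBl. Qed.

Lemma ipBr x y z : ip z (x - y) = ip z x - ip z y.
Proof. exact: linearBr. Qed.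

Lemma ip0l x : ip 0 x = 0.
Proof. exact: linear0l. Qed.

Lemma ip0r x : ip x 0 = 0.
Proof. exact: linear0r. Qed.

Lemma ip_suml I (r : seq I) (P : pred I) (F : I -> H) z :
  ip (\sum_(i <- r | P i) F i) z = \sum_(i <- r | P i) ip (F i) z.
Proof. exact: linear_sumlz. Qed.

Lemma ip_sumr I (r : seq I) (P : pred I) (F : I -> H) z :
  ip z (\sum_(i <- r | P i) F i) = \sum_(i <- r | P i) ip z (F i).
Proof. exact: linear_sumr. Qed.

Lemma ip_eq0 x : ip x x = 0 -> x = 0.
Proof. by rewrite hip => /eqP; rewrite expf_eq0 /= normr_eq0 => /eqP. Qed.

Lemma ip_eq0C x y : ip x y = 0 -> ip y x = 0.
Proof. by move=> xy; rewrite ipC xy conjC0. Qed.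

Lemma ip_normD x y : ip x y = 0 -> `|x + y| ^+ 2 = `|x| ^+ 2 + `|y| ^+ 2.
Proof.
by move=> xy; rewrite -!hip ipDl !ipDr xy (ip_eq0C xy) addr0 add0r.
Qed.

Lemma ip_norm_le x y : `|ip x y| <= `|x| * `|y|.
Proof.
have [->|y0] := eqVneq y 0; first by rewrite ip0r !normr0 mulr0.
have ny0 : `|y| != 0 by rewrite normr_eq0.
pose c := ip x y / `|y| ^+ 2.
have yc : ip (x - c *: y) (c *: y) = 0.
  by rewrite ipZr ipBl ipZl hip /c divfK ?expf_neq0// subrr mulr0.
have := ip_normD yc; rewrite subrK => nx.
have : `|c *: y| ^+ 2 <= `|x| ^+ 2 by rewrite nx lerDr exprn_ge0.
rewrite ler_pXn2r ?nnegrE// normrZ /c normrM normfV normrX normr_id.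
by rewrite expr2 invfM -!mulrA mulVf// mulr1 ler_pdivrMr ?lt0r ?ny0//=.
Qed.

Lemma cvg_ipl (y : H) T (F : set_system T) {FF : Filter F} (f : T -> H) (l : H) :
  f @ F --> l -> (fun t => ip (f t) y) @ F --> ip l y.
Proof.
move=> /cvgrPdist_lt fl; apply/cvgrPdist_lt => e e0.
have y1 : 0 < `|y| + 1 by rewrite ltr_wpDl.
have := fl (e / (`|y| + 1)) (divr_gt0 e0 y1); apply: filterS => t lt.
rewrite -ipBl (le_lt_trans (ip_norm_le _ _))//.
apply: le_lt_trans (_ : `|l - f t| * (`|y| + 1) < e).
  by rewrite ler_wpM2l// lerDl.
by rewrite -ltr_pdivlMr.
Qed.

Lemma cvg_ipr (y : H) T (F : set_system T) {FF : Filter F} (f : T -> H) (l : H) :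
  f @ F --> l -> (fun t => ip y (f t)) @ F --> ip y l.
Proof.
move=> /cvgrPdist_lt fl; apply/cvgrPdist_lt => e e0.
have y1 : 0 < `|y| + 1 by rewrite ltr_wpDl.
have := fl (e / (`|y| + 1)) (divr_gt0 e0 y1); apply: filterS => t lt.
rewrite -ipBr (le_lt_trans (ip_norm_le _ _))//.
apply: le_lt_trans (_ : (`|y| + 1) * `|l - f t| < e).
  by rewrite ler_wpM2r// lerDl.
by rewrite mulrC -ltr_pdivlMr.
Qed.

End HilbertSpace.

(** Limits along ultrafilters stand in for the extraction of convergent subsequences, and
    make diagonal arguments superfluous. *)
Lemma ultra_compact_lim (T : Type) (V : topologicalType) (F : set_system T)
    (UF : UltraFilter F) (f : T -> V) (K : set V) :
  compact K -> F (f @^-1` K) -> exists2 a, K a & f @ F --> a.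
Proof.
move=> cK FK; have [a [Ka cla]] := cK (f @ F) _ FK.
exists a => // A Aa; have [//|FnA] := in_ultra_setVsetC (f @^-1` A) UF.
by have [x [nAx Ax]] := cla (~` A) A FnA Aa; case: nAx.
Qed.

Lemma normc_ge_Im (R : realType) (z : R[i]) : `|complex.Im z|%:C%C <= `|z|.
Proof. by rewrite normc_def lecR -sqrtr_sqr ler_wsqrtr// lerDr sqr_ge0. Qed.

Lemma normc_le_ReIm (R : realType) (z : R[i]) :
  `|z| <= (`|complex.Re z| + `|complex.Im z|)%:C%C.
Proof.
rewrite normc_def lecR; case: z => a b /=.
rewrite -[leRHS]ger0_norm ?addr_ge0// -sqrtr_sqr ler_wsqrtr//.
by rewrite sqrrD !real_normK ?num_real// -addrAC lerDl mulrn_wge0 ?mulr_ge0.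
Qed.

Lemma ultra_bounded_lim (R : realType) (T : Type) (F : set_system T)
    (UF : UltraFilter F) (f : T -> R[i]) (r : R) :
  F [set x | `|f x| <= r%:C%C] -> exists a : R[i], f @ F --> a.
Proof.
move=> Fr.
have cpt : compact (`[-r, r] : set R) by exact: segment_compact.
have [|a _ fa] := ultra_compact_lim UF (f := fun x => complex.Re (f x)) cpt.
  apply: filterS Fr => x /=; rewrite in_itv /= -ler_norml -lecR.
  exact: le_trans (normc_ge_Re _).
have [|b _ fb] := ultra_compact_lim UF (f := fun x => complex.Im (f x)) cpt.
  apply: filterS Fr => x /=; rewrite in_itv /= -ler_norml -lecR.
  exact: le_trans (normc_ge_Im _).
exists (Complex a b); apply: cvg_eps => e e0.
have e2 : 0 < e / 2 by rewrite divr_gt0.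
move/cvgrPdist_lt : fa => /(_ _ e2); move/cvgrPdist_lt : fb => /(_ _ e2).
apply: filterS2 => x /= bx ax; apply: le_lt_trans (normc_le_ReIm _) _.
rewrite ltcR [ltRHS]splitr ltrD//; first by case: (f x) ax.
by case: (f x) bx.
Qed.

(** * Orthonormal sequences and diagonal operators *)

Section Orthonormal.
Context (R : realType) (H : completeNormedModType R[i]).
Context (ip : {dot H for (@Num.conj R[i])}).
Hypothesis hip : hilbert_norm ip.
Local Notation C := R[i].
Context (e : nat -> H).
Hypothesis e_ortho : forall i j, ip (e i) (e j) = (i == j)%:R.

Definition fourier_sum (n : nat) (x : H) : H :=
  \sum_(0 <= k < n) ip x (e k) *: e k.

Lemma ip_lin_comb (a : nat -> C) n j :
  ip (\sum_(0 <= k < n) a k *: e k) (e j) = if (j < n)%N then a j else 0.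
Proof.
rewrite ip_suml.
under eq_bigr do rewrite ipZl e_ortho.
rewrite big_mkord; case: ltnP => jn.
  rewrite (bigD1 (Ordinal jn)) //= eqxx mulr1 big1 ?addr0// => i ij.
  by rewrite (_ : (i == j :> nat) = false) ?mulr0//; apply/negbTE.
rewrite big1// => i _; rewrite (_ : (i == j :> nat) = false) ?mulr0//.
by apply/negbTE; rewrite neq_ltn (leq_trans (ltn_ord i) jn).
Qed.

Lemma cvg_lin_comb T (F : set_system T) {FF : Filter F} (f : T -> nat -> C)
    (a : nat -> C) n :
  (forall k, (fun t => f t k) @ F --> a k) ->
  (fun t => \sum_(0 <= k < n) f t k *: e k) @ F --> \sum_(0 <= k < n) a k *: e k.
Proof.
move=> fa; elim: n => [|n IH].
  rewrite big_geq//; under eq_fun do rewrite big_geq//; exact: cvg_cst.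
rewrite big_nat_recr//=; under eq_fun do rewrite big_nat_recr//=.
by apply: cvgD => //; apply: cvgZr_tmp; exact: fa.
Qed.

Lemma orthonormal_norm k : `|e k| = 1.
Proof.
by apply/eqP; rewrite -(@eqrXn2 _ 2)//; rewrite expr1n -hip e_ortho eqxx.
Qed.

Lemma ip_basis_le x k : `|ip x (e k)| <= `|x|.
Proof. by apply: le_trans (ip_norm_le hip _ _) _; rewrite orthonormal_norm mulr1. Qed.

Lemma fourier_sum_orth n x (a : nat -> C) :
  ip (x - fourier_sum n x) (\sum_(0 <= k < n) a k *: e k) = 0.
Proof.
rewrite ip_sumr big_nat big1// => k /andP[_ kn].
by rewrite ipZr ipBl ip_lin_comb kn subrr mulr0.
Qed.

Lemma fourier_sum_pythagoras n x :
  `|x| ^+ 2 = `|x - fourier_sum n x| ^+ 2 + `|fourier_sum n x| ^+ 2.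
Proof.
rewrite -(ip_normD hip) ?subrK//.
exact: (fourier_sum_orth n x (fun k => ip x (e k))).
Qed.

Lemma fourier_rest_le n x : `|x - fourier_sum n x| <= `|x|.
Proof.
rewrite -(@ler_pXn2r _ 2) ?nnegrE// [leRHS](fourier_sum_pythagoras n x).
by rewrite lerDl exprn_ge0.
Qed.

Lemma fourier_sumP n (a : C) x y :
  fourier_sum n (a *: x + y) = a *: fourier_sum n x + fourier_sum n y.
Proof.
rewrite /fourier_sum scaler_sumr -big_split; apply: eq_bigr => k _ /=.
by rewrite ipDl ipZl scalerDl scalerA.
Qed.

Lemma fourier_sumB n x y :
  fourier_sum n (x - y) = fourier_sum n x - fourier_sum n y.
Proof.
by rewrite addrC -scaleN1r fourier_sumP scaleN1r addrC.
Qed.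

Lemma fourier_sumK m n x : (m <= n)%N ->
  fourier_sum n (fourier_sum m x) = fourier_sum m x.
Proof.
move=> mn; rewrite {1}/fourier_sum (@big_cat_nat _ _ _ m)//= [X in _ + X]big_nat [X in _ + X]big1.
  rewrite addr0 big_nat [RHS]big_nat; apply: eq_bigr => k /andP[_ km].
  by rewrite ip_lin_comb km.
by move=> k /andP[mk _]; rewrite ip_lin_comb ltnNge mk scale0r.
Qed.

Hypothesis e_dense : forall (x : H) (r : R), 0 < r ->
  exists n y, fourier_sum n y = y /\ `|x - y| < r%:C%C.

Lemma fourier_sum_cvg x : (fun n => fourier_sum n x) @ \oo --> x.
Proof.
apply: cvg_eps => r r0; have [N [y [yN xy]]] := e_dense x r0.
near=> n; have Nn : (N <= n)%N by near: n; exact: nbhs_infty_ge.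
apply: le_lt_trans xy.
rewrite (_ : x - fourier_sum n x = (x - y) - fourier_sum n (x - y)).
  exact: fourier_rest_le.
rewrite fourier_sumB -[in fourier_sum n y]yN fourier_sumK// yN.
by rewrite opprB addrA subrK.
Unshelve. all: by end_near. Qed.

Lemma coord_inj x y : (forall k, ip x (e k) = ip y (e k)) -> x = y.
Proof.
move=> xy; have fxy n : fourier_sum n x = fourier_sum n y.
  by apply: eq_bigr => k _; rewrite xy.
have yx : (fun n => fourier_sum n y) @ \oo --> x.
  by rewrite -(funext fxy); exact: fourier_sum_cvg.
exact: (normed_cvg_unique yx (fourier_sum_cvg (x := y))).
Qed.

End Orthonormal.

Section DiagonalOperators.
Context (R : realType) (H : completeNormedModType R[i]).
Context (ip : {dot H for (@Num.conj R[i])}).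
Hypothesis hip : hilbert_norm ip.
Local Notation C := R[i].
Context (e : nat -> H).
Hypothesis e_ortho : forall i j, ip (e i) (e j) = (i == j)%:R.
Hypothesis e_dense : forall (x : H) (r : R), 0 < r ->
  exists n y, fourier_sum ip e n y = y /\ `|x - y| < r%:C%C.

Let inve (n : nat) : R := n.+1%:R^-1.

Let inve_gt0 n : 0 < inve n. Proof. by rewrite invr_gt0. Qed.

Let inve_le m n : (m <= n)%N -> inve n <= inve m.
Proof. by move=> mn; rewrite lef_pV2 ?posrE// ler_nat. Qed.

Let inve_small (r : R) : 0 < r -> exists N, inve N < r.
Proof.
move=> r0; exists (Num.truncn r^-1); rewrite invf_plt ?posrE//.
exact: truncnS_gt.
Qed.

Section Diagonal.
Context (c : nat -> C) (K : R).
Hypothesis K0 : 0 < K.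
(* The right-hand sides telescope, so the tails of the series below are explicit. *)
Hypothesis c_le : forall k, `|c k| <= (K * (inve k - inve k.+1))%:C%C.

Let term x k := (c k * ip x (e k)) *: e k.

Lemma diag_block m n x : (m <= n)%N ->
  `|\sum_(m <= k < n) term x k| <= (K * inve m)%:C%C * `|x|.
Proof.
move=> mn; apply: le_trans (ler_norm_sum _ _ _) _.
apply: le_trans (_ : \sum_(m <= k < n) (K * (inve k - inve k.+1))%:C%C * `|x| <= _).
  apply: ler_sum => k _; rewrite normrZ (orthonormal_norm hip)// mulr1 normrM.
  by rewrite ler_pM// (ip_basis_le hip).
rewrite -mulr_suml ler_wpM2r// -rmorph_sum lecR -mulr_sumr ler_pM2l//.
have -> : \sum_(m <= k < n) (inve k - inve k.+1) = - inve n + inve m.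
  rewrite -[LHS]opprK -sumrN (eq_bigr (fun k => inve k.+1 - inve k)); last first.
    by move=> k _; rewrite opprB.
  by rewrite telescope_sumr// opprB addrC.
by rewrite gerDr oppr_le0 ltW.
Qed.

Definition diag (x : H) : H := limn (series (term x)).

Lemma diag_cvg x : series (term x) @ \oo --> diag x.
Proof.
apply/cauchy_cvgP/cauchy_seriesP => r /posC_real[{}r r0 ->].
have [b b0 xb] := normC_real x.
have Kb : 0 < K * (b + 1) by rewrite mulr_gt0// ltr_wpDl.
have [N Nr] := inve_small (divr_gt0 r0 Kb).
exists ([set n | (N <= n)%N], [set n | (N <= n)%N]) => /=.
  by split; exact: nbhs_infty_ge.
move=> [m n] /= [Nm Nn]; have [mn|/ltnW nm] := leqP m n; last first.
  by rewrite big_geq// normr0 ltcR.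
apply: le_lt_trans (diag_block x mn) _; rewrite xb -rmorphM ltcR.
apply: le_lt_trans (_ : inve N * (K * (b + 1)) < r); last by rewrite -ltr_pdivlMr.
by rewrite mulrCA mulrA ler_pM ?mulr_ge0 ?ler_pM2l ?lerDl// ?inve_le// ltW.
Qed.

Lemma diag_coord x k : ip (diag x) (e k) = c k * ip x (e k).
Proof.
have h : (fun n => ip (series (term x) n) (e k)) @ \oo --> ip (diag x) (e k).
  by apply: (cvg_ipl hip); exact: diag_cvg.
apply: (normed_cvg_unique h).
apply: cvg_eps => r r0; near=> n.
have kn : (k < n)%N by near: n; exact: nbhs_infty_gt.
rewrite /series /= /term ip_lin_comb// kn subrr normr0 ltcR//.
Unshelve. all: by end_near. Qed.

Lemma diag_linear : linear diag.
Proof.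
move=> a x y; apply: (coord_inj hip e_ortho e_dense) => k.
by rewrite diag_coord !ipDl !ipZl !diag_coord; ring.
Qed.

Lemma diag_tail N x :
  `|diag x - fourier_sum ip e N (diag x)| <= (K * inve N)%:C%C * `|x|.
Proof.
have [b b0 xb] := normC_real x; rewrite xb -rmorphM.
have h : (fun n => series (term x) n - fourier_sum ip e N (diag x)) @ \oo -->
    diag x - fourier_sum ip e N (diag x).
  by apply: cvgB; [exact: diag_cvg|exact: cvg_cst].
apply: (cvg_norm_le (b := K * inve N * b) h); near=> n.
have Nn : (N <= n)%N by near: n; exact: nbhs_infty_ge.
have -> : (K * inve N * b)%:C%C = (K * inve N)%:C%C * `|x|.
  by rewrite xb -rmorphM.
apply: le_trans (diag_block x Nn).
rewrite /= /series /= /fourier_sum (@big_cat_nat _ _ _ N)//= addrAC.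
rewrite (_ : _ - _ = 0) ?add0r//; apply/eqP; rewrite subr_eq0; apply/eqP.
by apply: eq_bigr => k _; rewrite diag_coord.
Unshelve. all: by end_near. Qed.

Lemma diag_bounded : bounded_operator diag.
Proof.
split; first exact: diag_linear.
exists (K * inve 0) => x.
by have := diag_tail 0 x; rewrite /fourier_sum big_geq// subr0.
Qed.

(** On the image of the unit ball the Fourier remainders are uniformly small, and each of the
    finitely many remaining coordinates is bounded: hence an ultrafilter on the closure of
    this image is Cauchy. *)
Lemma diag_compact : compact_operator diag.
Proof.
split; first exact: diag_linear.
rewrite precompactE compact_ultra => F UF FK.
have FF : ProperFilter F by exact: ultra_proper.
have tail N x : closure (diag @` [set x | `|x| <= 1]) x ->
    `|x - fourier_sum ip e N x| <= (K * inve N)%:C%C.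
  rewrite closureEcvg => -[G PG [Gx GB]].
  have h : (fun y => y - fourier_sum ip e N y) @ G --> x - fourier_sum ip e N x.
    apply: cvgB => //; apply: cvg_lin_comb => k; exact: (cvg_ipl hip).
  apply: (cvg_norm_le h); apply: GB => y [z /= z1 <-].
  apply: le_trans (diag_tail _ _) _; rewrite -[leRHS]mulr1 ler_wpM2l//.
  by rewrite lecR mulr_ge0 ?ltW.
have coordF k : exists a : C, (fun x => ip x (e k)) @ F --> a.
  apply: (@ultra_bounded_lim _ _ _ UF _ (K * inve 0)).
  apply: filterS FK => x Kx /=; apply: le_trans (ip_basis_le hip e_ortho _ _) _.
  by have := tail 0 x Kx; rewrite /fourier_sum big_geq// subr0.
have /choice [a Fa] := coordF.
suff /cvg_ex [l Fl] : cvg F.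
  by exists l; split => //; apply: closed_cvg FK _ Fl; exact: closed_closure.
apply/cauchy_cvgP/cauchy_exP => r /posC_real[{}r r0 ->].
have r2 : 0 < r / 2 by rewrite divr_gt0.
have [N Nr] := inve_small (divr_gt0 r2 K0).
exists (\sum_(0 <= k < N) a k *: e k).
have h : (fun y => fourier_sum ip e N y) @ F --> \sum_(0 <= k < N) a k *: e k.
  by apply: cvg_lin_comb => k; exact: Fa.
have r2C : 0 < (r / 2)%:C%C :> C by rewrite ltcR.
move/cvgrPdist_lt : h => /(_ _ r2C) h.
apply: filterS2 h FK => x hx Kx; rewrite -ball_normE /=.
rewrite -(subrK (fourier_sum ip e N x) (\sum_(_ <= _ < _) _)) -addrA.
rewrite (le_lt_trans (ler_normD _ _))// (splitr r) rmorphD ltrD//.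
rewrite -normrN opprB (le_lt_trans (tail N x Kx))// ltcR mulrC -ltr_pdivlMr//.
Qed.

End Diagonal.
End DiagonalOperators.

Lemma cvg_ge0 (R : realType) (T : Type) (F : set_system T) {FF : ProperFilter F}
    (f : T -> R[i]) (l : R[i]) :
  f @ F --> l -> (forall t, 0 <= f t) -> 0 <= l.
Proof.
move=> /cvgrPdist_lt fl f0; rewrite lecE /=; apply/andP; split.
  apply/negP => /negP l0; have e0 : 0 < `|complex.Im l|%:C%C :> R[i].
    by rewrite ltcR normr_gt0.
  have [t lt] := filter_ex (fl _ e0); have := le_lt_trans (normc_ge_Im _) lt.
  have : complex.Im (f t) = 0 by have := f0 t; rewrite lecE => /andP[/eqP].
  by case: (f t) (l) => a b [c q] /= ->; rewrite ltcR subr0 ltxx.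
rewrite leNgt; apply/negP => l0.
have e0 : 0 < (- complex.Re l)%:C%C :> R[i] by rewrite ltcR oppr_gt0.
have [t lt] := filter_ex (fl _ e0); have := le_lt_trans (normc_ge_Re _) lt.
have : 0 <= complex.Re (f t) by have := f0 t; rewrite lecE => /andP[].
case: (f t) (l) l0 => a b [c q] /= c0 a0; rewrite ltcR ltNge => /negP; apply.
by rewrite ler0_norm ?opprB ?lerDr// subr_le0 ltW// (lt_le_trans c0).
Qed.

Lemma dense_closure (R : realType) (V : normedModType R[i]) (S : set V) :
  (forall (x : V) (r : R), 0 < r -> exists2 y, S y & `|x - y| < r%:C%C) ->
  closure S = setT.
Proof.
move=> h; apply/seteqP; split => // x _ B /nbhs_ballP[r /= /posC_real[{}r r0 ->] rB].
by have [y Sy xy] := h x r r0; exists y; split => //; apply: rB; rewrite -ball_normE.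
Qed.

Lemma cvg_ext (T : Type) (V : topologicalType) (F : set_system T) (f h : T -> V) (l : V) :
  f @ F --> l -> f =1 h -> h @ F --> l.
Proof. by move=> fl /funext <-. Qed.

Section BoundedOperators.
Context (R : realType) (H : completeNormedModType R[i]).
Local Notation C := R[i].

Lemma bounded_cvg (T : H -> H) (s : nat -> H) (x : H) : bounded_operator T ->
  s @ \oo --> x -> T \o s @ \oo --> T x.
Proof.
move=> [T_lin [K TK]] sx; apply: cvg_eps => e e0.
have [r r0 rK] : exists2 r : R, 0 < r & forall y, `|T y| <= r%:C%C * `|y|.
  exists (`|K| + 1); first by rewrite ltr_wpDl.
  move=> y; apply: le_trans (TK y) _; apply: ler_wpM2r => //.
  by rewrite lecR (le_trans (ler_norm K))// lerDl.
have er : 0 < (e / r)%:C%C :> C by rewrite ltcR divr_gt0.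
move/cvgrPdist_lt: sx => /(_ _ er); apply: filterS => n lt.
have -> : T x - (T \o s) n = T (x - s n).
  by have := T_lin (-1) (s n) x; rewrite !scaleN1r [- s n + _]addrC [- T _ + _]addrC.
apply: le_lt_trans (rK _) _.
have rC : 0 < r%:C%C :> C by rewrite ltcR.
by rewrite -ltr_pdivlMl// mulrC -RtoCV -RtoCM.
Qed.

Lemma dense_cvg (S : set H) (x : H) : closure S = setT ->
  exists s : nat -> H, (forall n, S (s n)) /\ s @ \oo --> x.
Proof.
move=> dS; have ex n : exists y, S y /\ `|x - y| < (n.+1%:R^-1)%:C%C.
  have : closure S x by rewrite dS.
  have n0 : 0 < (n.+1%:R^-1)%:C%C :> C by rewrite ltcR invr_gt0.
  by move=> /(_ _ (nbhsx_ballx x _ n0))[y [Sy]]; rewrite -ball_normE => xy; exists y.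
exists (fun n => projT1 (cid (ex n))); split=> [n|].
  by case: (projT2 (cid (ex n))).
apply: cvg_eps => e e0; near=> n; apply: lt_trans (projT2 (cid (ex n))).2 _.
rewrite ltcR; near: n; exact: near_infty_natSinv_lt (PosNum e0).
Unshelve. all: by end_near.
Qed.

End BoundedOperators.

(** * Operators with eigenvalues of cubic growth *)

Section DiracOperator.
Context (R : realType) (H : completeNormedModType R[i]).
Context (ip : {dot H for (@Num.conj R[i])}).
Hypothesis hip : hilbert_norm ip.
Local Notation C := R[i].
Context (e : nat -> H).
Hypothesis e_ortho : forall i j, ip (e i) (e j) = (i == j)%:R.
Hypothesis e_dense : forall (x : H) (r : R), 0 < r ->
  exists n y, fourier_sum ip e n y = y /\ `|x - y| < r%:C%C.
Context (d N : nat -> nat) (P : nat -> H -> H).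
Hypothesis d0 : (0 < d 0)%N.
Hypothesis d_mono : forall n, (d n < d n.+1)%N.
Hypothesis dN : forall n, (d n <= N n)%N.
Hypothesis P_fourier : forall n x, P n x = fourier_sum ip e (d n) x.

Let lam n : C := ((N n) ^ 3)%:R.

Definition spectral_term (x : H) (n : nat) : H :=
  if n is m.+1 then lam n *: (P n x - P m x) else lam 0 *: P 0 x.

Definition spectral_op : operator H :=
  Operator [set x | cvgn (series (spectral_term x))]
           (fun x => limn (series (spectral_term x))).

Local Notation D := spectral_op.

Let d_ge n : (n < d n)%N.
Proof. by elim: n => // n IH; exact: leq_trans (d_mono n). Qed.

Let ex_block k : exists n, (k < d n)%N. Proof. by exists k. Qed.

(** The index n such that e k is orthogonal to the range of P m for m < n, and lies in the
    range of P n. *)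
Definition block k := ex_minn (ex_block k).

Let d_le m n : (m <= n)%N -> (d m <= d n)%N.
Proof. by move=> mn; apply: (homo_leq leqnn leq_trans) mn => i; exact: ltnW. Qed.

Lemma blockP n k : (d n <= k < d n.+1)%N -> block k = n.+1.
Proof.
rewrite /block; case: ex_minnP => m km mmin /andP[nk kn].
apply/eqP; rewrite eqn_leq mmin//= ltnNge; apply/negP => mn.
by have := leq_trans km (leq_trans (d_le mn) nk); rewrite ltnn.
Qed.

Lemma block0 k : (k < d 0)%N -> block k = 0%N.
Proof.
rewrite /block; case: ex_minnP => m km mmin k0.
by apply/eqP; rewrite -leqn0 mmin.
Qed.

Definition eigen k : R := ((N (block k)) ^ 3)%:R.

(** If e k belongs to block m, then k < d m <= N m. *)
Lemma eigen_ge k : (k.+1 ^ 3)%:R <= eigen k.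
Proof.
rewrite /eigen ler_nat leq_exp2r// /block; case: ex_minnP => m km _.
exact: leq_trans (dN m).
Qed.

Lemma lam_block k : lam (block k) = (eigen k)%:C%C.
Proof. by rewrite /eigen rmorph_nat. Qed.

Lemma series_spectral x n : series (spectral_term x) n.+1 =
  \sum_(0 <= k < d n) ((eigen k)%:C%C * ip x (e k)) *: e k.
Proof.
elim: n => [|n IH]; rewrite /series /= big_nat_recr//=.
  rewrite big_geq// add0r P_fourier /fourier_sum scaler_sumr.
  by apply: eq_big_nat => k /block0 bk; rewrite scalerA -lam_block bk.
rewrite [X in X + _]IH (@big_cat_nat _ _ _ (d n) 0 (d n.+1))//=; last exact: ltnW.
congr (_ + _); rewrite !P_fourier /fourier_sum.
rewrite (@big_cat_nat _ _ _ (d n) 0 (d n.+1))//=; last exact: ltnW.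
rewrite addrAC subrr add0r scaler_sumr.
by apply: eq_big_nat => k /blockP bk; rewrite scalerA -lam_block bk.
Qed.

(** The domain of the operator is maximal: the partial sums of the series are Fourier sums of
    z, so they converge as soon as z exists. *)
Lemma spectral_op_intro y z :
  (forall k, ip z (e k) = (eigen k)%:C%C * ip y (e k)) ->
  op_dom D y /\ op_fun D y = z.
Proof.
move=> yz; suff h : series (spectral_term y) @ \oo --> z.
  split; first by apply/cvg_ex; exists z.
  by apply: cvg_lim h; exact: norm_hausdorff.
rewrite -cvg_shiftS /=.
under eq_fun do rewrite series_spectral.
apply: cvg_eps => r r0.
have /cvgrPdist_lt /(_ r%:C%C) := @fourier_sum_cvg _ _ ip hip e e_ortho e_dense z.
rewrite ltcR => /(_ r0) [n _ nr]; exists n => // m /= nm.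
rewrite (eq_bigr (fun k => ip z (e k) *: e k)); last by move=> k _; rewrite yz.
exact: nr (d m) (leq_trans nm (ltnW (d_ge m))).
Qed.

Lemma spectral_op_coord y k : op_dom D y ->
  ip (op_fun D y) (e k) = (eigen k)%:C%C * ip y (e k).
Proof.
move=> yD; have h : (fun n => ip (series (spectral_term y) n.+1) (e k)) @ \oo -->
    ip (op_fun D y) (e k).
  apply: (cvg_ipl hip); have := yD; rewrite /= -cvg_shiftS; exact.
apply: (normed_cvg_unique h); apply: cvg_eps => r r0.
exists k => // n /= kn; rewrite series_spectral ip_lin_comb//.
by rewrite (leq_ltn_trans kn (d_ge n)) subrr normr0 ltcR.
Qed.

Lemma spectral_op_e k : op_dom D (e k) /\ op_fun D (e k) = (eigen k)%:C%C *: e k.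
Proof.
apply: spectral_op_intro => j; rewrite ipZl !e_ortho.
by have [->//|] := eqVneq k j; rewrite ?mulr0.
Qed.

Let coord_inj' := coord_inj hip e_ortho e_dense.

Lemma spectral_op_fourier n x : op_dom D (fourier_sum ip e n x).
Proof.
apply: (spectral_op_intro (z := \sum_(0 <= k < n) ((eigen k)%:C%C * ip x (e k)) *: e k) _).1.
by move=> k; rewrite !ip_lin_comb//; case: ifP => //; rewrite mulr0.
Qed.

Let conj_real (a : R) : (a%:C%C)^* = a%:C%C :> C.
Proof. by apply/CrealP; rewrite complex_real. Qed.

Let conjM (a b : C) : (a * b)^* = a^* * b^*.
Proof. exact: rmorphM. Qed.

(** For a pair (y, z) in the graph of the adjoint, testing against e k gives the coordinates
    of z, and maximality of the domain concludes. *)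
Lemma spectral_op_self_adjoint : self_adjoint ip D.
Proof.
split.
  split.
  - by apply: (spectral_op_intro (z := 0) _).1 => k; rewrite !ip0l mulr0.
  - move=> c x y xD yD; apply: spectral_op_intro => k.
    by rewrite !ipDl !ipZl !spectral_op_coord//; ring.
  - apply: dense_closure => x r r0; have [n [y [yn xy]]] := e_dense x r0.
    by exists y => //; rewrite -yn; exact: spectral_op_fourier.
move=> y z; split => [h|[yD <-] x xD].
  apply: spectral_op_intro => k.
  have [ekD De] := spectral_op_e k; have := h _ ekD; rewrite De ipZl => yz.
  by rewrite (ipC ip z) -yz conjM conj_real -ipC.
have h1 : (fun n => ip (fourier_sum ip e n (op_fun D x)) y) @ \oo --> ip (op_fun D x) y.
  by apply: (cvg_ipl hip); exact: fourier_sum_cvg.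
have h2 : (fun n => ip x (fourier_sum ip e n (op_fun D y))) @ \oo --> ip x (op_fun D y).
  by apply: (cvg_ipr hip); exact: fourier_sum_cvg.
apply: (normed_cvg_unique h1); rewrite (_ : (fun _ => _) = fun n => ip x (fourier_sum ip e n (op_fun D y)))//.
apply/funext => n; rewrite ip_suml ip_sumr; apply: eq_bigr => k _.
rewrite ipZl ipZr !spectral_op_coord// conjM conj_real -(ipC ip (e k) y).
by ring.
Qed.

Lemma spectral_op_unbounded : unbounded D.
Proof.
move=> [M h]; pose k := Num.truncn `|M|.
have [ekD De] := spectral_op_e k; have := h _ ekD.
rewrite De normrZ (orthonormal_norm hip)// !mulr1 normc_def /= expr0n addr0 sqrtr_sqr lecR.
rewrite ger0_norm ?ler0n// => kM; have := le_trans (eigen_ge k) kM.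
apply/negP; rewrite -ltNge (le_lt_trans (ler_norm M))//.
apply: lt_le_trans (truncnS_gt _) _; rewrite ler_nat.
by rewrite -{1}(expn1 k.+1) leq_pexp2l.
Qed.

Let telescoping_bound (a K : R) k : a * (k.+1%:R * k.+2%:R) <= K ->
  a <= K * (k.+1%:R^-1 - k.+2%:R^-1).
Proof.
have k1 : 0 < k.+1%:R :> R by [].
have k2 : 0 < k.+2%:R :> R by [].
move=> aK; have -> : k.+1%:R^-1 - k.+2%:R^-1 = (k.+1%:R * k.+2%:R)^-1 :> R.
  have -> : k.+2%:R = k.+1%:R + 1 :> R by rewrite natr1.
  move: (k.+1%:R) k1 => q q0; field.
  by apply/andP; split; rewrite gt_eqF// addr_gt0.
by rewrite ler_pdivlMr// mulr_gt0.
Qed.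

Let poly_bound k : k.+1%:R * k.+2%:R <= 2 * k.+1%:R ^+ 2 :> R.
Proof.
by rewrite expr2 mulrCA ler_pM2l// -natrM ler_nat; lia.
Qed.

Lemma spectral_op_compact_resolvent : compact_resolvent D.
Proof.
move=> z z0.
have [A A0 zA] := normC_real z.
pose b := `|complex.Im z|; have b0 : 0 < b by rewrite normr_gt0.
(* K serves for lambda <= 2|z|, by |lambda - z| >= |Im z|, and for the other lambda, by
   |lambda - z| >= lambda / 2 *)
pose K := 4 + 4 * A / b; have K0 : 0 < K.
  by rewrite ltr_pwDl// divr_ge0 ?mulr_ge0// ltW.
pose c k : C := ((eigen k)%:C%C - z)^-1.
have lz k : (eigen k)%:C%C - z != 0.
  apply: contraNneq z0 => /eqP; rewrite subr_eq0 => /eqP <- /=; exact: eqxx.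
have c_le k : `|c k| <= (K * (k.+1%:R^-1 - k.+2%:R^-1))%:C%C.
  have [r r0 lr] := normC_real ((eigen k)%:C%C - z).
  have rb : b <= r.
    rewrite -lecR -lr; apply: le_trans (normc_ge_Im _).
    by rewrite /b lecR; case: (z) => p q /=; rewrite sub0r normrN.
  have r_gt0 : 0 < r := lt_le_trans b0 rb.
  have rA : eigen k - A <= r.
    rewrite lerBlDr -lecR RtoCD -zA -lr.
    have E : (eigen k)%:C%C = `|(eigen k)%:C%C - z + z|.
      by rewrite subrK normc_def /= expr0n addr0 sqrtr_sqr ger0_norm// ler0n.
    rewrite [leLHS]E.
    exact: ler_normD.
  rewrite /c normfV lr -RtoCV lecR; apply: telescoping_bound.
  rewrite mulrC ler_pdivrMr//; apply: le_trans (poly_bound k) _.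
  have ek : k.+1%:R ^+ 2 <= eigen k.
    by apply: le_trans (eigen_ge k); rewrite -natrX ler_nat leq_pexp2l.
  have [eA|Ae] := leP (eigen k) (2 * A).
    apply: le_trans (_ : 4 * A / b * r <= _).
      apply: le_trans (_ : 4 * A <= _).
        by rewrite (le_trans (ler_wpM2l _ (le_trans ek eA)))// mulrA -natrM.
      by rewrite -mulrA ler_peMr ?mulr_ge0// mulrC ler_pdivlMr// mul1r.
    by rewrite ler_wpM2r ?lerDr// ltW.
  apply: le_trans (_ : 4 * r <= _); last first.
    by rewrite ler_wpM2r ?lerDl ?divr_ge0 ?mulr_ge0// ltW.
  by lra.
exists (diag ip e c); split.
- exact: (diag_compact hip e_ortho e_dense K0 c_le).
- move=> y; set T := diag ip e c y.
  have [TD DT] : op_dom D T /\ op_fun D T = y + z *: T.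
    apply: spectral_op_intro => k; rewrite ipDl ipZl.
    rewrite !(diag_coord hip e_ortho K0 c_le) /c.
    rewrite mulrA -[X in X + _]mul1r -(divff (lz k)) -!mulrA -mulrDl.
    by rewrite subrK.
  by rewrite DT addrK.
- move=> x xD; apply: coord_inj' => k.
  rewrite (diag_coord hip e_ortho K0 c_le) ipBl ipZl spectral_op_coord//.
  by rewrite -mulrBl /c mulKf.
Qed.

Let c k : R := (Num.sqrt (1 + eigen k ^+ 2))^-1.

Let rt_gt0 k : 0 < Num.sqrt (1 + eigen k ^+ 2).
Proof. by rewrite sqrtr_gt0 ltr_pwDl// sqr_ge0. Qed.

Let c_gt0 k : 0 < c k.
Proof. by rewrite invr_gt0. Qed.

Let eigen_ge0 k : 0 <= eigen k.
Proof. by rewrite ler0n. Qed.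

Let eigen_le k : eigen k <= Num.sqrt (1 + eigen k ^+ 2).
Proof.
by rewrite -{1}(ger0_norm (eigen_ge0 k)) -sqrtr_sqr ler_wsqrtr// lerDr.
Qed.

Let c_bound k : c k <= 2 * (k.+1%:R^-1 - k.+2%:R^-1).
Proof.
apply: telescoping_bound; rewrite mulrC ler_pdivrMr//.
apply: le_trans (poly_bound k) _; rewrite ler_pM2l//.
apply: le_trans (eigen_le k); apply: le_trans (eigen_ge k).
by rewrite -natrX ler_nat leq_pexp2l.
Qed.

Let c_sqr k : (1 + eigen k ^+ 2) * c k ^+ 2 = 1.
Proof.
rewrite /c exprVn sqr_sqrtr ?divff// ?gt_eqF//.
  by rewrite ltr_pwDl// sqr_ge0.
by rewrite addr_ge0// sqr_ge0.
Qed.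

Let cC k : C := (c k)%:C%C.

Let cC_bound k : `|cC k| <= (2 * (k.+1%:R^-1 - k.+2%:R^-1))%:C%C.
Proof.
by rewrite normc_def /= expr0n addr0 sqrtr_sqr lecR ger0_norm ?c_bound// ltW.
Qed.

Let two0 : 0 < 2 :> R. Proof. by []. Qed.

Let B := diag ip e cC.

Let B_coord x k : ip (B x) (e k) = cC k * ip x (e k).
Proof. exact: (diag_coord hip e_ortho two0 cC_bound). Qed.

Lemma spectral_op_inv_sqrt : inv_sqrt_one_plus_sq ip D B.
Proof.
have cE k : (1 + (eigen k)%:C%C ^+ 2) * cC k ^+ 2 = 1.
  transitivity ((1 + eigen k ^+ 2) * c k ^+ 2)%:C%C; last by rewrite c_sqr.
  by rewrite RtoCM RtoCD !expr2 !RtoCM.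
split.
- exact: (diag_bounded hip e_ortho e_dense two0 cC_bound).
- move=> x.
  have h : (fun n => ip (fourier_sum ip e n (B x)) x) @ \oo --> ip (B x) x.
    by apply: (cvg_ipl hip); exact: fourier_sum_cvg.
  apply: cvg_ge0 h _ => n; rewrite ip_suml sumr_ge0// => k _.
  rewrite ipZl B_coord -mulrA mulr_ge0//; first by rewrite lecR ltW.
  by rewrite (ipC ip (e k)) mul_conjC_ge0.
- move=> y.
  (* the coefficients of D B^2, at most those of B since lambda c <= 1 *)
  pose q k : C := (eigen k)%:C%C * cC k ^+ 2.
  have q_le k : `|q k| <= (2 * (k.+1%:R^-1 - k.+2%:R^-1))%:C%C.
    apply: le_trans (cC_bound k); rewrite normrM expr2 normrM mulrA.
    rewrite ler_piMl// -normrM -RtoCM normc_def /= expr0n addr0 sqrtr_sqr.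
    have : `|eigen k * c k| <= 1.
      rewrite ger0_norm ?mulr_ge0 ?(ltW (c_gt0 k))// ler_pdivrMr// mul1r.
      exact: eigen_le.
    by rewrite -lecR.
  pose w := diag ip e q y.
  have [BD BE] : op_dom D (B (B y)) /\ op_fun D (B (B y)) = w.
    apply: spectral_op_intro => k; rewrite (diag_coord hip e_ortho two0 q_le).
    by rewrite !B_coord /q expr2 !mulrA.
  have [wD wE] : op_dom D w /\ op_fun D w = y - B (B y).
    apply: spectral_op_intro => k; rewrite (diag_coord hip e_ortho two0 q_le).
    rewrite ipBl !B_coord -[X in X - _]mul1r -(cE k) /q; ring.
  by rewrite BE wE addrC subrK.
- move=> x xD DxD; apply: coord_inj' => k.
  rewrite !B_coord ipDl !spectral_op_coord// -[RHS]mul1r -(cE k); ring.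
Qed.

Lemma orthonormal_injective : injective e.
Proof.
move=> i j eij; apply/eqP; apply: contraT => /negbTE ij.
have := e_ortho i j; rewrite eij e_ortho eqxx ij => /eqP.
by rewrite oner_eq0.
Qed.

Lemma orthonormal_sequence_basis : orthonormal_basis ip (range e).
Proof.
split.
- by move=> _ [k _ <-]; rewrite e_ortho eqxx.
- move=> _ _ [k _ <-] [j _ <-] kj; rewrite e_ortho.
  by case: eqVneq kj => // ->.
- apply: dense_closure => x r r0; have [n [y [yn xy]]] := e_dense x r0.
  exists y => //; exists n, (fun i : 'I_n => ip y (e i)), (fun i : 'I_n => e i).
  by split; [move=> i; exists i|rewrite -{1}yn /fourier_sum big_mkord].
Qed.

Lemma spectral_op_one_summable : one_summable ip D.
Proof.
exists B; first exact: spectral_op_inv_sqrt.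
exists (range e); first exact: orthonormal_sequence_basis.
have BE k : (complex.Re (ip (B (e k)) (e k)))%:E = (c k)%:E.
  by rewrite B_coord e_ortho eqxx mulr1.
rewrite (@esum_image _ _ _ setT); last by move=> i j _ _; exact: orthonormal_injective.
under eq_esum do rewrite BE.
rewrite -nneseries_esumT; last by move=> k; rewrite lee_fin ltW.
apply: (@le_lt_trans _ _ 2%:E); last by rewrite ltry.
apply: lime_le.
  by apply: is_cvg_nneseries => k _ _; rewrite lee_fin ltW.
apply: nearW => n; rewrite sumEFin lee_fin.
apply: le_trans (_ : \sum_(0 <= k < n) 2 * (k.+1%:R^-1 - k.+2%:R^-1) <= _).
  by apply: ler_sum => k _; exact: c_bound.
rewrite -mulr_sumr ger_pMr//.
rewrite (_ : \sum_(0 <= k < n) _ = 1 - n.+1%:R^-1) ?gerBl//.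
elim: n => [|n IH]; first by rewrite big_geq// invr1 subrr.
by rewrite big_nat_recr//= IH addrA subrK.
Qed.

(** The terms of index above m of the series for D commute with T, so [D, T] is the commutator
    of T with the partial sum up to m, a bounded operator. *)
Lemma spectral_op_commutator (T : H -> H) m : bounded_operator T ->
  (forall n x, (m <= n)%N -> P n (T x) = T (P n x)) ->
  bounded_commutator D T.
Proof.
move=> bT PT; have [T_lin [M TM]] := bT.
have TB x y : T (x - y) = T x - T y.
  by rewrite addrC -scaleN1r T_lin scaleN1r addrC.
have TD x y : T (x + y) = T x + T y.
  by rewrite -{1}[x]scale1r T_lin scale1r.
have TZ a x : T (a *: x) = a *: T x.
  have T0 : T 0 = 0 by have := TB 0 0; rewrite !subrr.
  by rewrite -[a *: x]addr0 T_lin T0 addr0.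
pose Dm x := series (spectral_term x) m.+1.
pose K := \sum_(0 <= k < d m) eigen k.
have DmK x : `|Dm x| <= K%:C%C * `|x|.
  rewrite /Dm series_spectral (le_trans (ler_norm_sum _ _ _))//.
  rewrite (_ : K%:C%C = \sum_(0 <= k < d m) (eigen k)%:C%C); last exact: rmorph_sum.
  rewrite mulr_suml ler_sum// => k _; rewrite normrZ (orthonormal_norm hip)// mulr1 normrM.
  rewrite normc_def /= expr0n addr0 sqrtr_sqr ger0_norm// ler_wpM2l ?lecR//.
  exact: (ip_basis_le hip).
have TM' x : `|T x| <= `|M|%:C%C * `|x|.
  by apply: le_trans (TM x) _; rewrite ler_wpM2r// lecR ler_norm.
have M0 : 0 <= K by apply: sumr_ge0.
have T_cvg (u : nat -> H) l : u @ \oo --> l -> (fun n => T (u n)) @ \oo --> T l.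
  exact: bounded_cvg.
have tail n x : (m <= n)%N -> series (spectral_term (T x)) n.+1 =
    Dm (T x) + (T (series (spectral_term x) n.+1) - T (Dm x)).
  elim: n => [|n IH]; first by rewrite leqn0 /Dm => /eqP ->; rewrite subrr addr0.
  rewrite leq_eqVlt => /orP[/eqP <-|]; first by rewrite subrr addr0.
  rewrite ltnS => mn.
  have tt : spectral_term (T x) n.+1 = T (spectral_term x n.+1).
    by rewrite /= !PT ?leqW// -TB -TZ.
  by rewrite seriesSr (IH mn) [in RHS]seriesSr TD tt -!addrA; congr (_ + (_ + _)); rewrite addrC.
have Dx_cvg x : op_dom D x ->
    series (spectral_term (T x)) @ \oo --> Dm (T x) + (T (op_fun D x) - T (Dm x)).
  move=> xD; rewrite -cvg_shiftS.
  have h : (fun n => Dm (T x) + (T (series (spectral_term x) n.+1) - T (Dm x))) @ \oo -->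
      Dm (T x) + (T (op_fun D x) - T (Dm x)).
    apply: cvgD; first exact: cvg_cst.
    apply: cvgB; last exact: cvg_cst.
    by apply: T_cvg; have := xD; rewrite /= -cvg_shiftS; exact.
  apply: cvg_trans h; apply: near_eq_cvg; exists m => // n /= mn.
  by rewrite tail.
split; first by move=> x /Dx_cvg h; apply/cvg_ex; eexists; exact: h.
exists (K * `|M| + `|M| * K) => x xD.
have -> : op_fun D (T x) = Dm (T x) + (T (op_fun D x) - T (Dm x)).
  by apply: cvg_lim (Dx_cvg x xD); exact: norm_hausdorff.
rewrite addrCA addrAC subrr add0r RtoCD mulrDl (le_trans (ler_normB _ _))// lerD//.
  apply: le_trans (DmK _) _; rewrite RtoCM -mulrA ler_wpM2l ?lecR// TM'.
by apply: le_trans (TM' _) _; rewrite RtoCM -mulrA ler_wpM2l ?lecR// DmK.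
Qed.

End DiracOperator.

(** * Gram-Schmidt bases adapted to a chain of subspaces *)

Section GramSchmidt.
Context (R : realType) (H : completeNormedModType R[i]).
Context (ip : {dot H for (@Num.conj R[i])}).
Hypothesis hip : hilbert_norm ip.
Local Notation C := R[i].
Implicit Types (L : seq H) (v x : H).

Definition list_proj L x : H := \sum_(u <- L) ip x u *: u.

Definition orthonormal_list L : Prop :=
  forall i j, (i < size L)%N -> (j < size L)%N -> ip L`_i L`_j = (i == j)%:R.

Lemma list_proj_fourier (e : nat -> H) L :
  (forall i, (i < size L)%N -> L`_i = e i) ->
  forall x, list_proj L x = fourier_sum ip e (size L) x.
Proof.
move=> Le x; rewrite /list_proj (big_nth 0) /fourier_sum.
by apply: eq_big_nat => i /andP[_ iL]; rewrite Le.
Qed.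

Lemma list_proj_ortho L x u : orthonormal_list L -> u \in L ->
  ip (x - list_proj L x) u = 0.
Proof.
move=> oL /(nthP 0)[j jL <-]; rewrite ipBl /list_proj ip_suml (big_nth 0) big_mkord.
rewrite (bigD1 (Ordinal jL)) //= ipZl oL// eqxx mulr1 big1 ?addr0 ?subrr// => i ij.
by rewrite ipZl oL// (_ : (i == j :> nat) = false) ?mulr0//; apply/negbTE.
Qed.

Definition gs_step L v : seq H :=
  let r := v - list_proj L v in
  if r == 0 then L else rcons L (`|r|^-1 *: r).

Lemma gs_step_orthonormal L v : orthonormal_list L -> orthonormal_list (gs_step L v).
Proof.
move=> oL; rewrite /gs_step; case: eqVneq => // r0; set r := v - _ in r0 *.
have nr : `|r| != 0 by rewrite normr_eq0.
have rL u : u \in L -> ip (`|r|^-1 *: r) u = 0.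
  by move=> uL; rewrite ipZl list_proj_ortho// mulr0.
have rr : ip (`|r|^-1 *: r) (`|r|^-1 *: r) = 1.
  by rewrite hip normrZ normfV normr_id mulVf// expr1n.
move=> i j; rewrite size_rcons !ltnS !nth_rcons => iL jL.
case: (ltngtP i (size L)) iL => // [iL|->] _.
  case: (ltngtP j (size L)) jL => // [jL|->] _; first exact: oL.
  by rewrite (ltn_eqF iL) (ip_eq0C (rL _ _))// mem_nth.
case: (ltngtP j (size L)) jL => // jL _.
by rewrite rL// mem_nth.
Qed.

Lemma gs_step_fix L v x : orthonormal_list L ->
  list_proj L x = x -> list_proj (gs_step L v) x = x.
Proof.
move=> oL Lx; rewrite /gs_step; case: eqVneq => // r0.
have rx : ip (v - list_proj L v) x = 0.
  rewrite -Lx {2}/list_proj ip_sumr big_seq big1// => u uL.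
  by rewrite ipZr list_proj_ortho ?mulr0.
set r := v - _ in r0 rx *.
rewrite /list_proj -cats1 big_cat big_seq1 /= -/(list_proj L x) Lx.
by rewrite (ip_eq0C (x := _ *: _)) ?scale0r ?addr0// ipZl rx mulr0.
Qed.

Lemma gs_step_self L v : orthonormal_list L -> list_proj (gs_step L v) v = v.
Proof.
move=> oL; rewrite /gs_step; case: eqVneq => [/eqP|r0].
  by rewrite subr_eq0 => /eqP.
set r := v - _ in r0 *; have nr : `|r| != 0 by rewrite normr_eq0.
rewrite {1}/list_proj -cats1 big_cat big_seq1 /= -/(list_proj L v) ipZr scalerA.
have -> : ip v r = `|r| ^+ 2.
  rewrite -hip -{1}(subrK (list_proj L v) v) -/r ipDl -[RHS]addr0; congr (_ + _).
  rewrite /list_proj ip_suml big_seq big1// => u uL.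
  by rewrite ipZl (ip_eq0C (list_proj_ortho v oL uL)) mulr0.
have -> : (`|r|^-1)^* = `|r|^-1 :> C by apply: geC0_conj; rewrite invr_ge0.
rewrite expr2 mulrA mulVf// mul1r divff// scale1r /r addrC subrK//.
Qed.

Definition subspace (W : set H) : Prop :=
  W 0 /\ forall (c : C) x y, W x -> W y -> W (c *: x + y).

Lemma subspace_sum W I (r : seq I) (P : pred I) (c : I -> C) (F : I -> H) :
  subspace W -> (forall i, P i -> W (F i)) -> W (\sum_(i <- r | P i) c i *: F i).
Proof.
move=> [W0 WD] WF; elim/big_ind: _ => // [x y Wx Wy|i Pi].
  by rewrite -[x]scale1r; exact: WD.
by rewrite -[_ *: _]addr0; apply: WD => //; exact: WF.
Qed.

Lemma lspan_subspace (S : set H) : subspace (lspan S).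
Proof.
split.
  exists 0%N, (fun=> 0), (fun=> 0); split; first by case.
  by rewrite big_ord0.
move=> c _ _ [m [a [s [Ss ->]]]] [n [b [t [St ->]]]].
exists (m + n)%N, (fun i : 'I_(m + n) => match fintype.split i with inl j => c * a j | inr j => b j end),
  (fun i : 'I_(m + n) => match fintype.split i with inl j => s j | inr j => t j end); split.
  by move=> i; case: splitP.
rewrite big_split_ord /= scaler_sumr; congr (_ + _); apply: eq_bigr => i _.
  by case: splitP => j /=; [move=> /val_inj <-; rewrite scalerA|have := ltn_ord i; lia].
by case: splitP => j /=; [have := ltn_ord j; lia|move=> /eqP; rewrite eqn_add2l => /eqP/val_inj <-].
Qed.

Lemma gs_step_sub W L v : subspace W -> {in L, forall u, W u} -> W v ->
  {in gs_step L v, forall u, W u}.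
Proof.
move=> sW WL Wv u; rewrite /gs_step; case: eqVneq => [_|_]; first exact: WL.
rewrite mem_rcons inE => /orP[/eqP ->|]; last exact: WL.
have [W0 WD] := sW; rewrite -[_ *: _]addr0; apply: (WD) => //.
rewrite addrC -scaleN1r; apply: (WD) => //.
by rewrite /list_proj big_seq; apply: subspace_sum.
Qed.

Definition gram_schmidt L vs : seq H := foldl gs_step L vs.

Lemma gram_schmidtP W L vs : subspace W -> orthonormal_list L ->
  {in L, forall u, W u} -> {in vs, forall u, W u} ->
  let L' := gram_schmidt L vs in
  [/\ orthonormal_list L', {in L', forall u, W u}, prefix L L',
      forall x, list_proj L x = x -> list_proj L' x = x &
      {in vs, forall x, list_proj L' x = x}].
Proof.
move=> sW; elim: vs L => [|v vs IH] L oL WL Wvs /=; first by split=> //; exact: prefix_refl.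
have Wv : W v by apply: Wvs; rewrite mem_head.
have [|||o WG p f s] := IH (gs_step L v).
- exact: gs_step_orthonormal.
- exact: gs_step_sub.
- by move=> u uvs; apply: Wvs; rewrite inE uvs orbT.
split=> //.
- apply: prefix_trans p; rewrite /gs_step; case: ifP => _; first exact: prefix_refl.
  exact: prefix_rcons.
- by move=> x Lx; apply: f; exact: gs_step_fix.
- move=> x; rewrite inE => /orP[/eqP ->|]; last exact: s.
  by apply: f; exact: gs_step_self.
Qed.

(** The matrix of the coordinates of L in b has a right inverse, formed by the inner products
    of b with L; so its rows are free, and there are at most n of them. *)
Lemma orthonormal_list_size L n (b : 'I_n -> H) : orthonormal_list L ->
  {in L, forall u, lspan (range b) u} -> (size L <= n)%N.
Proof.
move=> oL Lb; have spanb u : lspan (range b) u -> exists a : 'I_n -> C, u = \sum_i a i *: b i.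
  move=> [m [c [s [sb ->]]]]; have /choice[f fs] i : exists j, b j = s i.
    by have [j _ <-] := sb i; exists j.
  exists (fun j => \sum_(i | f i == j) c i).
  under [RHS]eq_bigr do rewrite scaler_suml.
  rewrite (partition_big f xpredT)//=; apply: eq_bigr => j _.
  by apply: eq_bigr => i /eqP <-; rewrite fs.
have /choice[a La] (i : 'I_(size L)) : exists a : 'I_n -> C, L`_i = \sum_j a j *: b j.
  by apply: spanb; apply: Lb; exact: mem_nth.
pose A := \matrix_(i < size L, j < n) a i j.
suff : row_free A by rewrite /row_free => /eqP <-; exact: rank_leq_col.
apply/row_freeP; pose G := \matrix_(j < n, i < size L) ip (b j) L`_i.
exists G; apply/matrixP => i j; rewrite !mxE -(oL i j)// La ip_suml.
by apply: eq_bigr => k _; rewrite !mxE ipZl.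
Qed.

End GramSchmidt.

(** Each list L n extends the previous one by the Gram-Schmidt process applied to a basis of
    W n; strictness of the chain makes the lengths d n grow. *)
Lemma adapted_orthonormal_sequence (R : realType) (H : completeNormedModType R[i])
    (ip : {dot H for (@Num.conj R[i])}) (hip : hilbert_norm ip)
    (W : nat -> set H) (N : nat -> nat) (b : forall n, 'I_(N n) -> H) :
  (forall n, lspan (range (b n)) = W n) -> (forall n, W n `<=` W n.+1) ->
  (forall n, exists2 x, W n.+1 x & ~ W n x) -> (exists2 x, W 0%N x & x != 0) ->
  exists (e : nat -> H) (d : nat -> nat),
    [/\ forall i j, ip (e i) (e j) = (i == j)%:R,
        (0 < d 0)%N /\ forall n, (d n < d n.+1)%N,
        forall n, (d n <= N n)%N &
        forall n x, W n x <-> fourier_sum ip e (d n) x = x].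
Proof.
move=> bW filtration_sub filtration_strict W0.
pose G n := [seq b n i | i <- enum 'I_(N n)].
pose L := fix L n := if n is m.+1 then gram_schmidt ip (L m) (G m.+1)
                     else gram_schmidt ip [::] (G 0%N).
have sW n : subspace (W n) by rewrite -bW; exact: lspan_subspace.
have GW n : {in G n, forall u, W n u}.
  move=> _ /mapP[i _ ->]; rewrite -bW; exists 1%N, (fun=> 1), (fun=> b n i).
  by split; [move=> _; exists i|rewrite big_ord1 scale1r].
have LP n : orthonormal_list ip (L n) /\ {in L n, forall u, W n u}.
  elim: n => [|n [oL WL]].
    by have [] := @gram_schmidtP _ _ ip hip (W 0%N) [::] (G 0%N) (sW _) _ _ (GW _).
  have WL' : {in L n, forall u, W n.+1 u} by move=> u /WL; exact: filtration_sub.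
  by have [] := @gram_schmidtP _ _ ip hip (W n.+1) (L n) (G n.+1) (sW _) oL WL' (GW _).
have oL n := (LP n).1; have WL n := (LP n).2.
have LG n : {in G n, forall x, list_proj ip (L n) x = x}.
  case: n => [|n].
    by have [] := @gram_schmidtP _ _ ip hip (W 0%N) [::] (G 0%N) (sW _) _ _ (GW _).
  have WL' : {in L n, forall u, W n.+1 u} by move=> u /WL; exact: filtration_sub.
  by have [] := @gram_schmidtP _ _ ip hip (W n.+1) (L n) (G n.+1) (sW _) (oL n) WL' (GW _).
have Lpre n : prefix (L n) (L n.+1).
  have WL' : {in L n, forall u, W n.+1 u} by move=> u /WL; exact: filtration_sub.
  by have [] := @gram_schmidtP _ _ ip hip (W n.+1) (L n) (G n.+1) (sW _) (oL n) WL' (GW _).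
have WP n x : W n x <-> list_proj ip (L n) x = x.
  split=> [|<-]; last first.
    by rewrite /list_proj big_seq; apply: subspace_sum => // u; exact: WL.
  rewrite -bW => -[m [c [s [sb ->]]]].
  have ls i : list_proj ip (L n) (s i) = s i.
    by apply: LG; have [j _ <-] := sb i; apply: map_f; rewrite mem_enum.
  rewrite {1}/list_proj; under eq_bigr do rewrite ip_suml scaler_suml.
  rewrite exchange_big /=; apply: eq_bigr => i _.
  rewrite -[in RHS]ls /list_proj scaler_sumr; apply: eq_bigr => u _.
  by rewrite ipZl scalerA.
pose d n := size (L n).
have d_mono n : (d n < d n.+1)%N.
  rewrite ltn_neqAle (size_prefix (Lpre n)) andbT; apply/negP => /eqP dd.
  have [x Wx nWx] := filtration_strict n; apply: nWx; apply/WP; move/WP: Wx.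
  have /prefixP[t Lt] := Lpre n; move: dd; rewrite /d Lt size_cat.
  by move=> /eqP; rewrite -[X in X == _]addn0 eqn_add2l eq_sym => /nilP ->; rewrite cats0.
have d0 : (0 < d 0)%N.
  rewrite lt0n; apply/negP => /nilP L0; have [x /WP + /eqP] := W0.
  by rewrite L0 /list_proj big_nil => <-; apply.
have d_gt n : (n < d n)%N by elim: n => // n IH; exact: leq_trans (d_mono n).
have Lle m n : (m <= n)%N -> prefix (L m) (L n).
  move=> /subnK <-; elim: (n - m)%N => [|k IH]; first exact: prefix_refl.
  exact: prefix_trans IH (Lpre _).
(* L k has more than k terms, as d increases from d 0 > 0 *)
pose e k := (L k)`_k.
have Le n i : (i < d n)%N -> (L n)`_i = e i.
  have nthP' m m' : (m <= m')%N -> (i < d m)%N -> (L m')`_i = (L m)`_i.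
    by move=> /Lle/prefixP[t ->] im; rewrite nth_cat im.
  by move=> id; have [/nthP'|/ltnW/nthP'] := leqP n i; [move=> <-|move=> ->].
exists e, d; split=> //.
- move=> i j; have im : (i < d (maxn i j))%N := leq_ltn_trans (leq_maxl i j) (d_gt _).
  have jm : (j < d (maxn i j))%N := leq_ltn_trans (leq_maxr i j) (d_gt _).
  by rewrite -(Le _ _ im) -(Le _ _ jm) oL.
- by move=> n; apply: (orthonormal_list_size (b := b n)) (oL n) _; rewrite bW; exact: WL.
- by move=> n x; rewrite -(list_proj_fourier _ (Le n)); exact: WP.
Qed.

(** * The C*-algebra of continuous functions *)

Lemma nbhs_normc (R : realType) (z : R[i]) (e : R) : 0 < e ->
  nbhs z [set w | Normc.normc (z - w) < e].
Proof.
move=> e0; have e0C : 0 < e%:C%C :> R[i] by rewrite ltcR.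
have := @nbhsx_ballx R[i] R[i] z _ e0C; apply: filterS => w.
by rewrite -ball_normE /= -ltcR.
Qed.

Lemma nbhs_normcP (R : realType) (z : R[i]) (A : set R[i]) :
  nbhs z A -> exists2 e : R, 0 < e & forall w, Normc.normc (z - w) < e -> A w.
Proof.
move=> /nbhs_ballP[r /= /posC_real[{}r r0 ->] rA]; exists r => // w zw.
by apply: rA; rewrite -ball_normE /= -[`|_|]/((_)%:C%C) ltcR.
Qed.

Section SupNorm.
Context (R : realType) (X : topologicalType).
Local Notation C := R[i].
Local Notation A := (cfun_alg R X).
Implicit Types f g : cfun R X.

Lemma normc_ge0 (z : C) : 0 <= Normc.normc z.
Proof. by case: z => a b; rewrite sqrtr_ge0. Qed.

Lemma normc_le (z : C) (b : R) : (Normc.normc z <= b) = (`|z| <= b%:C%C).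
Proof. by rewrite -lecR. Qed.

Lemma normc_lt (z : C) (b : R) : (Normc.normc z < b) = (`|z| < b%:C%C).
Proof. by rewrite -ltcR. Qed.

Lemma normcD (z w : C) : Normc.normc (z + w) <= Normc.normc z + Normc.normc w.
Proof. by rewrite normc_le RtoCD; exact: ler_normD. Qed.

Lemma normcB (z w : C) : Normc.normc (z - w) = Normc.normc (w - z).
Proof.
have : `|z - w| = `|w - z| by exact: distrC.
by rewrite -[LHS]/((_)%:C%C) -[RHS]/((_)%:C%C) => -[].
Qed.

Lemma normc_continuous : continuous (fun z : C => Normc.normc z).
Proof.
move=> z B /nbhs_ballP[e /= e0 eB]; apply: filterS (nbhs_normc z e0) => w zw.
apply: eB; rewrite -ball_normE /=; apply: le_lt_trans zw; rewrite ler_norml; apply/andP; split.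
  by rewrite lerBrDl lerBlDr normcB -{1}(subrK z w) addrC normcD.
by rewrite lerBlDr -{1}(subrK w z) normcD.
Qed.

Lemma cfunP f g : f =1 g -> f = g.
Proof. by move=> fg; apply/val_inj/funext. Qed.

Lemma cfunD f g x : (f + g) x = f x + g x.
Proof. by []. Qed.

Lemma cfunZ c f x : (c *: f) x = c * f x.
Proof. by []. Qed.

Lemma cfunB f g x : (f - g) x = f x - g x.
Proof. by []. Qed.

Hypothesis cX : compact [set: X].
Context (x1 : X).

Lemma sup_norm_ge f x : Normc.normc (f x) <= sa_norm (f : A).
Proof.
apply: sup_upper_bound; last by exists x.
apply: compact_has_sup; first by exists (Normc.normc (f x1)), x1.
apply: continuous_compact cX; apply: continuous_subspaceT => y.
apply: (continuous_comp (@cfun_continuous _ _ f y)); exact: normc_continuous.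
Qed.

Lemma sup_norm_le f b : (forall x, Normc.normc (f x) <= b) -> sa_norm (f : A) <= b.
Proof.
move=> fb; apply: ge_sup; first by exists (Normc.normc (f x1)), x1.
by move=> _ [x _ <-].
Qed.

Lemma sup_norm_ge0 f : 0 <= sa_norm (f : A).
Proof. exact: le_trans (normc_ge0 _) (sup_norm_ge f x1). Qed.

Lemma normc_conj (z : C) : Normc.normc z^* = Normc.normc z.
Proof.
have : `|z^*| = `|z| by exact: norm_conjC.
by rewrite -[LHS]/((_)%:C%C) -[RHS]/((_)%:C%C) => -[].
Qed.

(** The limit is taken pointwise along an ultrafilter; the Cauchy estimate is uniform, so the
    limit is uniform and continuous. *)
Lemma sup_norm_complete (u : nat -> A) :
  (forall e : R, 0 < e -> exists N, forall m n, (N <= m)%N -> (N <= n)%N ->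
     sa_norm (u m - u n) < e) ->
  exists l : A, forall e : R, 0 < e -> exists N, forall n, (N <= n)%N ->
     sa_norm (u n - l) < e.
Proof.
move=> uC; have [U [UU Uoo]] := ultraFilterLemma eventually_filter.
have UF : ProperFilter U by exact: ultra_proper.
have U_ge N : U [set n | (N <= n)%N] by apply: Uoo; exact: nbhs_infty_ge.
have /choice[l Ul] x : exists a : C, (fun n => (u n : cfun R X) x) @ U --> a.
  have [N uN] := uC 1 ltr01.
  apply: (@ultra_bounded_lim _ _ _ UU _ (sa_norm (u N) + 1)).
  apply: filterS (U_ge N) => n /= Nn; rewrite -normc_le.
  have -> : (u n : cfun R X) x = (u n - u N : cfun R X) x + (u N : cfun R X) x.
    by rewrite cfunB subrK.
  rewrite addrC (le_trans (normcD _ _))// lerD ?sup_norm_ge//.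
  by rewrite (le_trans (sup_norm_ge _ _))// ltW// uN.
have ul e : 0 < e -> exists N, forall n, (N <= n)%N ->
    forall x, Normc.normc ((u n : cfun R X) x - l x) <= e.
  move=> e0; have [N uN] := uC e e0; exists N => n Nn x; rewrite normc_le.
  have h : (fun m => (u n : cfun R X) x - (u m : cfun R X) x) @ U --> (u n : cfun R X) x - l x.
    by apply: cvgB; [exact: cvg_cst|exact: Ul].
  apply: (cvg_norm_le h); apply: filterS (U_ge N) => m /= Nm; rewrite -normc_le.
  by rewrite (le_trans (sup_norm_ge (u n - u m) x))// ltW// uN.
have lC : continuous l.
  move=> x B /nbhs_normcP[e e0 eB].
  have e3 : 0 < e / 3 by rewrite divr_gt0.
  have [N uN] := ul _ e3.
  have : nbhs x ((u N : cfun R X) @^-1` [set w | Normc.normc ((u N : cfun R X) x - w) < e / 3]).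
    by apply: (@cfun_continuous _ _ (u N : cfun R X) x); exact: nbhs_normc.
  apply: filterS => y /= xy; apply: eB.
  have -> : l x - l y = (l x - (u N : cfun R X) x) +
      ((u N : cfun R X) x - (u N : cfun R X) y) + ((u N : cfun R X) y - l y) by ring.
  apply: le_lt_trans (normcD _ _) _.
  apply: le_lt_trans (lerD (normcD _ _) (uN N (leqnn N) y)) _.
  by rewrite normcB; have := uN N (leqnn N) x; lra.
have lC' : l \in @continuous_pred R X by apply/mem_set.
exists (Cfun lC') => e e0; have e2 : 0 < e / 2 by rewrite divr_gt0.
have [N uN] := ul _ e2; exists N => n Nn.
apply: (@le_lt_trans _ _ (e / 2)); last by lra.
by apply: sup_norm_le => x; rewrite cfunB; exact: uN.
Qed.

Lemma cfun_cstar : cstar_algebra A.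
Proof.
split.
- by move=> f g h; apply: cfunP => x /=; rewrite mulrA.
- move=> f c g h; apply: cfunP => x.
  by change ((c * cfun_val g x + cfun_val h x) * cfun_val f x =
    c * (cfun_val g x * cfun_val f x) + cfun_val h x * cfun_val f x); ring.
- move=> f c g h; apply: cfunP => x.
  by change (cfun_val f x * (c * cfun_val g x + cfun_val h x) =
    c * (cfun_val f x * cfun_val g x) + cfun_val f x * cfun_val h x); ring.
- by move=> f; apply: cfunP => x /=; rewrite conjCK.
- move=> c f g; apply: cfunP => x.
  change ((c * cfun_val f x + cfun_val g x)^* =
    c^* * (cfun_val f x)^* + (cfun_val g x)^*).
  by rewrite rmorphD rmorphM.
- by move=> f g; apply: cfunP => x /=; rewrite rmorphM mulrC.
- move=> f f0; apply: cfunP => x; apply: Normc.eq0_normc; apply: le_anti.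
  by rewrite normc_ge0 andbT -f0 sup_norm_ge.
- move=> f g; apply: sup_norm_le => x; apply: le_trans (normcD _ _) _.
  by rewrite lerD// sup_norm_ge.
- move=> c f; apply: le_anti; apply/andP; split.
    apply: sup_norm_le => x.
    rewrite [leLHS](Normc.normcM c (cfun_val f x)) ler_wpM2l ?normc_ge0//.
    exact: sup_norm_ge.
  have [->|c0] := eqVneq c 0.
    rewrite Normc.normc0 mul0r; exact: sup_norm_ge0.
  have nc0 : 0 < Normc.normc c.
    rewrite lt0r normc_ge0 andbT; apply: contraNneq c0 => /Normc.eq0_normc ->.
    by rewrite eqxx.
  rewrite mulrC -ler_pdivlMr//; apply: sup_norm_le => x.
  rewrite ler_pdivlMr// mulrC -Normc.normcM; exact: (sup_norm_ge (c *: f : cfun R X)).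
- move=> f g; apply: sup_norm_le => x /=; rewrite Normc.normcM.
  by rewrite ler_pM ?normc_ge0 ?sup_norm_ge.
- move=> f; apply: le_anti; apply/andP; split.
    apply: sup_norm_le => x /=; rewrite Normc.normcM normc_conj expr2.
    by rewrite ler_pM ?normc_ge0 ?sup_norm_ge.
  have s0 := sup_norm_ge0 (sa_mul (sa_star (f : A)) f : cfun R X).
  rewrite -(sqr_sqrtr s0) ler_pXn2r ?nnegrE ?sup_norm_ge0 ?sqrtr_ge0//.
  apply: sup_norm_le => x.
  rewrite -[leLHS]ger0_norm ?normc_ge0// -sqrtr_sqr ler_wsqrtr// expr2.
  rewrite -{1}normc_conj -Normc.normcM.
  exact: (sup_norm_ge (sa_mul (sa_star (f : A)) f : cfun R X)).
- exact: sup_norm_complete.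
Qed.

End SupNorm.

(** * Topology of the Riemann sphere and Moebius transformations *)

Section Sphere.
Context (R : realType).
Local Notation C := R[i].
Implicit Types (x y : P1 R) (z w : C).

Lemma nbhs_SomeP z (A : set (P1 R)) : nbhs (Some z : P1 R) A <->
  exists2 e : R, 0 < e & forall w, Normc.normc (z - w) < e -> A (Some w).
Proof.
split; first by move=> /(@nbhs_normcP R z (Some @^-1` A)).
by move=> [e e0 eA]; apply: filterS (nbhs_normc z e0) => w; exact: eA.
Qed.

Lemma compact_bounded_normc (K : set C) : compact K ->
  exists r : R, forall z, K z -> Normc.normc z <= r.
Proof.
move=> cK; have [->|K0] := eqVneq K set0; first by exists 0.
have cN : compact ((fun z : C => Normc.normc z) @` K).
  by apply: continuous_compact cK; apply: continuous_subspaceT; exact: normc_continuous.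
exists (sup ((fun z : C => Normc.normc z) @` K)) => z Kz.
apply: sup_upper_bound; last by exists z.
by apply: compact_has_sup => //; exists (Normc.normc z), z.
Qed.

Lemma closed_disc (r : R) : closed [set z : C | Normc.normc z <= r].
Proof.
apply: (@closed_comp _ _ (fun z : C => Normc.normc z) [set t : R | t <= r]).
  by move=> z _; exact: normc_continuous.
exact: closed_le.
Qed.

Lemma compact_disc (r : R) : compact [set z : C | Normc.normc z <= r].
Proof.
rewrite compact_ultra => F UF FD.
have PF : ProperFilter F by exact: ultra_proper.
have FD' : F [set z | `|z| <= r%:C%C].
  by apply: filterS FD => z /=; rewrite normc_le.
have [a Fa] := @ultra_bounded_lim R C F UF id r FD'.
by exists a; split => //=; rewrite normc_le; exact: (cvg_norm_le Fa FD').
Qed.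

Lemma nbhs_NoneP (A : set (P1 R)) : nbhs (None : P1 R) A <->
  A None /\ exists r : R, forall z, r < Normc.normc z -> A (Some z).
Proof.
split=> [[K [cK _] KA]|[AN [r rA]]].
  split; first by apply: KA; right.
  have [r Kr] := compact_bounded_normc cK; exists r => z rz.
  by apply: KA; left; exists z => // /Kr; rewrite leNgt rz.
exists [set z : C | Normc.normc z <= r].
  by split; [exact: compact_disc|exact: closed_disc].
by move=> _ [[z /negP + <-]|->//]; rewrite -ltNge; exact: rA.
Qed.

Lemma P1_compact : compact [set: P1 R].
Proof. exact: one_point_compactification_compact. Qed.

Lemma P1_hausdorff : hausdorff_space (P1 R).
Proof.
move=> p q; have far (z : C) : exists2 A : set (P1 R), nbhs (Some z : P1 R) A &
    nbhs (None : P1 R) (~` A).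
  exists [set x | exists2 w, x = Some w & Normc.normc w < Normc.normc z + 1].
    apply/nbhs_SomeP; exists 1 => // w zw; exists w => //.
    by rewrite -(subrK z w) (le_lt_trans (normcD _ _))// addrC ltrD2l normcB.
  apply/nbhs_NoneP; split; first by case.
  exists (Normc.normc z + 1) => w zw [_ [<-]]; apply/negP; rewrite -leNgt; exact: ltW.
case: p q => [z|] [w|] // pq.
- congr Some; apply/eqP; rewrite -subr_eq0; apply: contraT => zw.
  have e0 : 0 < Normc.normc (z - w) / 2.
    rewrite divr_gt0// lt0r normc_ge0 andbT; apply: contraNneq zw => /Normc.eq0_normc ->.
    by rewrite eqxx.
  have Az : nbhs (Some z : P1 R) [set x | exists2 u, x = Some u & Normc.normc (z - u) < Normc.normc (z - w) / 2].
    by apply/nbhs_SomeP; exists (Normc.normc (z - w) / 2) => // u ?; exists u.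
  have Aw : nbhs (Some w : P1 R) [set x | exists2 u, x = Some u & Normc.normc (w - u) < Normc.normc (z - w) / 2].
    by apply/nbhs_SomeP; exists (Normc.normc (z - w) / 2) => // u ?; exists u.
  have [_ [[u -> zu] [v [<-] wu]]] := pq _ _ Az Aw.
  have : Normc.normc (z - w) <= Normc.normc (z - u) + Normc.normc (w - u).
    by rewrite (normcB w u) -{1}(subrK u z) -addrA normcD.
  by move: zu wu; lra.
- have [A Az AN] := far z.
  by have [x [Ax nAx]] := pq _ _ Az AN; case: (nAx Ax).
- have [A Aw AN] := far w.
  by have [x [nAx Ax]] := pq _ _ AN Aw; case: (nAx Ax).
Qed.

Lemma closed_compact (A : set (P1 R)) : closed A -> compact A.
Proof. by move=> cA; apply: (subclosed_compact cA P1_compact). Qed.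

Lemma normc_gt0 z : (0 < Normc.normc z) = (z != 0).
Proof.
rewrite lt0r normc_ge0 andbT; congr (~~ _); apply/eqP/eqP => [/Normc.eq0_normc//|->].
exact: Normc.normc0.
Qed.

Lemma cvgC_normc T (F : set_system T) (FF : Filter F) (f : T -> C) (a : C) (e : R) :
  f @ F --> a -> 0 < e -> \forall t \near F, Normc.normc (a - f t) < e.
Proof. by move=> fa e0; exact: fa (nbhs_normc a e0). Qed.

(** [u : v] is continuous off (0, 0). This one statement covers both charts of the sphere, and
    all continuity properties of Moebius transformations are derived from it. *)
Lemma proj_pt_cvg T (F : set_system T) {FF : Filter F} (u v : T -> C) (a b : C) :
  u @ F --> a -> v @ F --> b -> (a != 0) || (b != 0) ->
  (fun t => proj_pt (u t, v t)) @ F --> (proj_pt (a, b) : P1 R).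
Proof.
move=> ua vb ab0; rewrite {2}/proj_pt /=; case: eqVneq => b0.
  rewrite b0 eqxx orbF in ab0; have na : 0 < Normc.normc a by rewrite normc_gt0.
  move=> A /nbhs_NoneP[AN [r rA]].
  have r1 : 0 < `|r| + 1 by rewrite ltr_wpDl.
  have h1 := cvgC_normc FF ua (divr_gt0 na (ltr0n R 2)).
  have h2 := cvgC_normc FF vb (divr_gt0 (divr_gt0 na (ltr0n R 2)) r1).
  change (F [set t | A (proj_pt (u t, v t))]).
  apply: filterS2 h1 h2 => t; rewrite b0 sub0r => h1 h2.
  rewrite /proj_pt /=; case: eqVneq => // v0; apply: rA.
  have nv : 0 < Normc.normc (v t) by rewrite normc_gt0.
  rewrite Normc.normcM Normc.normcV ltr_pdivlMr//.
  have nu : Normc.normc a / 2 < Normc.normc (u t).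
    have : Normc.normc a <= Normc.normc (a - u t) + Normc.normc (u t).
      by rewrite -{1}(subrK (u t) a) normcD.
    by move: h1; lra.
  apply: le_lt_trans nu.
  have {}h2 : Normc.normc (v t) < Normc.normc a / 2 / (`|r| + 1).
    by move: h2; rewrite -(sub0r (v t)) normcB subr0.
  apply: (@le_trans _ _ ((`|r| + 1) * Normc.normc (v t))).
    by rewrite ler_pM2r// ler_wpDr// ler_norm.
  by rewrite mulrC -ler_pdivlMr// ltW.
have : (fun t => u t / v t) @ F --> (a / b : C).
  have vV := @cvgV C T F FF v b b0 vb.
  exact: (@cvgM C T F FF u (fun t => (v t)^-1) a b^-1 ua vV).
move=> uv A /= /uv; rewrite /proj_pt /=.
have h := cvgC_normc FF vb (_ : 0 < Normc.normc b); rewrite normc_gt0 in h.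
apply: filterS2 (h b0) => t /= h1; case: eqVneq => // v0.
by move: h1; rewrite v0 subr0 ltxx.
Qed.

End Sphere.

Section Moebius.
Context (R : realType).
Local Notation C := R[i].
Implicit Types (x y : P1 R) (z w : C) (A B : 'M[C]_2) (p : C * C).

Definition nz p := (p.1 != 0) || (p.2 != 0).

Lemma homog_nz x : nz (homog x).
Proof. by case: x => [z|]; rewrite /nz /= oner_eq0 ?orbT. Qed.

Lemma homogK x : proj_pt (homog x) = x.
Proof. by case: x => [z|]; rewrite /proj_pt /= ?oner_eq0 ?divr1 ?eqxx. Qed.

Lemma proj_pt_scale (c : C) p : c != 0 -> proj_pt (c * p.1, c * p.2) = proj_pt p.
Proof.
move=> c0; rewrite /proj_pt /= mulf_eq0 (negPf c0) /=; case: eqVneq => // p0.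
by rewrite invfM mulrACA divff// mul1r.
Qed.

Lemma homog_proj_pt p : nz p ->
  exists2 c : C, c != 0 & homog (proj_pt p) = (c * p.1, c * p.2).
Proof.
rewrite /nz /proj_pt; case: (eqVneq p.2 0) => [->|p0 _] /=; last first.
  by exists p.2^-1; rewrite ?invr_eq0// mulrC mulVf.
by rewrite orbF => p0; exists p.1^-1; rewrite ?invr_eq0// mulVf// mulr0.
Qed.

Lemma lin_act_scale A (c : C) p :
  lin_act A (c * p.1, c * p.2) = (c * (lin_act A p).1, c * (lin_act A p).2).
Proof. by congr (_, _); rewrite /=; ring. Qed.

Lemma lin_actZ (c : C) A p :
  lin_act (c *: A) p = (c * (lin_act A p).1, c * (lin_act A p).2).
Proof. by congr (_, _); rewrite /= !mxE; ring. Qed.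

Lemma sum_ord2 (F : 'I_2 -> C) : \sum_(i < 2) F i = F 0 + F 1.
Proof. by rewrite !big_ord_recl big_ord0 addr0; congr (_ + F _); exact: val_inj. Qed.

Lemma lin_actM A B p : lin_act (A * B) p = lin_act A (lin_act B p).
Proof. by congr (_, _); rewrite /= !mxE !sum_ord2; ring. Qed.

Lemma lin_act1 p : lin_act 1 p = p.
Proof. by case: p => a b; congr (_, _); rewrite /= !mxE /=; ring. Qed.

Lemma lin_act_nz A p : A \in unitmx -> nz p -> nz (lin_act A p).
Proof.
move=> uA; apply: contraTT; rewrite /nz !negb_or !negbK => /andP[/eqP h1 /eqP h2].
have : lin_act (invmx A) (lin_act A p) = p.
  by rewrite -lin_actM -[_ * _]/(_ *m _) mulVmx// lin_act1.
rewrite [lin_act A p]surjective_pairing h1 h2 /lin_act /= !mulr0 addr0 => <- /=.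
by rewrite eqxx.
Qed.

Lemma moebius_proj_pt A p : A \in unitmx -> nz p ->
  moebius A (proj_pt p) = proj_pt (lin_act A p).
Proof.
move=> uA p0; rewrite /moebius; have [c c0 ->] := homog_proj_pt p0.
by rewrite lin_act_scale proj_pt_scale.
Qed.

Lemma moebiusM A B x : A \in unitmx -> B \in unitmx ->
  moebius (A * B) x = moebius A (moebius B x).
Proof.
move=> uA uB; rewrite [moebius B x]/moebius moebius_proj_pt ?lin_act_nz ?homog_nz//.
by rewrite /moebius lin_actM.
Qed.

Lemma moebius1 x : moebius 1 x = x.
Proof. by rewrite /moebius lin_act1 homogK. Qed.

Lemma moebiusZ (c : C) A x : c != 0 -> moebius (c *: A) x = moebius A x.
Proof. by move=> c0; rewrite /moebius lin_actZ proj_pt_scale. Qed.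

Lemma moebiusK A : A \in unitmx -> cancel (moebius A) (moebius (invmx A)).
Proof.
move=> uA x; rewrite -moebiusM ?unitmx_inv// -[_ * _]/(_ *m _) mulVmx//.
exact: moebius1.
Qed.

Lemma moebiusVK A : A \in unitmx -> cancel (moebius (invmx A)) (moebius A).
Proof. by move=> uA x; rewrite -{1}(invmxK A) moebiusK// unitmx_inv. Qed.

Lemma moebius_inj A : A \in unitmx -> injective (moebius A).
Proof. by move=> uA; exact: can_inj (moebiusK uA). Qed.

(** The limit matrix may be singular, as it happens for long words; then it sends all points
    off its kernel to one and the same limit. *)
Lemma moebius_cvg_mx T (F : set_system T) {FF : Filter F} (A : T -> 'M[C]_2) B
    (u v : T -> C) p :
  (forall i j, (fun t => A t i j) @ F --> B i j) ->
  u @ F --> p.1 -> v @ F --> p.2 -> nz (lin_act B p) ->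
  (fun t => proj_pt (lin_act (A t) (u t, v t))) @ F --> (proj_pt (lin_act B p) : P1 R).
Proof.
move=> AB up vp nzB; rewrite [lin_act B p]surjective_pairing.
have h i : (fun t => A t i 0 * u t + A t i 1 * v t) @ F --> (B i 0 * p.1 + B i 1 * p.2 : C).
  exact: (@cvgD C C _ F FF _ _ _ _ (@cvgM C T F FF _ _ _ _ (AB i 0) up)
    (@cvgM C T F FF _ _ _ _ (AB i 1) vp)).
exact: (@proj_pt_cvg R T F FF _ _ _ _ (h 0) (h 1) nzB).
Qed.

(** The coordinates homog jump at infinity, so others are needed there. *)
Lemma local_coordinates x : exists u v : P1 R -> C,
  [/\ u @ x --> (homog x).1, v @ x --> (homog x).2 &
      \forall y \near x, nz (u y, v y) /\ proj_pt (u y, v y) = y].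
Proof.
case: x => [z|].
  exists (fun y => if y is Some w then w else 0), (fun=> 1); split.
  - move=> A /nbhs_normcP[e e0 eA].
    by apply/nbhs_SomeP; exists e => // w zw; exact: eA.
  - exact: cvg_cst.
  - apply/nbhs_SomeP; exists 1 => // w _.
    by rewrite /nz /proj_pt /= oner_eq0 orbT divr1.
rewrite (_ : homog (None : P1 R) = (1, 0))//=.
exists (fun=> 1), (fun y => if y is Some w then w^-1 else 0); split.
- exact: (@cvg_cst C 1 _ _ (nbhs_filter (None : P1 R))).
- move=> A /nbhs_normcP[e e0 eA]; apply/nbhs_NoneP; split.
    by apply: (eA 0); rewrite subrr Normc.normc0.
  exists e^-1 => w ew; apply: (eA w^-1); rewrite normcB subr0 Normc.normcV.
  rewrite invf_plt ?posrE// (lt_trans _ ew)// invr_gt0//.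
- apply/nbhs_NoneP; split; first by rewrite /nz /proj_pt /= oner_eq0 eqxx.
  exists 0 => w; rewrite normc_gt0 => w0.
  by rewrite /nz /proj_pt /= oner_eq0 invr_eq0 (negPf w0) invrK mul1r.
Qed.

Lemma moebius_continuous A : A \in unitmx -> continuous (moebius A : P1 R -> P1 R).
Proof.
move=> uA x; have [u [v [ux vx uv]]] := local_coordinates x.
have h : (fun y => proj_pt (lin_act A (u y, v y))) @ x --> (moebius A x : P1 R).
  have hA i j : (fun _ : P1 R => A i j) @ nbhs x --> A i j.
    exact: (@cvg_cst C (A i j) _ _ (nbhs_filter x)).
  exact: (@moebius_cvg_mx (P1 R) (nbhs x) (nbhs_filter x) (fun=> A) A u v (homog x)
    hA ux vx (lin_act_nz uA (homog_nz x))).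
move=> S /h hS; apply: (@filterS2 _ _ (nbhs_filter x) _ _ _ _ hS uv) => y /= Sy [nzy yE].
by rewrite -yE moebius_proj_pt.
Qed.

Lemma moebius_image A (S : set (P1 R)) : A \in unitmx ->
  moebius A @` S = moebius (invmx A) @^-1` S.
Proof.
move=> uA; apply/seteqP; split=> [_ [x Sx <-]|x Sx] /=; first by rewrite moebiusK.
by exists (moebius (invmx A) x) => //; rewrite moebiusVK.
Qed.

Lemma moebius_closed A (K : set (P1 R)) : A \in unitmx -> closed K ->
  closed (moebius A @` K).
Proof.
move=> uA cK; rewrite moebius_image//.
by apply: closed_comp => // x _; apply: moebius_continuous; rewrite unitmx_inv.
Qed.

Lemma moebius_open A (U : set (P1 R)) : A \in unitmx -> open U ->
  open (moebius A @` U).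
Proof.
move=> uA oU; rewrite moebius_image//.
by apply: open_comp => // x _; apply: moebius_continuous; rewrite unitmx_inv.
Qed.

End Moebius.

Section SphereConnected.
Context (R : realType).
Local Notation C := R[i].

Definition seg (z w : C) : set C := [set z + t%:C%C * (w - z) | t in `[0%R, 1%R]].

Lemma real_complex_continuous : continuous (fun t : R => t%:C%C).
Proof.
move=> t A /nbhs_normcP[e e0 eA].
have := @nbhsx_ballx R R t e e0; apply: filterS => s; rewrite -ball_normE /= => ts.
apply: eA; rewrite (_ : t%:C%C - s%:C%C = (t - s)%:C%C) /=; last exact: esym (rmorphB _ _ _).
by rewrite expr0n addr0 sqrtr_sqr.
Qed.

Lemma seg_connected z w : connected (seg z w).
Proof.
apply: connected_continuous_connected; first exact: segment_connected.
apply: continuous_subspaceT => t.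
apply: (@cvgD C C); first exact: cvg_cst.
apply: (@cvgM C); last exact: cvg_cst.
exact: real_complex_continuous.
Qed.

Lemma seg_left z w : seg z w z.
Proof. exists 0; first by rewrite /= in_itv /= lexx ler01.
by rewrite -[0%:C%C]/(0 : C) mul0r addr0. Qed.

Lemma seg_right z w : seg z w w.
Proof. exists 1; first by rewrite /= in_itv /= lexx ler01.
by rewrite -[1%:C%C]/(1 : C) mul1r addrC subrK. Qed.

Lemma star_connected (S : set C) z : S z -> (forall w, S w -> seg z w `<=` S) ->
  connected S.
Proof.
move=> Sz star; have -> : S = \bigcup_(w in S) seg z w.
  apply/seteqP; split=> [w Sw|x [w Sw]]; last exact: star.
  by exists w => //; exact: seg_right.
apply: bigcup_connected; last by move=> w _; exact: seg_connected.
by exists z => w _; exact: seg_left.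
Qed.

Lemma seg_normc (z w u v : C) (r : R) : Normc.normc (u - z) < r -> Normc.normc (u - w) < r ->
  seg z w v -> Normc.normc (u - v) < r.
Proof.
move=> uz uw [t /=]; rewrite in_itv /= => /andP[t0 t1] <-.
have -> : u - (z + t%:C%C * (w - z)) = (1 - t)%:C%C * (u - z) + t%:C%C * (u - w).
  by rewrite (_ : (1 - t)%:C%C = 1 - t%:C%C); [ring|exact: rmorphB].
have nR (s : R) : 0 <= s -> Normc.normc s%:C%C = s.
  by move=> s0; rewrite /= expr0n addr0 sqrtr_sqr ger0_norm.
apply: le_lt_trans (normcD _ _) _; rewrite !Normc.normcM !nR ?subr_ge0//.
have [->|tn0] := eqVneq t 0; first by rewrite subr0 mul1r mul0r addr0.
have tp : 0 < t by rewrite lt0r tn0.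
have : (1 - t) * Normc.normc (u - z) <= (1 - t) * r by apply: ler_wpM2l; [rewrite subr_ge0|exact: ltW].
have : t * Normc.normc (u - w) < t * r by rewrite ltr_pM2l.
by lra.
Qed.

Lemma disc_connected z (r : R) : connected [set w | Normc.normc (z - w) < r].
Proof.
have [r0|r0] := leP r 0.
  rewrite (_ : [set w | _] = set0); first exact: connected0.
  by apply/seteqP; split => // w /= /lt_le_trans/(_ r0); rewrite ltNge normc_ge0.
apply: (@star_connected _ z) => [|w zw v] /=; first by rewrite subrr Normc.normc0.
by move=> /(seg_normc _ zw); apply; rewrite subrr Normc.normc0.
Qed.

Lemma chart0_continuous : continuous (Some : C -> P1 R).
Proof. exact: one_point_compactification_some_continuous. Qed.

Lemma chart1_continuous : continuous ((fun z => proj_pt (1, z)) : C -> P1 R).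
Proof.
move=> z; apply: (@proj_pt_cvg R C (nbhs z) (nbhs_filter z) (fun=> 1) id 1 z).
- exact: (@cvg_cst C 1 _ _ (nbhs_filter z)).
- by move=> A.
- by rewrite oner_eq0.
Qed.

Lemma P1_connected : connected [set: P1 R].
Proof.
have cT : connected [set: C] by apply: (@star_connected _ 0).
have -> : [set: P1 R] = \bigcup_(b in [set: bool])
    ((if b then Some else fun z => proj_pt (1, z)) : C -> P1 R) @` setT.
  apply/seteqP; split=> // -[z|] _; first by exists true => //; exists z.
  by exists false => //; exists 0 => //; rewrite /proj_pt /= eqxx.
apply: bigcup_connected.
  exists (Some 1) => -[] _; exists 1 => //.
  by rewrite /proj_pt /= oner_eq0 divr1.
move=> b _; apply: connected_continuous_connected cT _.
by apply: continuous_subspaceT; case: b; [exact: chart0_continuous|exact: chart1_continuous].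
Qed.

Lemma P1_locally_connected (x : P1 R) (U : set (P1 R)) : nbhs x U ->
  exists2 V, nbhs x V & [/\ V x, V `<=` U & connected V].
Proof.
case: x => [z /nbhs_SomeP[e e0 eU]|/nbhs_NoneP[UN [r rU]]].
  exists (Some @` [set w | Normc.normc (z - w) < e]).
    by apply/nbhs_SomeP; exists e => // w zw; exists w.
  split; first by exists z; rewrite //= subrr Normc.normc0.
    by move=> _ [w zw <-]; exact: eU.
  apply: connected_continuous_connected; first exact: disc_connected.
  by apply: continuous_subspaceT; exact: chart0_continuous.
have r1 : 0 < `|r| + 1 by rewrite ltr_wpDl.
have d0 : Normc.normc (0 - 0 : C) < (`|r| + 1)^-1 by rewrite subrr Normc.normc0 invr_gt0.
exists ((fun z => proj_pt (1, z)) @` [set w | Normc.normc (0 - w) < (`|r| + 1)^-1]).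
  apply/nbhs_NoneP; split.
    by exists 0; rewrite ?d0// /proj_pt eqxx.
  exists (`|r| + 1) => z rz; have nz0 := lt_trans r1 rz.
  exists z^-1; last first.
    by move: nz0; rewrite normc_gt0 /proj_pt /= invr_eq0 => /negPf ->; rewrite invrK mul1r.
  by rewrite /= normcB subr0 Normc.normcV ltf_pV2 ?posrE.
split.
- by exists 0; rewrite ?d0// /proj_pt eqxx.
- move=> _ [w /= w1 <-]; rewrite /proj_pt /=; case: eqVneq => // w0; apply: rU.
  rewrite mul1r Normc.normcV; apply: (@le_lt_trans _ _ `|r|); first exact: ler_norm.
  apply: (@lt_trans _ _ (`|r| + 1)); first by rewrite ltrDl.
  by rewrite invf_pgt ?posrE ?normc_gt0//; move: w1; rewrite normcB subr0.
- apply: connected_continuous_connected; first exact: disc_connected.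
  by apply: continuous_subspaceT; exact: chart1_continuous.
Qed.

Lemma component_open (U : set (P1 R)) p : open U -> open (connected_component U p).
Proof.
move=> oU; rewrite openE => x Ux.
have xU : U x by exact: connected_component_sub Ux.
have [V xV [Vx VU cV]] := P1_locally_connected (open_nbhs_nbhs (conj oU xU)).
apply: filterS xV => y Vy; rewrite (same_connected_component Ux).
exact: (connected_component_max Vx VU cV).
Qed.

End SphereConnected.

(** * Jordan curves and ping-pong *)

Section JordanCurves.
Context (R : realType).
Local Notation C := R[i].
Implicit Types (J : set (P1 R)) (p : P1 R).

Lemma subarc_compact (f : R -> P1 R) (a b : R) :
  {within `[0%R, 1%R], continuous f} -> 0 <= a -> b <= 1 -> compact (f @` `[a, b]).
Proof.
move=> cf a0 b1; apply: continuous_compact; last exact: segment_compact.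
apply: continuous_subspaceW cf => t /=; rewrite !in_itv /= => /andP[at_ tb].
by rewrite (le_trans a0 at_) (le_trans tb b1).
Qed.

Lemma subarc_closed (f : R -> P1 R) (a b : R) :
  {within `[0%R, 1%R], continuous f} -> 0 <= a -> b <= 1 -> closed (f @` `[a, b]).
Proof.
by move=> cf a0 b1; apply: (compact_closed (@P1_hausdorff R)); exact: subarc_compact.
Qed.

Lemma jordan_closed J : jordan_curve J -> closed J.
Proof. by move=> [f [cf _ _ ->]]; exact: subarc_closed. Qed.

Lemma jordan_connected J : jordan_curve J -> connected J.
Proof.
move=> [f [cf _ _ ->]]; apply: connected_continuous_connected cf.
exact: segment_connected.
Qed.

Lemma jordan_neq0 J : jordan_curve J -> J !=set0.
Proof. by move=> [f [_ _ _ ->]]; exists (f 0), 0; rewrite //= in_itv /= lexx ler01. Qed.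

(** Twice the signed area of the triangle a b c, used as a test for collinearity. *)
Definition area (a b c : C) : R :=
  (complex.Re b - complex.Re a) * (complex.Im c - complex.Im a) -
  (complex.Im b - complex.Im a) * (complex.Re c - complex.Re a).

Lemma seg_area a b c : seg a c b -> area a b c = 0.
Proof.
move=> [t _ <-]; rewrite /area; case: a c => [a1 a2] [c1 c2] /=; ring.
Qed.

Lemma open_disc (U : set (P1 R)) x : open U -> U x ->
  exists z (e : R), 0 < e /\ forall w, Normc.normc (z - w) < e -> U (Some w).
Proof.
move=> oU; case: x => [z|] Ux.
  have /nbhs_SomeP[e e0 eU] := open_nbhs_nbhs (conj oU Ux).
  by exists z, e.
have /nbhs_NoneP[_ [r rU]] := open_nbhs_nbhs (conj oU Ux).
have nR (s : R) : 0 <= s -> Normc.normc s%:C%C = s.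
  by move=> s0; rewrite /= expr0n addr0 sqrtr_sqr ger0_norm.
have : U (Some (`|r| + 1)%:C%C).
  by apply: rU; rewrite nR ?addr_ge0// (le_lt_trans (ler_norm r))// ltrDl.
move=> Uz; have /nbhs_SomeP[e e0 eU] := open_nbhs_nbhs (conj oU Uz).
by exists (`|r| + 1)%:C%C, e.
Qed.

Lemma P1_closed1 (x : P1 R) : closed [set x].
Proof. exact: (accessible_closed_set1 (hausdorff_accessible (@P1_hausdorff R))). Qed.

Lemma normc_shift (z w : C) : Normc.normc (z - (z + w)) = Normc.normc w.
Proof. by rewrite normcB addrAC subrr add0r. Qed.

(** Suppose that J contains a disc. Of three points of the disc that are not collinear, one lies
    between the other two for the parameter of the curve; the segment joining these two avoids
    it, yet it would be disconnected by the two arcs that the middle point cuts. *)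
Lemma jordan_no_interior J (U : set (P1 R)) x : jordan_curve J -> open U ->
  U `<=` J -> ~ U x.
Proof.
move=> [f [cf f01 finj JE]] oU UJ Ux.
have [z0 [e0 [e0_gt0 z0U]]] := open_disc oU Ux.
(* f is injective only on [0, 1), so the point f 0 = f 1 is removed *)
pose U' := U `&` ~` [set f 0].
have oU' : open U' by apply: openI => //; apply: closed_openC; exact: P1_closed1.
have [y U'y] : exists y, U' y.
  have nz0 (s : R) : Normc.normc (z0 - (z0 + s%:C%C)) = `|s|.
    by rewrite normc_shift /= expr0n addr0 sqrtr_sqr.
  have [f0z|f0z] := pselect (f 0 = Some z0); last first.
    exists (Some z0); split; last by move=> /= /esym.
    by apply: z0U; rewrite subrr Normc.normc0.
  exists (Some (z0 + (e0 / 2)%:C%C)); split.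
    by apply: z0U; rewrite nz0 ger0_norm ?divr_ge0 ?ltW//; lra.
  rewrite /= f0z => -[/eqP]; rewrite -subr_eq0 addrC addKr.
  by rewrite eq_complex /= eqxx andbT; apply/negP; rewrite gt_eqF ?divr_gt0.
have {y U'y} [z [e [e_gt0 zU]]] := open_disc oU' U'y.
have par w : Normc.normc (z - w) < e -> exists t, [/\ 0 <= t, t <= 1 & f t = Some w].
  by move=> /zU[/UJ]; rewrite JE => -[t /=]; rewrite in_itv /= => /andP[t0 t1] <- _; exists t.
have mid a b c ta tb tc : Normc.normc (z - a) < e -> Normc.normc (z - b) < e ->
    Normc.normc (z - c) < e -> f ta = Some a -> f tb = Some b -> f tc = Some c ->
    0 <= ta -> ta < tb -> tb < tc -> tc <= 1 -> area a b c != 0 -> False.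
  move=> za zb zc fa fb fc ta0 tab tbc tc1 abc.
  have tb0 : 0 <= tb := ltW (le_lt_trans ta0 tab).
  have tb1 : tb <= 1 := ltW (lt_le_trans tbc tc1).
  pose S : set (P1 R) := Some @` seg a c.
  have cS : connected S.
    apply: connected_continuous_connected; first exact: seg_connected.
    by apply: continuous_subspaceT; exact: chart0_continuous.
  have SU w : S w -> U' w by move=> [v /(seg_normc za zc) zv <-]; exact: zU.
  have Sb : ~ S (Some b).
    by move=> [v acv [vb]]; move/eqP: abc; apply; apply: seg_area; rewrite -vb.
  have PQ w : S w -> (f @` `[0, tb]) w -> (f @` `[tb, 1]) w -> False.
    move=> Sw [s /=]; rewrite in_itv /= => /andP[s0 sb] fs [t /=].
    rewrite in_itv /= => /andP[tbt t1] ft.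
    have [_ wf0] := SU _ Sw.
    have {}t1 : t < 1.
      by rewrite lt_neqAle t1 andbT; apply: contra_notN wf0 => /eqP t1'; rewrite /= -ft t1'.
    have st : s = t.
      by apply: finj; rewrite ?s0 ?(le_lt_trans sb (le_lt_trans tbt t1)) ?(le_trans tb0 tbt)// fs.
    by apply: Sb; rewrite -fb (_ : tb = t) ?ft//; apply: le_anti; rewrite tbt -st sb.
  have PorQ w : S w -> ~ (f @` `[tb, 1]) w -> (f @` `[0, tb]) w.
    move=> /SU[/UJ + _]; rewrite JE => -[t /=]; rewrite in_itv /= => /andP[t0 t1] <- nQ.
    exists t => //=; rewrite in_itv /= t0 /=; rewrite leNgt; apply/negP => tbt.
    by apply: nQ; exists t => //=; rewrite in_itv /= t1 ltW.
  have ES : S `&` f @` `[0, tb] = S.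
    apply: cS.
    - exists (Some a); split; first by exists a => //; exact: seg_left.
      by exists ta => //=; rewrite in_itv /= ta0 ltW.
    - exists (~` (f @` `[tb, 1])); first by apply: closed_openC; exact: subarc_closed.
      apply/seteqP; split=> w [Sw h]; split => //; last exact: PorQ.
      by move=> Qw; exact: PQ Sw h Qw.
    - by exists (f @` `[0, tb]) => //; exact: subarc_closed.
  have Sc : S (Some c) by exists c => //; exact: seg_right.
  have [_ Pc] : (S `&` f @` `[0, tb]) (Some c) by rewrite ES.
  by apply: PQ Sc Pc _; exists tc => //=; rewrite in_itv /= tc1 ltW.
pose h := e / 2; have h0 : 0 < h by rewrite divr_gt0.
have he : h < e by rewrite /h; lra.
pose b := z + h%:C%C; pose c := z + Complex 0 h.
have za : Normc.normc (z - z) < e by rewrite subrr Normc.normc0.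
have zb : Normc.normc (z - b) < e.
  by rewrite /b normc_shift /= expr0n addr0 sqrtr_sqr ger0_norm ?ltW.
have zc : Normc.normc (z - c) < e.
  by rewrite /c normc_shift /= expr0n add0r sqrtr_sqr ger0_norm ?ltW.
have A : area z b c != 0.
  rewrite /area /b /c; case: (z) => z1 z2 /=.
  rewrite (_ : _ - _ = h * h); last by ring.
  by rewrite mulf_neq0 ?gt_eqF.
have [ta [ta0 ta1 fa]] := par _ za.
have [tb [tb0 tb1 fb]] := par _ zb.
have [tc [tc0 tc1 fc]] := par _ zc.
have A1 : area z c b != 0 by rewrite (_ : area z c b = - area z b c) ?oppr_eq0// /area; ring.
have A2 : area b z c != 0 by rewrite (_ : area b z c = - area z b c) ?oppr_eq0// /area; ring.
have A3 : area b c z != 0 by rewrite (_ : area b c z = area z b c)// /area; ring.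
have A4 : area c z b != 0 by rewrite (_ : area c z b = area z b c)// /area; ring.
have A5 : area c b z != 0 by rewrite (_ : area c b z = - area z b c) ?oppr_eq0// /area; ring.
have A0 x' y' : area x' x' y' = 0 by rewrite /area; ring.
have A0' x' y' : area x' y' y' = 0 by rewrite /area; ring.
have ab : ta != tb.
  by apply: contraNneq A => tab; move: fa; rewrite tab fb => -[->]; rewrite A0.
have bc : tb != tc.
  by apply: contraNneq A => tbc; move: fb; rewrite tbc fc => -[->]; rewrite A0'.
have ac : ta != tc.
  by apply: contraNneq A4 => tac; move: fa; rewrite tac fc => -[->]; rewrite A0.
case: (ltgtP ta tb) ab => // ab _; case: (ltgtP tb tc) bc => // bc _;
  case: (ltgtP ta tc) ac => // ac _.
- exact: (mid z b c ta tb tc).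
- by have := lt_trans ab bc; rewrite ltNge ltW.
- exact: (mid z c b ta tc tb).
- exact: (mid c z b tc ta tb).
- exact: (mid b z c tb ta tc).
- exact: (mid b c z tb tc ta).
- by have := lt_trans bc ab; rewrite ltNge ltW.
- exact: (mid c b z tc tb ta).
Qed.

End JordanCurves.

(** The tables K a are closed so that limits of orbits stay in them, and the point p off all of
    them has a free orbit. *)
Definition ping_pong (R : realType) (g : nat) (T : 'I_g -> 'M[R[i]]_2)
    (K : letter g -> set (P1 R)) (p : P1 R) : Prop :=
  [/\ forall a, closed (K a),
      forall a b, a != b -> K a `&` K b = set0,
      forall a, ~ K a p &
      forall a x, ~ K (inv_letter a) x -> K a (moebius (letter_mx T a) x)].

Section PingPong.
Context (R : realType) (g : nat).
Local Notation C := R[i].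

Section Exterior.
Context (p : P1 R) (J : set (P1 R)).
Hypothesis jJ : jordan_curve J.
Hypothesis pJ : ~ J p.
Local Notation ext := (curve_exterior p J).
Local Notation int := (curve_interior p J).

Lemma exterior_open : open ext.
Proof. by apply: component_open; apply: closed_openC; exact: jordan_closed. Qed.

Lemma exterior_base : ext p.
Proof. exact: connected_component_refl. Qed.

Lemma exteriorE x : ext x <-> ~ J x /\ ~ int x.
Proof.
split=> [ex|[nJ nI]].
  have nJ : ~ J x by exact: connected_component_sub ex.
  by split => // nI; apply: nI; right.
by apply: contrapT => nE; apply: nI => -[].
Qed.

Lemma exterior_max (S : set (P1 R)) x : connected S -> S x -> ext x ->
  S `&` J = set0 -> S `<=` ext.
Proof.
move=> cS Sx ex SJ; rewrite /curve_exterior (same_connected_component ex).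
apply: connected_component_max Sx _ cS => y Sy Jy.
by have : (S `&` J) y by []; rewrite SJ.
Qed.

(** Otherwise the exterior would be closed as well as open, hence the whole sphere. *)
Lemma exterior_adherent : exists2 x, J x & closure ext x.
Proof.
apply: contrapT => h; have cE : closed ext.
  move=> x clx; apply: contrapT => nx; apply: h; exists x => //.
  apply: contrapT => nJx.
  have oJ : open (~` J) by apply: closed_openC; exact: jordan_closed.
  have [V xV [Vx VJ cV]] := P1_locally_connected (open_nbhs_nbhs (conj oJ nJx)).
  have [y [ey Vy]] := clx V xV.
  apply: nx; apply: exterior_max cV Vy ey _ _ Vx.
  by apply/seteqP; split => // z [/VJ].
have eT : ext = setT.
  apply: (@P1_connected R); first by exists p; exact: exterior_base.
  - by exists ext; [exact: exterior_open|rewrite setTI].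
  - by exists ext => //; rewrite setTI.
have [x Jx] := jordan_neq0 jJ.
have : ext x by rewrite eT.
by move/exteriorE => [].
Qed.

End Exterior.

(** If J met the interior of J', it would lie in it by connectedness; then the exterior of J'
    would lie in that of J, and J' too, as it is adherent to its exterior. So the interior of J
    would be contained in that of J', against disjointness, as it is not empty. *)
Lemma jordan_not_nested (p : P1 R) (J J' : set (P1 R)) :
  jordan_curve J -> ~ J p -> jordan_curve J' -> ~ J' p -> J `&` J' = set0 ->
  curve_interior p J `&` curve_interior p J' = set0 ->
  curve_interior p J !=set0 -> J `&` curve_interior p J' = set0.
Proof.
move=> jJ pJ jJ' pJ' JJ' II' [y Iy]; apply/seteqP; split => // x [Jx I'x].
have JJ'0 z : J z -> ~ J' z by move=> Jz J'z; have : (J `&` J') z by []; rewrite JJ'.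
have JI' z : J z -> curve_interior p J' z.
  move=> Jz; apply: contrapT => nI.
  have ez : curve_exterior p J' z by apply/exteriorE => //; split => //; exact: JJ'0.
  have /exteriorE : curve_exterior p J' x.
    exact: (exterior_max (jordan_connected jJ) Jz ez).
  by move=> [].
have eJ z : curve_exterior p J' z -> ~ J z.
  by move=> /exteriorE[_ nI] /JI'.
have ee : curve_exterior p J' `<=` curve_exterior p J.
  apply: (exterior_max (x := p)).
  - exact: component_connected.
  - exact: exterior_base.
  - exact: exterior_base.
  - by apply/seteqP; split => // z [/eJ].
have [z J'z clz] := exterior_adherent jJ' pJ'.
have oJ : open (~` J) by apply: closed_openC; exact: jordan_closed.
have nJz : ~ J z by move/JJ'0.
have [V zV [Vz VJ cV]] := P1_locally_connected (open_nbhs_nbhs (conj oJ nJz)).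
have [t [et Vt]] := clz V zV.
have ez : curve_exterior p J z.
  apply: (exterior_max cV Vt (ee _ et)) => //.
  by apply/seteqP; split => // s [/VJ].
have J'e : J' `<=` curve_exterior p J.
  by apply: (exterior_max (jordan_connected jJ') J'z ez); rewrite setIC.
have : (curve_interior p J `&` curve_interior p J') y.
  split => // -[/J'e|/ee] /exteriorE[_]; exact.
by rewrite II'.
Qed.

(** The table of a letter is the complement of the exterior of the curve of its inverse. The
    interiors of the curves are nonempty: T i maps p into the second of a pair, and if the first
    were empty, the inverse of T i would map the exterior of the second, an open set, into a
    Jordan curve. *)
Lemma schottky_ping_pong (T : 'I_g -> 'M[C]_2) : schottky_generators T ->
  exists (K : letter g -> set (P1 R)) (p : P1 R), ping_pong T K p.
Proof.
move=> [uT [p [J [hJ JJ II TJ]]]].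
pose D a := ~` curve_exterior p (J a).
have jJ a : jordan_curve (J a) by case: (hJ a).
have pJ a : ~ J a p by case: (hJ a).
have T_ext i x : curve_exterior p (J (i, false)) x ->
    curve_interior p (J (i, true)) (moebius (T i) x).
  by move=> ex; rewrite -TJ; exists x.
have TV_ext i x : curve_exterior p (J (i, true)) x ->
    ~ curve_exterior p (J (i, false)) (moebius (invmx (T i)) x).
  by move=> ex /T_ext; rewrite moebiusVK// => ix; have [_] := (exteriorE p (J (i, true)) x).1 ex.
have I0 a : curve_interior p (J a) !=set0.
  case: a => i []; first by exists (moebius (T i) p); apply: T_ext; exact: exterior_base.
  apply: contrapT => I0.
  pose U := moebius (invmx (T i)) @` curve_exterior p (J (i, true)).
  have oU : open U by apply: moebius_open; [rewrite unitmx_inv|exact: exterior_open].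
  apply: (jordan_no_interior (J := J (i, false)) (x := moebius (invmx (T i)) p) (jJ _) oU).
    move=> _ [x ex <-]; have := TV_ext i x ex; apply: contra_notP => nJ.
    by apply/exteriorE => //; split => // ix; apply: I0; exists (moebius (invmx (T i)) x).
  by exists p => //; exact: exterior_base.
have DE a x : D a x <-> J a x \/ curve_interior p (J a) x.
  split=> [nE|[Jx|Ix] /exteriorE[]//].
  apply: contrapT => /not_orP[nJ nI]; apply: nE; exact/exteriorE.
exists (fun a => D (inv_letter a)), p; split.
- by move=> a; apply: open_closedC; exact: exterior_open.
- move=> a b ab; have ab' : inv_letter a != inv_letter b.
    apply: contraNneq ab => /(congr1 (@inv_letter g)).
    by rewrite /inv_letter /= !negbK -!surjective_pairing => ->.
  move: (inv_letter a) (inv_letter b) ab' => {}a {}b {}ab.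
  have JI := jordan_not_nested (jJ a) (pJ a) (jJ b) (pJ b) (JJ _ _ ab) (II _ _ ab) (I0 a).
  have ba : b != a by rewrite eq_sym.
  have IJ := jordan_not_nested (jJ b) (pJ b) (jJ a) (pJ a) (JJ _ _ ba) (II _ _ ba) (I0 b).
  apply/seteqP; split => // x [/DE ax /DE bx].
  case: ax => ax; case: bx => bx.
  + by have : (J a `&` J b) x by []; rewrite (JJ _ _ ab).
  + by have : (J a `&` curve_interior p (J b)) x by []; rewrite JI.
  + by have : (J b `&` curve_interior p (J a)) x by []; rewrite IJ.
  + by have : (curve_interior p (J a) `&` curve_interior p (J b)) x by []; rewrite (II _ _ ab).
- by move=> a; apply; exact: exterior_base.
- move=> [i []] x; rewrite /inv_letter /letter_mx /= /D => /contrapT ex.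
    exact: TV_ext.
  by move=> ex'; have [_] := (exteriorE p (J (i, true)) _).1 ex'; apply; exact: T_ext.
Qed.

End PingPong.

(** * Reduced words and change of free basis *)

Section ReducedWords.
Context (g : nat).
Local Notation word := (seq (letter g)).
Implicit Types (u v w s t : word) (a b : letter g).

Lemma inv_letterK : involutive (@inv_letter g).
Proof. by move=> [i b]; rewrite /inv_letter /= negbK. Qed.

Lemma inv_letter_neq a : inv_letter a != a.
Proof. by case: a => i b; rewrite xpair_eqE /= andbC; case: b. Qed.

Definition inv_word u : word := rev (map (@inv_letter g) u).

Lemma inv_word_cons a u : inv_word (a :: u) = rcons (inv_word u) (inv_letter a).
Proof. by rewrite /inv_word /= rev_cons. Qed.

Lemma inv_word_rcons u a : inv_word (rcons u a) = inv_letter a :: inv_word u.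
Proof. by rewrite /inv_word map_rcons rev_rcons. Qed.

Lemma size_inv_word u : size (inv_word u) = size u.
Proof. by rewrite size_rev size_map. Qed.

Lemma inv_wordK : involutive inv_word.
Proof.
move=> u; rewrite /inv_word map_rev revK -map_comp.
by rewrite -[RHS]map_id; apply: eq_map => a; exact: inv_letterK.
Qed.

Lemma reduced_cons a b u :
  reduced (a :: b :: u) = (b != inv_letter a) && reduced (b :: u).
Proof. by []. Qed.

Lemma reduced_catl u v : reduced (u ++ v) -> reduced u.
Proof. by case: u => // a u; rewrite /reduced /= cat_path => /andP[]. Qed.

Lemma reduced_catr u v : reduced (u ++ v) -> reduced v.
Proof.
case: u v => [|a u] [|b v] //; rewrite /reduced /= cat_path /=.
by move=> /and3P[].
Qed.

Lemma reduced_take n u : reduced u -> reduced (take n u).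
Proof. by rewrite -{1}(cat_take_drop n u); exact: reduced_catl. Qed.

Lemma reduced_rcons2 u a b :
  reduced (rcons (rcons u a) b) = reduced (rcons u a) && (b != inv_letter a).
Proof. by case: u => [|c u]; rewrite /reduced /= ?andbT// [LHS]rcons_path last_rcons. Qed.

Lemma reduced_inv_word u : reduced u -> reduced (inv_word u).
Proof.
elim: u => // a [//|b u] IH; rewrite reduced_cons => /andP[ba /IH].
rewrite (inv_word_cons a) (inv_word_cons b) reduced_rcons2 => -> /=.
by rewrite inv_letterK eq_sym.
Qed.

Lemma mkseqS T (v : nat -> T) n : mkseq v n.+1 = rcons (mkseq v n) (v n).
Proof. by rewrite /mkseq -[n.+1]addn1 iotaD map_cat cats1. Qed.

Lemma reduced_mkseq (v : nat -> letter g) n : reduced_inf v -> reduced (mkseq v n).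
Proof.
move=> rv; elim: n => // -[|n] // IH.
by move: IH; rewrite !mkseqS reduced_rcons2 => -> /=; exact: rv.
Qed.

Lemma take_mkseq T (v : nat -> T) k n : (k <= n)%N -> take k (mkseq v n) = mkseq v k.
Proof. by move=> kn; rewrite /mkseq -map_take take_iota (minn_idPl kn). Qed.

Lemma mkseq_cons T (a : T) (v : nat -> T) n :
  mkseq (fun k => if k is m.+1 then v m else a) n.+1 = a :: mkseq v n.
Proof. by rewrite /mkseq /= (iotaDl 1 0) -map_comp. Qed.

Definition red_rcons u a : word :=
  if u is b :: u' then
    if last b u' == inv_letter a then belast b u' else rcons u a
  else [:: a].

Lemma red_rconsP u a : reduced u ->
  [/\ reduced (red_rcons u a), (size u <= (size (red_rcons u a)).+1)%N &
      forall k, (k < size u)%N -> take k (red_rcons u a) = take k u].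
Proof.
case: (lastP u) => [|u' b] // ru.
have E : red_rcons (rcons u' b) a =
    if b == inv_letter a then u' else rcons (rcons u' b) a.
  by case: u' {ru} => [|c u'] //=; rewrite last_rcons belast_rcons.
rewrite E size_rcons; case: eqVneq => [_|ba]; split.
- by move: ru; rewrite -cats1 => /reduced_catl.
- by [].
- by move=> k; rewrite ltnS => ku; rewrite -cats1 takel_cat.
- by rewrite reduced_rcons2 ru /=; apply: contraNneq ba => ->; rewrite inv_letterK.
- by rewrite size_rcons size_rcons; lia.
- by move=> k ku; rewrite -[in LHS]cats1 takel_cat// size_rcons ltnW.
Qed.

Definition red_cat u s : word := foldl red_rcons u s.

Lemma red_catP u s : reduced u ->
  [/\ reduced (red_cat u s), (size u <= size (red_cat u s) + size s)%N &
      forall k, (k + size s <= size u)%N -> take k (red_cat u s) = take k u].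
Proof.
elim: s u => [|a s IH] u ru /=; first by rewrite addn0.
have [r1 s1 t1] := red_rconsP a ru; have [r2 s2 t2] := IH _ r1.
split=> //; first by lia.
move=> k; rewrite addnS => ks; rewrite t2; last by lia.
by rewrite t1//; lia.
Qed.

Lemma finite_words n : finite_set [set w : word | size w = n].
Proof.
apply: (@sub_finite_set _ _ ((@tval n (letter g)) @` setT)).
  by move=> w /= wn; exists (tcast (esym (esym wn)) (in_tuple w)) => //; rewrite val_tcast.
by apply: finite_image; exact: finite_finset.
Qed.

Lemma finite_short_words k : finite_set [set w : word | (size w < k)%N].
Proof.
rewrite (_ : [set w : word | _] = \bigcup_(n in `I_k) [set w : word | size w = n]).
  by apply: bigcup_finite => *; [exact: finite_II|exact: finite_words].
by apply/seteqP; split=> [w /= wk|w [n /= nk ->]] //; exists (size w).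
Qed.

End ReducedWords.

(** Two free bases of the same group give two maps between reduced words, inverse to each
    other. Appending one letter changes only boundedly many of the last letters of the image,
    and only finitely many words have a short image; so long prefixes determine the prefixes
    of the image, and both maps extend to infinite words. *)
Section ChangeOfBasis.
Context (g : nat) (a0 : letter g).
Local Notation word := (seq (letter g)).
Implicit Types (u w s t : word) (v : nat -> letter g).

(** What is retained of a change of free basis. *)
Definition quasi_prefix (phi : word -> word) : Prop :=
  [/\ forall w, reduced w -> reduced (phi w),
      forall w w', reduced w -> reduced w' -> phi w = phi w' -> w = w' &
      exists L, forall w a, reduced (rcons w a) ->
        (size (phi w) <= size (phi (rcons w a)) + L)%N /\
        forall k, (k + L <= size (phi w))%N ->
          take k (phi (rcons w a)) = take k (phi w)].

Section OneMap.
Context (phi : word -> word).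
Hypothesis qp : quasi_prefix phi.

Lemma quasi_prefix_grow k : exists N, forall w, reduced w -> (N <= size w)%N ->
  (k <= size (phi w))%N.
Proof.
have [_ phi_inj _] := qp.
(* phi is injective only on reduced words *)
pose f (w : word) : word + word := if reduced w then inl (phi w) else inr w.
have f_inj : injective f.
  move=> w w'; rewrite /f; case: ifP => rw; case: ifP => rw' // [] //.
  exact: phi_inj.
have fin2 : finite_set (f @^-1` (inl @` [set w : word | (size w < k)%N])).
  by apply: finite_preimage; [move=> ? ? _ _; exact: f_inj|exact/finite_image/finite_short_words].
have /finite_seqP[l El] := fin2.
exists (\max_(w <- l) size w).+1 => w rw; apply: contraTT; rewrite -!ltnNge => wk.
have : [set` l] w by rewrite -El /= /f rw; exists (phi w).
by rewrite ltnS => wl; exact: leq_bigmax_seq.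
Qed.

Lemma quasi_prefix_stable k : exists N, forall w t, reduced (w ++ t) -> (N <= size w)%N ->
  (k <= size (phi (w ++ t)))%N /\ take k (phi (w ++ t)) = take k (phi w).
Proof.
have [_ _ [L step]] := qp.
have [N HN] := quasi_prefix_grow (k + L); exists N => w t + Nw.
elim/last_ind: t => [|t a IH]; rewrite ?cats0 -?rcons_cat => rwt.
  by split => //; apply: leq_trans (HN w rwt Nw); exact: leq_addr.
have rwt' : reduced (w ++ t) by move: rwt; rewrite -cats1 => /reduced_catl.
have [_ wt] := IH rwt'; have [_ st] := step _ _ rwt.
have kL : (k + L <= size (phi (w ++ t)))%N.
  by apply: HN rwt' _; rewrite size_cat (leq_trans Nw)// leq_addr.
split; last by rewrite st.
apply: leq_trans (HN _ rwt _); first exact: leq_addr.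
by rewrite size_rcons size_cat; lia.
Qed.

Definition boundary_depth k : nat := projT1 (cid (quasi_prefix_stable k)).

(** The first n.+1 letters of phi w are the same for all long enough prefixes w of a reduced
    v, so the default letter a0 is not read. *)
Definition boundary (v : nat -> letter g) : nat -> letter g :=
  fun n => nth a0 (phi (mkseq v (boundary_depth n.+1))) n.

Lemma boundary_depthP k w t : reduced (w ++ t) -> (boundary_depth k <= size w)%N ->
  (k <= size (phi (w ++ t)))%N /\ take k (phi (w ++ t)) = take k (phi w).
Proof. by rewrite /boundary_depth; case: cid => N /= h rw Nw; exact: h. Qed.

Lemma boundaryE v k m : reduced_inf v -> (boundary_depth k <= m)%N ->
  take k (phi (mkseq v m)) = mkseq (boundary v) k.
Proof.
move=> rv km.
have mkD (i j : nat) : (i <= j)%N -> exists t, mkseq v j = mkseq v i ++ t.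
  by move=> ij; exists (drop i (mkseq v j)); rewrite -(take_mkseq v ij) cat_take_drop.
have red j : reduced (mkseq v j) by exact: reduced_mkseq.
have [t1 E1] := mkD _ _ km.
have big := boundary_depthP (w := mkseq v (boundary_depth k)) (t := t1) (k := k).
rewrite -E1 size_mkseq in big; have {big} [big _] := big (red _) (leqnn _).
apply: (@eq_from_nth _ a0); first by rewrite size_takel// size_mkseq.
move=> i; rewrite size_takel// => ik; rewrite nth_take// nth_mkseq// /boundary.
have im := leq_maxl m (boundary_depth i.+1); have dm := leq_maxr m (boundary_depth i.+1).
have [t2 E2] := mkD _ _ im; have [t3 E3] := mkD _ _ dm.
have h2 := boundary_depthP (w := mkseq v m) (t := t2) (k := k).
rewrite -E2 size_mkseq in h2; have {h2} [s2 h2] := h2 (red _) km.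
have h3 := boundary_depthP (w := mkseq v (boundary_depth i.+1)) (t := t3) (k := i.+1).
rewrite -E3 size_mkseq in h3; have {h3} [s3 h3] := h3 (red _) (leqnn _).
rewrite -(nth_take a0 ik) -h2 (nth_take a0 ik).
by rewrite -[RHS](nth_take a0 (ltnSn i)) -h3 (nth_take a0 (ltnSn i)).
Qed.

Lemma boundary_reduced v : reduced_inf v -> reduced_inf (boundary v).
Proof.
move=> rv n; have [phi_red _ _] := qp.
have : reduced (mkseq (boundary v) n.+2).
  by rewrite -(boundaryE rv (leqnn _)); apply/reduced_take/phi_red/reduced_mkseq.
by rewrite !mkseqS reduced_rcons2 => /andP[].
Qed.

Lemma boundary_prefix k v v' : reduced_inf v -> reduced_inf v' ->
  mkseq v (boundary_depth k) = mkseq v' (boundary_depth k) ->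
  mkseq (boundary v) k = mkseq (boundary v') k.
Proof. by move=> rv rv' vv'; rewrite -!(boundaryE _ (leqnn _))// vv'. Qed.

End OneMap.

Lemma boundaryK (phi psi : word -> word) (qphi : quasi_prefix phi)
    (qpsi : quasi_prefix psi) v : (forall w, reduced w -> psi (phi w) = w) ->
  reduced_inf v -> boundary qpsi (boundary qphi v) =1 v.
Proof.
move=> psiK rv n; have rv' := boundary_reduced qphi rv.
suff : mkseq (boundary qpsi (boundary qphi v)) n.+1 = mkseq v n.+1.
  by move=> /(congr1 (fun s => nth a0 s n)); rewrite !nth_mkseq.
set k := boundary_depth qpsi n.+1; set m := maxn n.+1 (boundary_depth qphi k).
rewrite -(boundaryE (qp := qpsi) rv' (leqnn _)) -/k -(boundaryE (qp := qphi) rv (leq_maxr n.+1 _)) -/m.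
have [phi_red _ _] := qphi; have rm := reduced_mkseq m rv.
have h := boundary_depthP (phi := psi) (qp := qpsi) (w := take k (phi (mkseq v m))) (t := drop k (phi (mkseq v m))) (k := n.+1).
rewrite cat_take_drop in h; have [|_ <-] := h (phi_red _ rm).
  by rewrite (boundaryE (qp := qphi) rv (leq_maxr n.+1 _)) size_mkseq.
by rewrite psiK// take_mkseq// leq_maxl.
Qed.

End ChangeOfBasis.

(** * The action of the free group and itineraries *)

Section WordMatrices.
Context (R : realType) (g : nat) (T : 'I_g -> 'M[R[i]]_2).
Local Notation C := R[i].
Local Notation word := (seq (letter g)).
Hypothesis uT : forall i, T i \in unitmx.
Implicit Types (u v w s : word) (a b : letter g).

Lemma letter_mx_unit a : letter_mx T a \in unitmx.
Proof. by rewrite /letter_mx; case: a.2; rewrite ?unitmx_inv. Qed.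

Lemma word_mx_nil : word_mx T [::] = 1.
Proof. by rewrite /word_mx big_nil. Qed.

Lemma word_mx_cons a u : word_mx T (a :: u) = letter_mx T a * word_mx T u.
Proof. by rewrite /word_mx big_cons. Qed.

Lemma word_mx_cat u v : word_mx T (u ++ v) = word_mx T u * word_mx T v.
Proof. by rewrite /word_mx big_cat. Qed.

Lemma word_mx_unit u : word_mx T u \in unitmx.
Proof.
elim: u => [|a u IH]; first by rewrite word_mx_nil unitmx1.
by rewrite word_mx_cons -[_ * _]/(_ *m _) unitmx_mul letter_mx_unit.
Qed.

Lemma letter_mx_inv a : letter_mx T (inv_letter a) * letter_mx T a = 1.
Proof.
case: a => i []; rewrite /letter_mx /=; first exact: mulmxV.
exact: mulVmx.
Qed.

Lemma word_mx_inv u : word_mx T (inv_word u) * word_mx T u = 1.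
Proof.
elim: u => [|a u IH]; first by rewrite /inv_word /= word_mx_nil mulr1.
rewrite inv_word_cons -cats1 word_mx_cat !word_mx_cons word_mx_nil mulr1.
by rewrite -mulrA (mulrA (letter_mx T (inv_letter a))) letter_mx_inv mul1r.
Qed.

Definition act u (x : P1 R) : P1 R := moebius (word_mx T u) x.

Lemma act_nil x : act [::] x = x.
Proof. by rewrite /act word_mx_nil moebius1. Qed.

Lemma act_cat u v x : act (u ++ v) x = act u (act v x).
Proof. by rewrite /act word_mx_cat moebiusM// word_mx_unit. Qed.

Lemma act_cons a u x : act (a :: u) x = moebius (letter_mx T a) (act u x).
Proof. by rewrite /act word_mx_cons moebiusM// ?word_mx_unit ?letter_mx_unit. Qed.

Lemma act1 a x : act [:: a] x = moebius (letter_mx T a) x.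
Proof. by rewrite act_cons act_nil. Qed.

Lemma act_rcons u a x : act (rcons u a) x = act u (moebius (letter_mx T a) x).
Proof. by rewrite -cats1 act_cat act1. Qed.

Lemma actVK u : cancel (act u) (act (inv_word u)).
Proof.
by move=> x; rewrite /act -moebiusM ?word_mx_unit// word_mx_inv moebius1.
Qed.

Lemma actKV u : cancel (act (inv_word u)) (act u).
Proof. by move=> x; rewrite -{1}(inv_wordK u) actVK. Qed.

End WordMatrices.

Section PglEq.
Context (R : realType).
Local Notation C := R[i].
Implicit Types A B D : 'M[C]_2.

Lemma pgl_eq_sym A B : pgl_eq A B -> pgl_eq B A.
Proof.
move=> [c c0 ->]; exists c^-1; first by rewrite invr_eq0.
by rewrite scalerA mulVf// scale1r.
Qed.

Lemma pgl_eq_trans B A D : pgl_eq A B -> pgl_eq B D -> pgl_eq A D.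
Proof.
move=> [c c0 ->] [d d0 ->]; exists (c * d); first by rewrite mulf_neq0.
by rewrite scalerA.
Qed.

Lemma pgl_eqM A B A' B' : pgl_eq A A' -> pgl_eq B B' -> pgl_eq (A * B) (A' * B').
Proof.
move=> [c c0 ->] [d d0 ->]; exists (c * d); first by rewrite mulf_neq0.
by rewrite -scalerAl -scalerAr scalerA.
Qed.

Lemma pgl_eq_moebius A B x : pgl_eq A B -> moebius A x = moebius B x.
Proof. by move=> [c c0 ->]; exact: moebiusZ. Qed.

End PglEq.

Section Itineraries.
Context (R : realType) (g : nat) (T : 'I_g -> 'M[R[i]]_2).
Local Notation C := R[i].
Local Notation word := (seq (letter g)).
Hypothesis uT : forall i, T i \in unitmx.
Context (K : letter g -> set (P1 R)) (p : P1 R).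
Hypothesis KP : ping_pong T K p.
Implicit Types (u v w s : word) (a b : letter g).
Local Notation act := (act T).

(** The points whose itinerary starts with u. The last letter contributes its table and not
    an image of the sphere. *)
Fixpoint kset u : set (P1 R) :=
  if u is a :: u' then
    if u' is [::] then K a else moebius (letter_mx T a) @` kset u'
  else setT.

Lemma kset_consE a b u : kset (a :: b :: u) = moebius (letter_mx T a) @` kset (b :: u).
Proof. by []. Qed.

Lemma kset_closed u : closed (kset u).
Proof.
have [cK _ _ _] := KP; elim: u => [|a [|b u] IH]; first exact: closedT.
  exact: cK.
by rewrite kset_consE; apply: moebius_closed => //; exact: letter_mx_unit.
Qed.

Lemma kset_head a u : reduced (a :: u) -> kset (a :: u) `<=` K a.
Proof.
have [_ dK _ ppK] := KP; elim: u a => [|b u IH] a; first by move=> _ x.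
rewrite reduced_cons kset_consE => /andP[ba rbu] _ [x /(IH _ rbu) Kx <-].
apply: ppK => Kx'; have : (K b `&` K (inv_letter a)) x by [].
by rewrite dK.
Qed.

Lemma kset_cat u v : reduced (u ++ v) -> kset (u ++ v) `<=` kset u.
Proof.
elim: u => [//|a [|b u] IH]; first by move=> /= ruv; exact: kset_head.
rewrite !cat_cons !kset_consE reduced_cons => /andP[_ /IH h].
by move=> _ [x /h Kx <-]; exists x.
Qed.

Lemma kset_take n u : reduced u -> kset u `<=` kset (take n u).
Proof. by rewrite -{1 2}(cat_take_drop n u); exact: kset_cat. Qed.

Lemma kset_disjoint u v : reduced u -> reduced v -> size u = size v -> u <> v ->
  kset u `&` kset v = set0.
Proof.
have [_ dK _ _] := KP.
elim: u v => [|a u IH] [|b v] // ru rv [suv] uv.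
apply/seteqP; split => // x [ux vx].
have [ab|ab] := eqVneq a b; last first.
  have : (K a `&` K b) x by split; [exact: kset_head ux|exact: kset_head vx].
  by rewrite dK.
subst b; case: u v ru rv suv uv IH ux vx => [|c u] [|d v] // ru rv suv uv IH.
rewrite !kset_consE => -[y uy <-] [z vz /(moebius_inj (letter_mx_unit uT a)) zy].
have : (kset (c :: u) `&` kset (d :: v)) y by split => //; rewrite -zy.
rewrite IH//; first by move: ru; rewrite reduced_cons => /andP[].
  by move: rv; rewrite reduced_cons => /andP[].
by move=> cd; apply: uv; rewrite cd.
Qed.

Lemma kset_act u v x : v <> [::] -> kset (u ++ v) (act u x) <-> kset v x.
Proof.
move=> v0; elim: u => [|a u IH]; first by rewrite act_nil.
have [b [s Es]] : exists b s, u ++ v = b :: s by case: (u) (v) v0 => [|b s] [|c t] // _; do 2 eexists.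
rewrite act_cons// -{1}[a :: u]cat1s -catA cat1s Es kset_consE -Es.
split=> [[y uvy /(moebius_inj (letter_mx_unit uT a)) yE]|vx].
  by apply/IH; rewrite -yE.
by exists (act u x) => //; exact/IH.
Qed.

(** The base point lies off all tables, so the letters of u give the itinerary of its image;
    the action is therefore free at p (base_free). *)
Lemma kset_base u : reduced u -> kset u (act u p).
Proof.
have [_ _ nKp ppK] := KP; case: (lastP u) => // {}u a _.
rewrite act_rcons// -cats1; apply/kset_act => //=; apply: ppK; exact: nKp.
Qed.

Lemma act_outside a u x : reduced (a :: u) -> ~ kset (inv_word (a :: u)) x ->
  K a (act (a :: u) x).
Proof.
have [_ _ _ ppK] := KP; move=> rau nx; rewrite act_cons//; apply: ppK => Kx.
apply: nx; rewrite inv_word_cons -cats1 -[x in kset _ x](actVK uT u).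
by apply/kset_act.
Qed.

Lemma base_free u v : reduced u -> reduced v -> act u p = act v p -> u = v.
Proof.
have [_ dK nKp _] := KP.
have K_base a s : reduced (a :: s) -> K a (act (a :: s) p).
  by move=> r; apply: kset_head (r) _ _; exact: kset_base.
elim: u v => [|a u IH] [|b v] // ru rv uv.
- by have := K_base _ _ rv; rewrite -uv act_nil => /nKp.
- by have := K_base _ _ ru; rewrite uv act_nil => /nKp.
have [ab|ab] := eqVneq a b; last first.
  have : (K a `&` K b) (act (b :: v) p) by split; [rewrite -uv|]; exact: K_base.
  by rewrite dK.
subst b; congr cons; apply: IH.
- exact: (@reduced_catr _ [:: a]).
- exact: (@reduced_catr _ [:: a]).
- by move: uv; rewrite !act_cons// => /(moebius_inj (letter_mx_unit uT a)).
Qed.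

(** A word pushes into the set of its prefix all points but those whose itinerary starts with
    the inverse of the rest of the word. A point that is not in the limit set has no long
    itinerary, so its images under long words follow long prefixes of these words. *)
Lemma act_deep u a s x : reduced (u ++ a :: s) -> ~ kset (inv_word (a :: s)) x ->
  kset (rcons u a) (act (u ++ a :: s) x).
Proof.
move=> rus nx; rewrite act_cat// -cats1; apply/kset_act => //=.
by apply: act_outside => //; exact: reduced_catr rus.
Qed.

End Itineraries.

Lemma nbhs_mx (R : realType) (B : 'M[R[i]]_2) (V : set 'M[R[i]]_2) : nbhs B V ->
  exists2 e : R, 0 < e &
    forall A : 'M[R[i]]_2, (forall i j, Normc.normc (B i j - A i j) < e) -> V A.
Proof.
move=> /nbhs_ballP[r /= /posC_real[{}r r0 ->] rV]; exists r => // A BA.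
apply: rV; split; first by rewrite ltcR.
by move=> i j; rewrite -ball_normE /= -[`|_|]/((_)%:C%C) ltcR.
Qed.

Lemma ultra_finType (S : Type) (I : finType) (U : set_system S) (UU : UltraFilter U)
    (f : S -> I) : exists i, U (f @^-1` [set i]).
Proof.
have UF : ProperFilter U by exact: ultra_proper.
suff H (l : seq I) : U [set x | f x \in l] -> exists i, U (f @^-1` [set i]).
  by apply: (H (enum I)); apply: filterS filterT => x _ /=; rewrite mem_enum.
elim: l => [U0|i l IH Ul].
  have [x] : exists x, [set x | f x \in [::]] x by exact: (@filter_ex _ U).
  by rewrite /= in_nil.
have [Ui|nUi] := in_ultra_setVsetC (f @^-1` [set i]) UU; first by exists i.
by apply: IH; apply: filterS2 nUi Ul => x /= fi; rewrite inE => /orP[/eqP|].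
Qed.

Section ComplexLimits.
Context (R : realType) (S : Type) (F : set_system S).
Hypothesis FF : Filter F.
Local Notation C := R[i].
Implicit Types (f h : S -> C) (a b : C).

Lemma cvgC_D f h a b : f @ F --> a -> h @ F --> b -> (fun t => f t + h t) @ F --> a + b.
Proof. exact: (@cvgD C C S F FF). Qed.

Lemma cvgC_M f h a b : f @ F --> a -> h @ F --> b -> (fun t => f t * h t) @ F --> a * b.
Proof. exact: (@cvgM C S F FF). Qed.

Lemma cvgC_N f a : f @ F --> a -> (fun t => - f t) @ F --> - a.
Proof. exact: (@cvgN C C S F FF). Qed.

Lemma cvgC_cst a : (fun _ : S => a) @ F --> a.
Proof. exact: (@cvg_cst C a S F FF). Qed.

End ComplexLimits.

Definition discrete_at_one (R : realType) (g : nat) (T : 'I_g -> 'M[R[i]]_2) : Prop :=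
  exists2 V : set 'M[R[i]]_2, nbhs (1 : 'M[R[i]]_2) V &
    forall u (c : R[i]), c != 0 -> V (c *: word_mx T u) -> pgl_eq (word_mx T u) 1.

Section LimitPoints.
Context (R : realType) (g : nat) (T : 'I_g -> 'M[R[i]]_2).
Local Notation C := R[i].
Local Notation word := (seq (letter g)).
Hypothesis uT : forall i, T i \in unitmx.
Context (K : letter g -> set (P1 R)) (p : P1 R).
Hypothesis KP : ping_pong T K p.
Hypothesis disc : discrete_at_one T.
Implicit Types (u w s : word) (a b : letter g) (v : nat -> letter g).
Local Notation act := (act T).
Local Notation kset := (kset T K).

(* The determinant of two vectors, which vanishes when they define the same point. *)
Let cross (q r : C * C) : C := q.1 * r.2 - q.2 * r.1.
Let det2 (B : 'M[C]_2) : C := B 0 0 * B 1 1 - B 0 1 * B 1 0.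

Let cross_lin B q r : cross (lin_act B q) (lin_act B r) = det2 B * cross q r.
Proof. by rewrite /cross /det2 /=; ring. Qed.

Let proj_pt_cross q r : nz q -> nz r -> cross q r = 0 -> proj_pt q = proj_pt r.
Proof.
case: q r => [q1 q2] [r1 r2]; rewrite /nz /cross /proj_pt /=.
have [->|q20] := eqVneq q2 0.
  rewrite orbF mul0r subr0 => q10 _ /eqP; rewrite mulf_eq0 (negPf q10) /= => /eqP ->.
  by rewrite eqxx.
have [->|r20] := eqVneq r2 0.
  rewrite mulr0 sub0r orbF => _ r10 /eqP; rewrite oppr_eq0 mulf_eq0 (negPf q20) /=.
  by rewrite (negPf r10).
move=> _ _ /eqP; rewrite subr_eq0 => /eqP h; congr Some.
by apply/eqP; rewrite eqr_div// h mulrC.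
Qed.

Let cross_homog (x y : P1 R) : x <> y -> cross (homog x) (homog y) != 0.
Proof.
move=> xy; apply/eqP => h; apply: xy.
by rewrite -(homogK x) -(homogK y) (proj_pt_cross _ _ h) ?homog_nz.
Qed.

Let kernel (B : 'M[C]_2) (x y : P1 R) : x <> y -> ~~ nz (lin_act B (homog x)) ->
  ~~ nz (lin_act B (homog y)) -> B = 0.
Proof.
move=> /cross_homog; move: (homog x) (homog y) => [x1 x2] [y1 y2].
rewrite /cross /nz /= !negb_or !negbK => c0 /andP[/eqP h1 /eqP h2] /andP[/eqP h3 /eqP h4].
have row (b1 b2 : C) : b1 * x1 + b2 * x2 = 0 -> b1 * y1 + b2 * y2 = 0 -> b1 = 0 /\ b2 = 0.
  move=> e1 e2; split; apply: (mulIf c0); rewrite mul0r.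
    transitivity (y2 * (b1 * x1 + b2 * x2) - x2 * (b1 * y1 + b2 * y2)); first by ring.
    by rewrite e1 e2; ring.
  transitivity (x1 * (b1 * y1 + b2 * y2) - y1 * (b1 * x1 + b2 * x2)); first by ring.
  by rewrite e1 e2; ring.
have [b00 b01] := row _ _ h1 h3; have [b10 b11] := row _ _ h2 h4.
apply/matrixP => i j; rewrite !mxE.
by case: i j => [[|[|//]] hi] [[|[|//]] hj];
  [rewrite -[RHS]b00|rewrite -[RHS]b01|rewrite -[RHS]b10|rewrite -[RHS]b11];
  congr (B _ _); exact: val_inj.
Qed.

Let adj2 (A : 'M[C]_2) : 'M[C]_2 := \matrix_(i, j)
  if i == 0 then (if j == 0 then A 1 1 else - A 0 1)
  else (if j == 0 then - A 1 0 else A 0 0).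

Let ord2 (i : 'I_2) : i = 0 \/ i = 1.
Proof. by case: i => [[|[|//]] hi]; [left|right]; exact: val_inj. Qed.

Let scale_mulE (d : C) (A B : 'M[C]_2) i j :
  (d *: (A * B)) i j = d * (A i 0 * B 0 j + A i 1 * B 1 j).
Proof. by rewrite !mxE sum_ord2. Qed.

Let adj2M A : adj2 A * A = det2 A *: 1.
Proof.
apply/matrixP => i j; rewrite !mxE sum_ord2 !mxE /det2.
by case: (ord2 i) => ->; case: (ord2 j) => -> /=; ring.
Qed.

Lemma act_pgl u (x : P1 R) : pgl_eq (word_mx T u) 1 -> act u x = x.
Proof. by move=> h; rewrite -[LHS]/(moebius _ _) (pgl_eq_moebius _ h) moebius1. Qed.

(* Were the limit B of the matrices A n invertible, the quotients (A n)^-1 A m would be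
   close to 1 for infinitely many n and m, hence trivial by discreteness. *)
Let singular_limit (U : set_system nat) (UU : UltraFilter U) (w : nat -> word)
    (c : nat -> C) (B : 'M[C]_2) : (forall N, U [set n | (N <= n)%N]) ->
  (forall n m, act (inv_word (w n)) p = act (inv_word (w m)) p -> n = m) ->
  (forall n, c n != 0) ->
  (forall i j, (fun n => c n * word_mx T (w n) i j) @ U --> B i j) -> det2 B = 0.
Proof.
move=> U_ge w_inj c0 AB; apply: contrapT => /eqP d0.
have UF : ProperFilter U by exact: ultra_proper.
pose A n := c n *: word_mx T (w n).
have {}AB i j : (fun n => A n i j) @ U --> B i j.
  rewrite (_ : (fun n => A n i j) = fun n => c n * word_mx T (w n) i j) ?AB//.
  by apply/funext => n; rewrite mxE.
have FF : Filter (filter_prod U U) by exact: filter_prod_filter.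
have A1 i j : (fun t : nat * nat => A t.1 i j) @ filter_prod U U --> B i j.
  by apply: cvg_comp (AB i j); exact: cvg_fst.
have A2 i j : (fun t : nat * nat => A t.2 i j) @ filter_prod U U --> B i j.
  by apply: cvg_comp (AB i j); exact: cvg_snd.
(* the quotient (A n)^-1 A m, up to a scalar tending to 1; the adjugate avoids inverses *)
pose Q (t : nat * nat) : 'M[C]_2 := (det2 B)^-1 *: (adj2 (A t.1) * A t.2).
have adjL i j : (fun t : nat * nat => adj2 (A t.1) i j) @ filter_prod U U --> adj2 B i j.
  rewrite mxE (_ : (fun t => _) = fun t : nat * nat => if i == 0 then
      (if j == 0 then A t.1 1 1 else - A t.1 0 1)
    else (if j == 0 then - A t.1 1 0 else A t.1 0 0)); last first.
    by apply/funext => t; rewrite mxE.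
  by case: ifP => _; case: ifP => _ //; exact: cvgC_N.
have QL i j : (fun t => Q t i j) @ filter_prod U U --> (1 : 'M[C]_2) i j.
  have -> : (1 : 'M[C]_2) = (det2 B)^-1 *: (adj2 B * B).
    by rewrite adj2M scalerA mulVf// scale1r.
  rewrite scale_mulE.
  rewrite (_ : (fun t => _) = fun t => (det2 B)^-1 *
      (adj2 (A t.1) i 0 * A t.2 0 j + adj2 (A t.1) i 1 * A t.2 1 j)); last first.
    by apply/funext => t; rewrite /Q scale_mulE.
  by apply: (cvgC_M FF); [exact: cvgC_cst|apply: (cvgC_D FF); exact: (cvgC_M FF)].
have [V V1 discV] := disc; have [e e0 eV] := nbhs_mx V1.
have e1 : 0 < Num.min e 1 by rewrite lt_min e0 ltr01.
have near_e i j := cvgC_normc FF (QL i j) e1.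
have : filter_prod U U [set t | forall i j, Normc.normc ((1 : 'M[C]_2) i j - Q t i j) < Num.min e 1].
  have fI := @filterI _ _ FF.
  have h := fI _ _ (fI _ _ (near_e 0 0) (near_e 0 1)) (fI _ _ (near_e 1 0) (near_e 1 1)).
  apply: (@filterS _ _ FF _ _ _ h) => t [[h1 h2] [h3 h4]] i j.
  by case: (ord2 i) => ->; case: (ord2 j) => ->.
move=> [[P P'] /= [UP UP'] PP'].
have [n [Pn P'n]] : exists n, (P `&` P') n by apply: (@filter_ex _ U); exact: filterI.
have [m [P'm nm]] : exists m, (P' `&` [set m | (n.+1 <= m)%N]) m.
  by apply: (@filter_ex _ U); apply: filterI.
have Qnm := PP' (n, m) (conj Pn P'm).
have AV : A n * ((c n)^-1 *: word_mx T (inv_word (w n))) = 1.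
  by rewrite /A -scalerAr -scalerAl scalerA mulVf// scale1r -{1}(inv_wordK (w n)) word_mx_inv.
pose k := (det2 B)^-1 * (det2 (A n) * ((c n)^-1 * c m)).
have QE : Q (n, m) = k *: word_mx T (inv_word (w n) ++ w m).
  rewrite /Q /= word_mx_cat; have -> : adj2 (A n) = det2 (A n) *: ((c n)^-1 *: word_mx T (inv_word (w n))).
    by rewrite -[LHS]mulr1 -AV mulrA adj2M -scalerAl mul1r.
  rewrite /A /k -!scalerAl -!scalerAr !scalerA; congr (_ *: _).
  by rewrite -!mulrA.
have k0 : k != 0.
  apply/eqP => k0; have := Qnm 0 0.
  have -> : (1 : 'M[C]_2) 0 0 - Q (n, m) 0 0 = 1 by rewrite QE k0 scale0r !mxE subr0.
  rewrite Normc.normc1.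
  by rewrite lt_min ltxx andbF.
have Vk : V (k *: word_mx T (inv_word (w n) ++ w m)).
  rewrite -QE; apply: eV => i j; apply: lt_le_trans (Qnm i j) _.
  by rewrite ge_min lexx.
have : act (inv_word (w n)) p = act (inv_word (w m)) p.
  have := act_pgl (act (inv_word (w m)) p) (discV _ _ k0 Vk).
  by rewrite act_cat// actKV.
by move=> /w_inj nm'; move: nm; rewrite nm' /= ltnn.
Qed.

(** Along an ultrafilter, the inverses of the prefixes of v converge off one point to a constant.
    If x and y differ, one of them is mapped to this constant, through the tables of the next
    letters; and so is one of two points outside the table of the first letter of v, through
    the tables of the inverses of the last letters. The limits of these letters differ, and
    their tables are closed and disjoint. *)
Lemma itinerary_inj v (x y : P1 R) : reduced_inf v ->
  (forall n, kset (mkseq v n) x) -> (forall n, kset (mkseq v n) y) -> x = y.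
Proof.
have [cK dK nKp _] := KP.
move=> rv vx vy; apply: contrapT => xy.
have [U [UU Uoo]] := ultraFilterLemma eventually_filter.
have UF : ProperFilter U by exact: ultra_proper.
have U_ge N : U [set n | (N <= n)%N] by apply: Uoo; exact: nbhs_infty_ge.
pose u n := mkseq v n; have ru n : reduced (u n) by exact: reduced_mkseq.
pose W n := word_mx T (inv_word (u n)).
pose s n : R := Normc.normc (W n 0 0) + Normc.normc (W n 0 1) +
  (Normc.normc (W n 1 0) + Normc.normc (W n 1 1)).
have s_ge n i j : Normc.normc (W n i j) <= s n.
  have := normc_ge0 (W n 0 0); have := normc_ge0 (W n 0 1).
  have := normc_ge0 (W n 1 0); have := normc_ge0 (W n 1 1).
  by case: (ord2 i) => ->; case: (ord2 j) => ->; rewrite /s; lra.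
have s0 n : 0 < s n.
  have := lin_act_nz (word_mx_unit uT (inv_word (u n))) (homog_nz (None : P1 R)).
  rewrite /nz /= !mulr1 !mulr0 !addr0 => /orP[] w0.
    by apply: lt_le_trans (s_ge n 0 0); rewrite normc_gt0.
  by apply: lt_le_trans (s_ge n 1 0); rewrite normc_gt0.
pose c n : C := ((s n)^-1)%:C%C.
have c0 n : c n != 0 by rewrite /c RtoCV invr_eq0 eq_complex /= eqxx andbT gt_eqF.
have nc n : Normc.normc (c n) = (s n)^-1.
  by rewrite /= expr0n addr0 sqrtr_sqr ger0_norm// invr_ge0 ltW.
have lim i j : exists b : C, (fun n => c n * W n i j) @ U --> b.
  apply: (@ultra_bounded_lim _ _ _ UU _ 1); apply: filterS (U_ge 0%N) => n _ /=.
  by rewrite -normc_le Normc.normcM nc mulrC ler_pdivrMr// mul1r.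
have /choice[b0 lim0] j := lim 0 j; have /choice[b1 lim1] j := lim 1 j.
pose B : 'M[C]_2 := \matrix_(i, j) if i == 0 then b0 j else b1 j.
have AB i j : (fun n => c n * W n i j) @ U --> B i j.
  by rewrite mxE; case: (ord2 i) => -> /=.
have w_inj n m : act (inv_word (inv_word (u n))) p = act (inv_word (inv_word (u m))) p -> n = m.
  rewrite !inv_wordK => /(base_free uT KP (ru n) (ru m)) /(congr1 size).
  by rewrite !size_mkseq.
have dB : det2 B = 0 by exact: (singular_limit UU U_ge w_inj c0 AB).
have B0 : B <> 0.
  move=> B0; have q4 : 0 < 4^-1 :> R by rewrite invr_gt0.
  have h i j := cvgC_normc UF (AB i j) q4.
  have [n [[h1 h2] [h3 h4]]] := filter_ex (filterI (filterI (h 0 0) (h 0 1)) (filterI (h 1 0) (h 1 1))).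
  have E i j : Normc.normc (B i j - c n * W n i j) = (s n)^-1 * Normc.normc (W n i j).
    by rewrite B0 mxE normcB subr0 Normc.normcM nc.
  move: h1 h2 h3 h4; rewrite !E => h1 h2 h3 h4.
  have : (s n)^-1 * s n = 1 by rewrite mulVf ?gt_eqF.
  by rewrite {2}/s !mulrDr; lra.
have act_lim z : nz (lin_act B (homog z)) ->
    (fun n => act (inv_word (u n)) z) @ U --> (proj_pt (lin_act B (homog z)) : P1 R).
  move=> nzB; have AB' i j : (fun n => (c n *: W n) i j) @ U --> B i j.
    rewrite (_ : (fun n => _) = fun n => c n * W n i j) ?AB//.
    by apply/funext => n; rewrite mxE.
  have h := @moebius_cvg_mx R nat U UF (fun n => c n *: W n) B (fun=> (homog z).1)
    (fun=> (homog z).2) (homog z) AB'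
    (@cvgC_cst R nat U UF (homog z).1) (@cvgC_cst R nat U UF (homog z).2) nzB.
  rewrite (_ : (fun n => _) = fun n => proj_pt (lin_act (c n *: W n) ((homog z).1, (homog z).2)))//.
  by apply/funext => n; rewrite -surjective_pairing -[RHS]/(moebius _ _) moebiusZ.
have constant z z' : nz (lin_act B (homog z)) -> nz (lin_act B (homog z')) ->
    proj_pt (lin_act B (homog z)) = proj_pt (lin_act B (homog z')).
  by move=> nz1 nz2; apply: proj_pt_cross => //; rewrite cross_lin dB mul0r.
have one_of z z' : z <> z' -> nz (lin_act B (homog z)) \/ nz (lin_act B (homog z')).
  move=> zz'; case E1 : (nz (lin_act B (homog z))); first by left.
  case E2 : (nz (lin_act B (homog z'))); first by right.
  by case: B0; apply: (kernel zz'); rewrite ?E1 ?E2.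
have [d Ud] := ultra_finType UU v.
have [c' Uc] := ultra_finType UU (fun n => inv_letter (v n.-1)).
have K_next z n : kset (u n.+1) z -> K (v n) (act (inv_word (u n)) z).
  rewrite /u mkseqS -cats1 -{1}(actKV uT (u n) z).
  by move/(kset_act uT K (u n)) => /=; exact.
have K_last z n : (0 < n)%N -> ~ K (v 0%N) z -> K (inv_letter (v n.-1)) (act (inv_word (u n)) z).
  case: n => // n _ nz0; have := reduced_inv_word (ru n.+1).
  rewrite {1}/u {1}mkseqS {1}inv_word_rcons => r; rewrite /u mkseqS inv_word_rcons /=.
  apply: (act_outside uT KP r).
  rewrite -inv_word_rcons inv_wordK -mkseqS => kz; apply: nz0.
  by have := kset_cat KP (u := [:: v 0%N]) (v := behead (u n.+1)) (ru n.+1) kz.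
have in_d z : nz (lin_act B (homog z)) -> (forall n, kset (u n) z) ->
    K d (proj_pt (lin_act B (homog z))).
  move=> nzB kz; apply: (closed_cvg _ (cK d) _ _ (act_lim z nzB)).
  by apply: filterS Ud => n /= <-; exact: K_next.
have in_c z : nz (lin_act B (homog z)) -> ~ K (v 0%N) z ->
    K c' (proj_pt (lin_act B (homog z))).
  move=> nzB kz; apply: (closed_cvg _ (cK c') _ _ (act_lim z nzB)).
  by apply: filterS2 Uc (U_ge 1%N) => n /= <- n0; exact: K_last.
pose q := act [:: inv_letter (v 0%N)] p.
have Kq : K (inv_letter (v 0%N)) q.
  by have := kset_base uT KP (u := [:: inv_letter (v 0%N)]) isT.
have nq : ~ K (v 0%N) q.
  move=> Kq'; have : (K (inv_letter (v 0%N)) `&` K (v 0%N)) q by [].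
  by rewrite dK// inv_letter_neq.
have pq : p <> q by move=> pq; apply: (nKp (inv_letter (v 0%N))); move: Kq; rewrite -pq.
have cd : c' != d.
  have [n [[/= <- <-] n0]] := filter_ex (filterI (filterI Uc Ud) (U_ge 1%N)).
  by case: n n0 => // n _ /=; rewrite eq_sym; exact: rv.
have [z nzz Kz] : exists2 z, nz (lin_act B (homog z)) & K d (proj_pt (lin_act B (homog z))).
  by have [h|h] := one_of _ _ xy; [exists x|exists y] => //; exact: in_d.
have [z' nzz' Kz'] : exists2 z, nz (lin_act B (homog z)) & K c' (proj_pt (lin_act B (homog z))).
  by have [h|h] := one_of _ _ pq; [exists p|exists q] => //; apply: in_c => //; exact: nKp.
have : (K c' `&` K d) (proj_pt (lin_act B (homog z))).
  by split => //; rewrite (constant z z').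
by rewrite dK.
Qed.

End LimitPoints.

Section WordsFinite.
Context (g : nat).
Local Notation word := (seq (letter g)).

Lemma injective_words_grow (r : nat -> word) k : injective r ->
  exists N, forall n, (N <= n)%N -> (k <= size (r n))%N.
Proof.
move=> r_inj.
have fin : finite_set (r @^-1` [set w : word | (size w < k)%N]).
  by apply: finite_preimage; [move=> ? ? _ _; exact: r_inj|exact: finite_short_words].
have /finite_seqP[l El] := fin.
exists (\max_(n <- l) n).+1 => n; apply: contraTT; rewrite -!ltnNge => nk.
have : [set` l] n by rewrite -El.
by rewrite ltnS => nl; exact: (leq_bigmax_seq (F := id)).
Qed.

End WordsFinite.

Section NormalForms.
Context (R : realType) (g : nat).
Local Notation C := R[i].
Local Notation word := (seq (letter g)).

Lemma red_rcons_mx (T : 'I_g -> 'M[C]_2) (uT : forall i, T i \in unitmx) (u : word) a :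
  word_mx T (red_rcons u a) = word_mx T u * letter_mx T a.
Proof.
case: (lastP u) => [|u' b]; first by rewrite /= word_mx_cons word_mx_nil mulr1 mul1r.
have -> : red_rcons (rcons u' b) a =
    if b == inv_letter a then u' else rcons (rcons u' b) a.
  by case: u' => [|c u'] //=; rewrite last_rcons belast_rcons.
case: eqVneq => [->|_]; last by rewrite -cats1 word_mx_cat word_mx_cons word_mx_nil mulr1.
by rewrite -cats1 word_mx_cat word_mx_cons word_mx_nil mulr1 -mulrA letter_mx_inv// mulr1.
Qed.

Lemma red_cat_mx (T : 'I_g -> 'M[C]_2) (uT : forall i, T i \in unitmx) (u s : word) :
  word_mx T (red_cat u s) = word_mx T u * word_mx T s.
Proof.
elim: s u => [|a s IH] u; first by rewrite word_mx_nil mulr1.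
by rewrite word_mx_cons mulrA -red_rcons_mx// -IH.
Qed.

Lemma normal_form (T : 'I_g -> 'M[C]_2) (A : 'M[C]_2) : (forall i, T i \in unitmx) ->
  (exists v, pgl_eq A (word_mx T v)) -> exists r, reduced r /\ pgl_eq A (word_mx T r).
Proof.
move=> uT [v Av]; have [rr _ _] := red_catP v (isT : reduced ([::] : word)).
by exists (red_cat [::] v); rewrite red_cat_mx// word_mx_nil mul1r.
Qed.

Lemma normal_form_map (M T : 'I_g -> 'M[C]_2) :
  (forall i, M i \in unitmx) -> (forall i, T i \in unitmx) ->
  rho_injective M -> rho_injective T ->
  (forall u, exists v, pgl_eq (word_mx M u) (word_mx T v)) ->
  exists2 phi : word -> word, quasi_prefix phi &
    forall w, pgl_eq (word_mx M w) (word_mx T (phi w)).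
Proof.
move=> uM uT injM injT MT.
have /choice[phi hphi] w : exists r, reduced r /\ pgl_eq (word_mx M w) (word_mx T r).
  exact: normal_form.
have phi_red w := (hphi w).1; have phiE w := (hphi w).2.
exists phi => //; split.
- by move=> w _; exact: phi_red.
- move=> w w' rw rw' ww'; apply: injM => //.
  by apply: pgl_eq_trans (phiE w) _; rewrite ww'; exact: pgl_eq_sym.
exists (\max_(a : letter g) size (phi [:: a])) => w a _.
have -> : phi (rcons w a) = red_cat (phi w) (phi [:: a]).
  have [rr _ _] := red_catP (phi [:: a]) (phi_red w).
  apply: injT => //; apply: pgl_eq_trans (pgl_eq_sym (phiE _)) _.
  by rewrite red_cat_mx// -cats1 word_mx_cat; exact: pgl_eqM.
have [_ s1 s2] := red_catP (phi [:: a]) (phi_red w).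
have La : (size (phi [:: a]) <= \max_(a : letter g) size (phi [:: a]))%N.
  exact: (leq_bigmax (F := fun a => size (phi [:: a]))).
split; first by lia.
by move=> k kL; apply: s2; lia.
Qed.

End NormalForms.

Section LimitSet.
Context (R : realType) (g : nat) (T : 'I_g -> 'M[R[i]]_2).
Local Notation C := R[i].
Local Notation word := (seq (letter g)).
Hypothesis uT : forall i, T i \in unitmx.
Context (K : letter g -> set (P1 R)) (p : P1 R).
Hypothesis KP : ping_pong T K p.
Hypothesis disc : discrete_at_one T.
Context (a0 : letter g).
Implicit Types (u w s : word) (a b : letter g) (v : nat -> letter g).
Local Notation act := (act T).
Local Notation kset := (kset T K).

Definition level n : set (P1 R) :=
  [set x | exists u, [/\ reduced u, size u = n & kset u x]].

(** This is the limit set of the group generated by T, by limit_set_lim_kset below. *)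
Definition lim_kset : set (P1 R) := [set x | forall n, level n x].

Lemma level_closed n : closed (level n).
Proof.
rewrite (_ : level n = \bigcup_(u in [set u | size u = n]) (if reduced u then kset u else set0)).
  apply: closed_bigcup; first exact: finite_words.
  by move=> u _; case: ifP => _; [exact: (kset_closed uT KP)|exact: closed0].
apply/seteqP; split=> [x [u [ru un ux]]|x [u /= un]].
  by exists u => //; rewrite ru.
by case: ifP => // ru ux; exists u.
Qed.

Lemma lim_kset_closed : closed lim_kset.
Proof.
rewrite (_ : lim_kset = \bigcap_(n in setT) level n).
  by apply: closed_bigI => n _; exact: level_closed.
by apply/seteqP; split=> [x h n _|x h n]; exact: h.
Qed.

Lemma kset_unique u w x : reduced u -> reduced w -> size u = size w ->
  kset u x -> kset w x -> u = w.
Proof.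
move=> ru rw uw ux wx; apply: contrapT => nuw.
by have : (kset u `&` kset w) x by []; rewrite (kset_disjoint uT KP ru rw uw nuw).
Qed.

Lemma level_le m n x : (m <= n)%N -> level n x -> level m x.
Proof.
move=> mn [u [ru un ux]]; exists (take m u); split.
- exact: reduced_take.
- by rewrite size_takel// un.
- exact: kset_take KP _ _ ru _ ux.
Qed.

Lemma itinerary_ex x : lim_kset x ->
  exists v, reduced_inf v /\ forall n, kset (mkseq v n) x.
Proof.
move=> xl; have /choice[u hu] n := xl n.
have take_u k n : (k <= n)%N -> take k (u n) = u k.
  move=> kn; have [ru un ux] := hu n; have [rk uk xk] := hu k.
  apply: (kset_unique (x := x)) => //; first exact: reduced_take.
    by rewrite size_takel ?uk// un.
  exact: kset_take KP _ _ ru _ ux.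
pose v n := nth a0 (u n.+1) n.
have vu n : mkseq v n = u n.
  have [_ un _] := hu n; apply: (@eq_from_nth _ a0); rewrite size_mkseq ?un// => i ni.
  by rewrite nth_mkseq// /v -(take_u _ _ ni) nth_take.
exists v; split=> [n|n]; last by rewrite vu; have [] := hu n.
have [ru _ _] := hu n.+2; move: ru; rewrite -vu !mkseqS reduced_rcons2.
by case/andP.
Qed.

Lemma itinerary_unique v v' x : reduced_inf v -> reduced_inf v' ->
  (forall n, kset (mkseq v n) x) -> (forall n, kset (mkseq v' n) x) -> v =1 v'.
Proof.
move=> rv rv' vx vx' n.
have : mkseq v n.+1 = mkseq v' n.+1.
  by apply: (kset_unique (x := x)); rewrite ?reduced_mkseq ?size_mkseq.
by move=> /(congr1 (fun s => nth a0 s n)); rewrite !nth_mkseq.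
Qed.

(** A limit of y along any ultrafilter has itinerary v; there is only one such point, so y
    converges to it. *)
Lemma itinerary_cvg v (y : nat -> P1 R) : reduced_inf v ->
  (forall k, \forall n \near \oo, kset (mkseq v k) (y n)) ->
  exists x, (forall n, kset (mkseq v n) x) /\ y @ \oo --> x.
Proof.
move=> rv vy.
have lim_in U : UltraFilter U -> \oo `<=` U ->
    exists2 x, forall n, kset (mkseq v n) x & y @ U --> x.
  move=> UU Uoo; have UF : ProperFilter U by exact: ultra_proper.
  have [x _ yx] := ultra_compact_lim UU (f := y) (@P1_compact R) filterT.
  exists x => // n; have cK : closed (kset (mkseq v n)) by exact: (kset_closed uT KP).
  apply: (closed_cvg _ cK _ _ yx).
  by apply: Uoo; exact: vy.
have [U [UU Uoo]] := ultraFilterLemma eventually_filter.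
have [x vx yx] := lim_in U UU Uoo; exists x; split => // V xV.
apply: contrapT => nV.
pose G := filter_from [set: nat] (fun N => [set n | (N <= n)%N /\ ~ V (y n)]).
have G_proper : ProperFilter G.
  apply: filter_from_proper.
    apply: filter_from_filter; first by exists 0%N.
    move=> i j _ _; exists (maxn i j) => // n [/=]; rewrite geq_max => /andP[im jm] nVn.
    by split; split.
  move=> N _; apply: contrapT => h; apply: nV; exists N => // n /= Nn.
  by apply: contrapT => nVn; apply: h; exists n.
have [U' [UU' GU']] := ultraFilterLemma G_proper.
have oU' : \oo `<=` U'.
  by move=> A [N _ NA]; apply: GU'; exists N => // n [Nn _]; exact: NA.
have [x' vx' yx'] := lim_in U' UU' oU'.
have xx' := itinerary_inj uT KP disc rv vx vx'; rewrite -xx' in yx'.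
have U'F : ProperFilter U' by exact: ultra_proper.
have : U' [set n | ~ V (y n)] by apply: GU'; exists 0%N => // n [].
move=> nVy; have [n [Vn nVn]] : exists n, (y @^-1` V `&` [set n | ~ V (y n)]) n.
  by apply: (@filter_ex _ U'); apply: filterI => //; exact: yx'.
exact: nVn.
Qed.

Lemma itinerary_point v : reduced_inf v -> exists x, forall n, kset (mkseq v n) x.
Proof.
move=> rv; have [|x [vx _]] := @itinerary_cvg v (fun n => act (mkseq v n) p) rv.
  move=> k; exists k => // n /= kn; rewrite -(take_mkseq v kn).
  apply: (kset_take KP); first exact: reduced_mkseq.
  by apply: (kset_base uT KP); exact: reduced_mkseq.
by exists x.
Qed.

Lemma itinerary_lim v x : reduced_inf v -> (forall n, kset (mkseq v n) x) -> lim_kset x.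
Proof.
by move=> rv vx n; exists (mkseq v n); split; rewrite ?reduced_mkseq ?size_mkseq.
Qed.

Lemma itinerary_shrink v x (V : set (P1 R)) : reduced_inf v ->
  (forall n, kset (mkseq v n) x) -> nbhs x V -> exists n, kset (mkseq v n) `<=` V.
Proof.
move=> rv vx xV; apply: contrapT => /forallNP h.
have /choice[y hy] n : exists z, kset (mkseq v n) z /\ ~ V z.
  by have /existsNP[z /not_implyP[zk nz]] := h n; exists z.
have [|x' [vx' yx']] := @itinerary_cvg v y rv.
  move=> k; exists k => // n /= kn; rewrite -(take_mkseq v kn).
  by apply: (kset_take KP); [exact: reduced_mkseq|case: (hy n)].
have xx' := itinerary_inj uT KP disc rv vx vx'; rewrite -xx' in yx'.
have [N _ NV] := yx' V xV.
by have [_] := hy N; apply; exact: (NV N (leqnn N)).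
Qed.

(** The sets of the other words of length n form a finite family of closed sets, none of
    which contains x. *)
Lemma itinerary_locally_constant v x n : reduced_inf v ->
  (forall n, kset (mkseq v n) x) ->
  exists2 V, nbhs x V & forall y, V y -> level n y -> kset (mkseq v n) y.
Proof.
move=> rv vx.
pose F := \bigcup_(u in [set u | size u = n])
  (if reduced u && (u != mkseq v n) then kset u else set0).
have cF : closed F.
  apply: closed_bigcup; first exact: finite_words.
  by move=> u _; case: ifP => _; [exact: (kset_closed uT KP)|exact: closed0].
exists (~` F).
  apply: open_nbhs_nbhs; split; first exact: closed_openC.
  move=> [u /= un]; case: ifP => // /andP[ru /eqP unv] ux; apply: unv.
  by apply: (kset_unique (x := x)); rewrite ?reduced_mkseq ?size_mkseq.
move=> y nFy [u [ru un uy]]; have [<-//|unv] := eqVneq u (mkseq v n).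
by case: nFy; exists u => //; rewrite ru unv.
Qed.

Lemma act_deep_level z n0 k w : (0 < n0)%N -> ~ level n0 z -> reduced w ->
  (k + n0 <= size w)%N -> kset (take k w) (act w z).
Proof.
move=> n00 nz rw kw.
have sw : (size w - n0 < size w)%N by lia.
have : w = take (size w - n0) w ++ nth a0 w (size w - n0) :: drop (size w - n0).+1 w.
  by rewrite -drop_nth// cat_take_drop.
set u := take _ _; set a := nth _ _ _; set s := drop _ _ => wE.
have su : size u = (size w - n0)%N by rewrite size_takel// leq_subr.
have rws : reduced (u ++ a :: s) by rewrite -wE.
have h : kset (rcons u a) (act (u ++ a :: s) z).
  apply: (act_deep uT KP) => // kz; apply: nz; exists (inv_word (a :: s)); split => //.
    by apply: reduced_inv_word; exact: reduced_catr rws.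
  rewrite size_inv_word /=; have := congr1 size wE; rewrite size_cat /= su; lia.
have -> : take k w = take k (rcons u a).
  by rewrite -cats1 takel_cat ?su; [rewrite wE takel_cat// su; lia|lia].
apply: (kset_take KP); first by move: rws; rewrite -cat_rcons => /reduced_catl.
by rewrite [X in act X]wE.
Qed.

(** Acting by a letter either removes the first letter of an itinerary or adds one, so at most
    one level is lost. *)
Lemma lim_kset_invariant w x : lim_kset x -> lim_kset (act w x).
Proof.
have [_ dK _ ppK] := KP.
move=> xl; elim: w => [|a w IH]; first by rewrite act_nil.
rewrite act_cons//; move: (act w x) IH => {x w xl} y yl.
have [v [rv vy]] := itinerary_ex yl => n.
pose v' k := v k.+1.
have vE m : mkseq v m.+1 = v 0%N :: mkseq v' m.
  by rewrite -mkseq_cons; apply: eq_mkseq => -[].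
have [va|va] := eqVneq (v 0%N) (inv_letter a).
  apply: (level_le (leqnSn n)); exists (mkseq v' n.+1); split.
  - by have := reduced_mkseq n.+2 rv; rewrite vE => /(@reduced_catr _ [:: _]).
  - by rewrite size_mkseq.
  have := vy n.+2; rewrite vE va => -[z zk <-].
  rewrite -moebiusM ?letter_mx_unit//.
  by rewrite -{1}(inv_letterK a) letter_mx_inv// moebius1.
apply: (@level_le n n.+2); first by lia.
exists (a :: mkseq v n.+1); split.
- have := reduced_mkseq n.+1 rv; rewrite vE reduced_cons => ->.
  by rewrite va.
- by rewrite -[LHS]/((size (mkseq v n.+1)).+1) size_mkseq.
- by have := vy n.+1; rewrite vE kset_consE => h; exists y.
Qed.

End LimitSet.

(** * The limit set as a space of infinite words *)

Section SchottkyCoding.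
Context (R : realType) (g : nat) (M : 'I_g -> 'M[R[i]]_2) (x0 : P1 R).
Local Notation C := R[i].
Local Notation word := (seq (letter g)).
Local Notation Lambda := (limit_set M).
Implicit Types (u w s : word) (a b : letter g) (v : nat -> letter g).

(** The map c inverts iota_rho, and both are continuous: c is locally constant in each letter,
    and the sets of points with given first letters are bases of neighbourhoods in the limit
    set. *)
Record coding (c : P1 R -> nat -> letter g) : Prop := Coding {
  coding_reduced : forall x, Lambda x -> reduced_inf (c x) ;
  coding_iota : forall x, Lambda x -> iota_rho M x0 (c x) = x ;
  coding_limit : forall v, reduced_inf v -> Lambda (iota_rho M x0 v) ;
  coding_inj : forall v, reduced_inf v -> c (iota_rho M x0 v) =1 v ;
  coding_cvg : forall v, reduced_inf v ->
    (fun n => moebius (word_mx M (mkseq v n)) x0) @ \oo --> iota_rho M x0 v ;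
  coding_continuous : forall x n, Lambda x -> exists2 V, nbhs x V &
    forall y, V y -> Lambda y -> mkseq (c y) n = mkseq (c x) n ;
  coding_basis : forall x V, Lambda x -> nbhs x V -> exists n, forall y,
    Lambda y -> mkseq (c y) n = mkseq (c x) n -> V y ;
  coding_closed : closed Lambda }.

Lemma ping_pong_injective (T : 'I_g -> 'M[C]_2) K p : (forall i, T i \in unitmx) ->
  ping_pong T K p -> rho_injective T.
Proof.
move=> uT KP u v ru rv uv; apply: (base_free uT KP ru rv).
exact: pgl_eq_moebius.
Qed.

(** There are finitely many words of each length, so the reduced words of distinct elements w n
    get arbitrarily long. If z has no infinite itinerary, act_deep_level puts x in every level,
    and if it has one, so has its orbit. Conversely the prefixes of an itinerary applied to p
    tend to the point that has this itinerary. *)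
Lemma limit_set_lim_kset (T : 'I_g -> 'M[C]_2) K p (a0 : letter g) :
  (forall i, T i \in unitmx) -> ping_pong T K p ->
  discrete_at_one T -> same_pgl_subgroup M T -> Lambda = lim_kset T K.
Proof.
move=> uT KP disc [MT TM]; apply/seteqP; split=> x.
  move=> [z [w [w_inj wx]]].
  have /choice[r hr] n : exists r, reduced r /\ pgl_eq (word_mx M (w n)) (word_mx T r).
    exact: normal_form.
  have r_inj : injective r.
    move=> m n mn; apply: w_inj; apply: pgl_eq_trans (hr m).2 _.
    by rewrite mn; apply: pgl_eq_sym; exact: (hr n).2.
  have {}wx : (fun n => act T (r n) z) @ \oo --> x.
    rewrite (_ : (fun n => _) = fun n => moebius (word_mx M (w n)) z)//.
    by apply/funext => n; rewrite (pgl_eq_moebius z (hr n).2).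
  have [zl|zl] := pselect (lim_kset T K z).
    apply: (closed_cvg _ (lim_kset_closed uT KP) _ _ wx).
    by apply: nearW => n; exact: (lim_kset_invariant uT KP a0).
  have /existsNP[n0 nz] := zl.
  have n00 : (0 < n0)%N.
    by rewrite lt0n; apply: contra_notN nz => /eqP ->; exists [::].
  move=> k; apply: (closed_cvg _ (level_closed uT KP (n := k)) _ _ wx).
  have [N HN] := injective_words_grow (k + n0) r_inj.
  exists N => // n /= Nn; have rk := HN n Nn; have rr := (hr n).1.
  exists (take k (r n)); split; first exact: reduced_take.
    by rewrite size_takel//; lia.
  exact: (act_deep_level uT KP a0 n00 nz rr rk).
move=> xl; have [v [rv vx]] := itinerary_ex uT KP a0 xl.
have /choice[w hw] n := TM (mkseq v n).
exists p, w; split=> [m n mn|].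
  have h : pgl_eq (word_mx T (mkseq v m)) (word_mx T (mkseq v n)).
    by apply: pgl_eq_trans (hw m) _; apply: pgl_eq_trans mn _; exact: pgl_eq_sym.
  have := base_free uT KP (reduced_mkseq m rv) (reduced_mkseq n rv) (pgl_eq_moebius p h).
  by move=> /(congr1 size); rewrite !size_mkseq.
have [|x' [vx' yx]] := @itinerary_cvg R g T uT K p KP disc v (fun n => act T (mkseq v n) p) rv.
  move=> k; exists k => // n /= kn; rewrite -(take_mkseq v kn).
  by apply: (kset_take KP); [|apply: (kset_base uT KP)]; exact: reduced_mkseq.
rewrite (itinerary_inj uT KP disc rv vx vx').
rewrite (_ : (fun n => _) = fun n => act T (mkseq v n) p)//.
by apply/funext => n; rewrite -(pgl_eq_moebius p (hw n)).
Qed.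

(** Infinite words over M are identified with infinite words over T by the boundary maps of the
    change of basis, and words over T with points of the limit set by itineraries. *)
Lemma schottky_coding : (0 < g)%N -> schottky M -> ~ Lambda x0 ->
  exists c, coding c.
Proof.
move=> g0 [uM injM discM [T TS MT]] nx0.
pose a0 : letter g := (Ordinal g0, false).
have [K [p KP]] := schottky_ping_pong TS; have uT := TS.1.
have [MT1 MT2] := MT.
have disc : discrete_at_one T.
  have [V V1 HV] := discM [::]; rewrite word_mx_nil in V1 HV.
  exists V => // u c c0 Vu; have [w [d d0 uw]] := MT2 u.
  apply: pgl_eq_trans (HV w (c * d) _ _); first by exists d.
    by rewrite mulf_neq0.
  by rewrite -scalerA -uw.
have injT := ping_pong_injective uT KP.
have [phi qphi phiE] := normal_form_map uM uT injM injT MT1.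
have [psi qpsi psiE] := normal_form_map uT uM injT injM MT2.
have [phi_red _ _] := qphi; have [psi_red _ _] := qpsi.
have psiK w : reduced w -> psi (phi w) = w.
  move=> rw; apply: injM => //; first exact/psi_red/phi_red.
  by apply: pgl_eq_trans (pgl_eq_sym (psiE _)) _; exact/pgl_eq_sym/phiE.
have phiK w : reduced w -> phi (psi w) = w.
  move=> rw; apply: injT => //; first exact/phi_red/psi_red.
  by apply: pgl_eq_trans (pgl_eq_sym (phiE _)) _; exact/pgl_eq_sym/psiE.
have LE := limit_set_lim_kset a0 uT KP disc MT.
pose bphi v := boundary a0 qphi v; pose bpsi v := boundary a0 qpsi v.
have rphi v : reduced_inf v -> reduced_inf (bphi v) by exact: boundary_reduced.
have rpsi v : reduced_inf v -> reduced_inf (bpsi v) by exact: boundary_reduced.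
(* x0 has no infinite itinerary, so its images by the prefixes of v follow the T-words of
   these prefixes, that is bphi v *)
have cvg_iota v x : reduced_inf v -> (forall n, kset T K (mkseq (bphi v) n) x) ->
    (fun n => moebius (word_mx M (mkseq v n)) x0) @ \oo --> x.
  move=> rv vx; rewrite LE in nx0; have /existsNP[n0 nz] := nx0.
  have n00 : (0 < n0)%N.
    by rewrite lt0n; apply: contra_notN nz => /eqP ->; exists [::].
  pose y n := act T (phi (mkseq v n)) x0.
  have yE n : moebius (word_mx M (mkseq v n)) x0 = y n by exact: pgl_eq_moebius.
  rewrite (funext yE).
  have [|x' [vx' yx]] := @itinerary_cvg R g T uT K p KP disc (bphi v) y (rphi _ rv).
    move=> k; exists (boundary_depth qphi (k + n0)) => // n /= kn.
    have rn := reduced_mkseq n rv.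
    have tE : take k (phi (mkseq v n)) = mkseq (bphi v) k.
      rewrite -(take_mkseq (bphi v) (leq_addr n0 k)) -(boundaryE (qp := qphi) a0 rv kn).
      by rewrite take_takel// leq_addr.
    have [sz _] := boundary_depthP (qp := qphi) (w := mkseq v n) (t := [::]) (k := (k + n0)%N)
      (etrans (congr1 _ (cats0 _)) rn) (leq_trans kn (eq_leq (esym (size_mkseq _ _)))).
    rewrite cats0 in sz; rewrite -tE.
    by apply: (act_deep_level uT KP a0 n00 nz _ sz); exact: phi_red.
  by rewrite (itinerary_inj uT KP disc (rphi _ rv) vx vx').
have lim_iota v x : reduced_inf v -> (forall n, kset T K (mkseq (bphi v) n) x) ->
    iota_rho M x0 v = x.
  move=> rv vx; apply: (@cvg_lim _ (@P1_hausdorff R)); exact: cvg_iota.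
have /choice[t ht] x : exists v, Lambda x -> reduced_inf v /\ forall n, kset T K (mkseq v n) x.
  have [xl|xl] := pselect (Lambda x); last by exists (fun=> a0).
  by move: (xl); rewrite LE => /(itinerary_ex uT KP a0)[v hv]; exists v.
have t_red x : Lambda x -> reduced_inf (t x) by move/ht => [].
have t_it x : Lambda x -> forall n, kset T K (mkseq (t x) n) x by move/ht => [].
have phipsi v : reduced_inf v -> bphi (bpsi v) =1 v by exact: boundaryK.
have psiphi v : reduced_inf v -> bpsi (bphi v) =1 v by exact: boundaryK.
have point v : reduced_inf v -> exists x, [/\ Lambda x, iota_rho M x0 v = x &
    forall n, kset T K (mkseq (bphi v) n) x].
  move=> rv; have [x vx] := itinerary_point uT KP disc (rphi _ rv).
  exists x; split=> //; last exact: lim_iota.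
  by rewrite LE; exact: itinerary_lim (rphi _ rv) vx.
have iota_c x : Lambda x -> iota_rho M x0 (bpsi (t x)) = x.
  move=> xl; apply: lim_iota; first exact/rpsi/t_red.
  by move=> n; rewrite (eq_mkseq (phipsi _ (t_red _ xl))); exact: t_it.
exists (fun x => bpsi (t x)); split.
- by move=> x xl; exact/rpsi/t_red.
- exact: iota_c.
- by move=> v rv; have [x [xl -> _]] := point v rv.
- move=> v rv n; have [x [xl -> vx]] := point v rv.
  have tE : t x =1 bphi v := itinerary_unique uT KP a0 (t_red _ xl) (rphi _ rv) (t_it _ xl) vx.
  by rewrite (funext tE) psiphi.
- by move=> v rv; have [x [xl -> vx]] := point v rv; exact: cvg_iota.
- move=> x n xl; have [V xV HV] := itinerary_locally_constant uT KP (boundary_depth qpsi n) (t_red _ xl) (t_it _ xl).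
  exists V => // y Vy yl; apply: boundary_prefix => //; try exact: t_red.
  have ky : kset T K (mkseq (t x) (boundary_depth qpsi n)) y.
    by apply: HV => //; move: yl; rewrite LE; exact.
  apply: (kset_unique uT KP (x := y)); rewrite ?size_mkseq ?reduced_mkseq//; try exact: t_red.
  exact: t_it.
- move=> x V xl xV; have [n nV] := itinerary_shrink uT KP disc (t_red _ xl) (t_it _ xl) xV.
  exists (boundary_depth qphi n) => y yl cxy; apply: nV.
  have := boundary_prefix a0 (rpsi _ (t_red _ yl)) (rpsi _ (t_red _ xl)) cxy.
  rewrite -/(bphi _) -/(bphi _) (eq_mkseq (phipsi _ (t_red _ yl))) (eq_mkseq (phipsi _ (t_red _ xl))) => <-.
  exact: t_it.
- by rewrite LE; exact: (lim_kset_closed uT KP).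
Qed.

End SchottkyCoding.

Section NullIntegral.
Import HBNNSimple.

(** The simple functions below f restricted to B vanish off B, so their integrals are zero. *)
Lemma null_integral (d : measure_display) (T : measurableType d) (R : realType)
    (mu : {measure set T -> \bar R}) (B : set T) (f : T -> \bar R) :
  measurable B -> mu B = 0%E -> (forall x, B x -> (0 <= f x)%E) ->
  (\int[mu]_(x in B) f x = 0)%E.
Proof.
move=> mB B0 f0; apply/eqP; rewrite eq_le integral_ge0// andbT ge0_integralE//.
apply: ge_ereal_sup => _ [h hf <-].
rewrite /sintegral fsbig1// => r _; have [->|r0] := eqVneq r 0; first by rewrite mul0e.
rewrite (_ : mu _ = 0%E) ?mule0//; apply: (subset_measure0 _ mB _ B0).
  exact: measurable_sfunP.
move=> x /= hx; apply: contrapT => Bx; have := hf x.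
rewrite /patch memNset// lee_fin hx => r_le; move: r0; rewrite eq_le r_le /=.
by rewrite -hx fun_ge0.
Qed.

End NullIntegral.

(** * Locally constant functions on the limit set *)

Section LimitSetSpace.
Context (R : realType) (g : nat) (M : 'I_g -> 'M[R[i]]_2) (x0 : P1 R).
Local Notation C := R[i].
Local Notation Lambda := (limit_set M).
Local Notation L := (set_type Lambda).
Context (c : P1 R -> nat -> letter g).
Hypothesis hc : coding M x0 c.
Implicit Types (x y : L) (n : nat).

Lemma nbhs_sub x (U : set L) :
  nbhs x U <-> exists2 V, nbhs (\val x) V & forall y, V (\val y) -> U y.
Proof.
split.
  case=> _ /= [] [W oW <- /= Wx sWU]; exists W; last exact: sWU.
  exact: open_nbhs_nbhs.
by case=> V Vx VU; apply: filterS VU _; exact: (@initial_continuous _ _ set_val x V Vx).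
Qed.

Definition prefix_of n x := mkseq (c (\val x)) n.

Lemma Lambda_val x : Lambda (\val x).
Proof. exact: set_mem (valP x). Qed.

Lemma prefix_of_le m n x y : (m <= n)%N -> prefix_of n x = prefix_of n y ->
  prefix_of m x = prefix_of m y.
Proof. by move=> mn e; rewrite /prefix_of -!(take_mkseq _ mn) -!/(prefix_of n _) e. Qed.

Lemma prefix_of_near n x : \forall y \near x, prefix_of n y = prefix_of n x.
Proof.
have [V Vx VP] := coding_continuous hc n (Lambda_val x).
by apply/nbhs_sub; exists V => // y Vy; exact: VP (Lambda_val y).
Qed.

Lemma prefix_of_basis x (U : set L) : nbhs x U ->
  exists n, forall y, prefix_of n y = prefix_of n x -> U y.
Proof.
move=> /nbhs_sub[V Vx VU]; have [n nP] := coding_basis hc (Lambda_val x) Vx.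
by exists n => y e; apply: VU; apply: nP e; exact: Lambda_val.
Qed.

Lemma Lambda_compact : compact [set: L].
Proof.
rewrite compact_ultra => F FF _.
have cL : compact Lambda.
  by apply: closed_compact; exact: coding_closed hc.
have FL : F ((\val : L -> P1 R) @^-1` Lambda).
  by apply: filterS filterT => x _; exact: Lambda_val.
have [a La Fa] := ultra_compact_lim FF cL FL.
exists (SigSub (mem_set La)); split=> // U /nbhs_sub[V Va VU].
by apply: filterS VU _; exact: Fa.
Qed.

(** The Lebesgue number lemma, with common prefixes in place of small distances. *)
Lemma uniform_prefix (P : L -> L -> Prop) :
  (forall z, \forall x \near z, P z x) ->
  exists n, forall x y, prefix_of n x = prefix_of n y -> exists z, P z x /\ P z y.
Proof.
move=> Pz.
have : \forall n \near \oo, [set: L] `<=` [set x | forall y,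
    prefix_of n x = prefix_of n y -> exists z, P z x /\ P z y].
  apply: (compact_near_coveringP [set: L]).1 Lambda_compact _ _ _ _ _ => z _.
  have [m mP] := prefix_of_basis (Pz z).
  exists ([set x | prefix_of m x = prefix_of m z], [set n | (m <= n)%N]).
    by split; [exact: prefix_of_near|exists m].
  move=> [x n] [/= xz mn] y xy; exists z; split; apply: mP => //.
  by rewrite -xz; apply/esym; exact: prefix_of_le xy.
by case=> n _ nP; exists n => x y; apply: (nP n) => //=.
Qed.

Definition depends_on n (a : L -> C) : Prop :=
  forall x y, prefix_of n x = prefix_of n y -> a x = a y.

Lemma depends_on_le m n a : (m <= n)%N -> depends_on m a -> depends_on n a.
Proof. by move=> mn am x y /(prefix_of_le mn); exact: am. Qed.

Lemma depends_on_near n a z : depends_on n a -> \forall x \near z, a x = a z.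
Proof. by move=> an; apply: filterS (prefix_of_near n z) => x; exact: an. Qed.

Lemma depends_on_continuous n a : depends_on n a -> a \in @continuous_pred R L.
Proof.
move=> an; apply/mem_set => z V Va.
by apply: filterS (depends_on_near z an) => x ax; rewrite /= ax; exact: nbhs_singleton.
Qed.

(** A locally constant function on a compact space is uniformly so. *)
Lemma loc_constP (a : CLambda M) : loc_const M a <-> exists n, depends_on n (a : cfun _ _).
Proof.
split=> [la|[n an] z]; last exact: depends_on_near an.
have [n nP] := uniform_prefix la.
by exists n => x y /nP[z [-> ->]].
Qed.

(** Sampling a continuous function at one point of each prefix class. *)
Lemma loc_const_dense (x1 : L) (a : CLambda M) (e : R) : 0 < e ->
  exists b : CLambda M, loc_const M b /\
    forall x, Normc.normc ((a : cfun _ _) x - (b : cfun _ _) x) < e.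
Proof.
move=> e0; pose P (z x : L) := Normc.normc ((a : cfun _ _) z - (a : cfun _ _) x) < e / 2.
have [] := @uniform_prefix P.
  move=> z; have Fz : Filter (nbhs z) by exact: nbhs_filter.
  have := @cfun_continuous R L (a : cfun _ _) z.
  move=> /(@cvgrPdist_lt _ C _ _ Fz) /(_ (e / 2)%:C%C).
  rewrite ltcR divr_gt0// => /(_ isT).
  by apply: filterS => x; rewrite -normc_lt.
move=> n nP; pose s (x : L) := xget x1 [set y | prefix_of n y = prefix_of n x].
have sP x : prefix_of n (s x) = prefix_of n x.
  by rewrite /s; apply: (@xgetPex _ x1 [set y | prefix_of n y = prefix_of n x]); exists x.
have ds : depends_on n ((a : cfun _ _) \o s).
  by move=> x y xy; rewrite /= /s xy.
exists (Cfun (depends_on_continuous ds)); split; first by apply/loc_constP; exists n.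
move=> x; have [z [zx zs]] := nP _ _ (esym (sP x)).
rewrite (splitr e) [X in Normc.normc X](_ : _ =
  ((a : cfun _ _) x - (a : cfun _ _) z) + ((a : cfun _ _) z - (a : cfun _ _) (s x))).
  by apply: le_lt_trans (normcD _ _) _; rewrite ltrD// normcB.
by rewrite addrA subrK.
Qed.

Lemma loc_const_dense_star x1 : dense_star_subalgebra (loc_const M).
Proof.
have cL := Lambda_compact.
split.
- by move=> x; near=> y.
- move=> k a b la lb x; near=> y; rewrite !cfunD !cfunZ.
  by congr (_ * _ + _); near: y; [exact: la|exact: lb].
- move=> a b la lb x; near=> y => /=.
  by congr (_ * _); near: y; [exact: la|exact: lb].
- move=> a la x; near=> y => /=.
  by congr (_^*); near: y; exact: la.
- move=> a e e0; have [b [lb ab]] := loc_const_dense x1 a (divr_gt0 e0 (ltr0n R 2)).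
  exists b => //; apply: le_lt_trans (_ : _ <= e / 2) _.
    by apply: (sup_norm_le x1) => x; rewrite cfunB ltW.
  by rewrite ltr_pdivrMr// mulr_natr mulr2n ltrDl.
Unshelve. all: by end_near.
Qed.

Lemma cylinderE x w : cylinder M x0 w (\val x) <-> prefix_of (size w) x = w.
Proof.
split=> [[v [rv wv] vx]|e].
  rewrite /prefix_of -vx [RHS]wv; have cv := coding_inj hc rv; exact: eq_mkseq cv _.
exists (c (\val x)); last exact: (coding_iota hc (Lambda_val x)).
by split; [exact: (coding_reduced hc (Lambda_val x))|rewrite /word_prefix -[LHS]e].
Qed.

Lemma chiE x w : chi x0 w x = (prefix_of (size w) x == w)%:R.
Proof.
congr (_ %:R); congr nat_of_bool.
by apply/idP/eqP => [/set_mem /cylinderE|/cylinderE ?]; last exact: mem_set.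
Qed.

Lemma size_prefix_of n x : size (prefix_of n x) = n.
Proof. exact: size_mkseq. Qed.

Lemma reduced_prefix_of n x : reduced (prefix_of n x).
Proof. exact: reduced_mkseq (coding_reduced hc (Lambda_val x)). Qed.

Lemma chi_depends_on w n : (size w <= n)%N -> depends_on n (chi x0 w).
Proof. by move=> wn x y /(prefix_of_le wn); rewrite !chiE => ->. Qed.

Lemma prefix_representatives n : exists (N : nat) (s : 'I_N -> L),
  (forall x, exists i, prefix_of n x = prefix_of n (s i)) /\
  forall i j, prefix_of n (s i) = prefix_of n (s j) -> i = j.
Proof.
have : finite_set (range (prefix_of n)).
  apply: sub_finite_set (finite_words g n) => _ [x _ <-].
  exact: size_prefix_of.
move=> /finite_seqP[r rE]; pose t := undup r.
have tE w : w \in t <-> exists x, prefix_of n x = w.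
  rewrite mem_undup; split=> [wr|[x <-]].
    have : [set` r] w by [].
    by rewrite -rE => -[x _ <-]; exists x.
  have : range (prefix_of n) (prefix_of n x) by exists x.
  by rewrite rE.
have ex (i : 'I_(size t)) : {x | prefix_of n x = nth [::] t i}.
  by apply: cid; apply/tE; exact: mem_nth.
exists (size t), (fun i => projT1 (ex i)); split=> [x|i j].
  have xt : prefix_of n x \in t by apply/tE; exists x.
  move: (xt); rewrite -index_mem => it; exists (Ordinal it).
  by rewrite (projT2 (ex _)) nth_index.
rewrite !(projT2 (ex _)) => /eqP; rewrite nth_uniq ?undup_uniq// => /eqP.
exact: val_inj.
Qed.

Let scaleE (k : C) (f : L -> C) x : (k *: f) x = k * f x. Proof. by []. Qed.

Lemma depends_on_sum n N (s : 'I_N -> L) (a : L -> C) :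
  (forall x, exists i, prefix_of n x = prefix_of n (s i)) ->
  (forall i j, prefix_of n (s i) = prefix_of n (s j) -> i = j) ->
  depends_on n a ->
  a = \sum_i a (s i) *: chi x0 (prefix_of n (s i)).
Proof.
move=> s_ex s_inj an; apply/funext => x; have [i xi] := s_ex x.
rewrite fct_sumE (bigD1 i)//= big1 ?addr0 => [|j ji].
  by rewrite scaleE chiE size_prefix_of xi eqxx mulr1; exact: an.
rewrite scaleE chiE size_prefix_of xi.
case: eqP => [/s_inj ij|]; last by rewrite mulr0.
by rewrite ij eqxx in ji.
Qed.

Lemma AfiltP n (a : CLambda M) : Afilt x0 n a <-> depends_on n (a : cfun _ _).
Proof.
split.
  move=> [m [k [s [sw]]]] e x y xy.
  rewrite e !fct_sumE; apply: eq_bigr => i _.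
  have [w /andP[_ wn] <-] := sw i.
  by rewrite !scaleE (chi_depends_on wn xy).
move=> an; have [N [s [s_ex s_inj]]] := prefix_representatives n.
exists N, (fun i => (a : cfun _ _) (s i)), (fun i => chi x0 (prefix_of n (s i))).
split; last exact: depends_on_sum.
move=> i; exists (prefix_of n (s i)) => //=.
by rewrite reduced_prefix_of size_prefix_of leqnn.
Qed.

Lemma cfun_sum I (r : seq I) (F : I -> cfun R L) x :
  (\sum_(i <- r) F i) x = \sum_(i <- r) F i x.
Proof.
elim: r => [|i r IH]; first by rewrite !big_nil.
by rewrite !big_cons cfunD IH.
Qed.

(** The characteristic functions of the cylinders of length n that occur form a basis, so that
    lin_dim is not a default value. *)
Lemma Afilt_basis n : exists b : 'I_(lin_dim (Afilt x0 n : set (CLambda M))) -> CLambda M,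
  lspan (range b) = Afilt x0 n.
Proof.
pose Q m := exists b : 'I_m -> CLambda M,
    (forall k : 'I_m -> C, \sum_i k i *: b i = 0 -> forall i, k i = 0) /\
    lspan (range b) = Afilt x0 n.
have [b [_ bE]] : Q (lin_dim (Afilt x0 n : set (CLambda M))); last by exists b.
apply: (@xgetPex _ 0%N Q); have [N [s [s_ex s_inj]]] := prefix_representatives n.
have dn i : depends_on n (chi x0 (prefix_of n (s i))).
  by apply: chi_depends_on; rewrite size_prefix_of.
pose b i : CLambda M := Cfun (depends_on_continuous (dn i)).
have bE (z : C) i x : (z *: b i : cfun R L) x =
    z * (prefix_of n x == prefix_of n (s i))%:R.
  by rewrite cfunZ /= chiE size_prefix_of.
exists N, b; split=> [k k0 i|].
  have := congr1 (fun f : cfun R L => f (s i)) k0.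
  rewrite cfun_sum (bigD1 i)// big1 ?addr0 => [|j /andP[_ ji]].
    by move=> kc; have := kc; rewrite [LHS]addr0 bE eqxx mulr1.
  rewrite bE; case: eqP => [/s_inj ij|]; last by rewrite mulr0.
  by rewrite ij eqxx in ji.
apply/seteqP; split=> a.
  move=> [m [k [f [fb ->]]]]; apply/AfiltP => x y xy; rewrite !cfun_sum.
  apply: eq_bigr => i _; rewrite !cfunZ; congr (_ * _).
  by have [j _ <-] := fb i; apply: (dn j).
move=> /AfiltP an; exists N, (fun i => (a : cfun _ _) (s i)), b; split; first by move=> i; exists i.
apply: cfunP => x; rewrite cfun_sum.
rewrite [LHS](congr1 (fun f => f x) (depends_on_sum s_ex s_inj an)) fct_sumE.
by apply: eq_bigr => i _; rewrite cfunZ.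
Qed.

(** * Conformal measures charge all cylinders *)

Lemma cylinder_set w (x : P1 R) :
  cylinder M x0 w x <-> Lambda x /\ mkseq (c x) (size w) = w.
Proof.
split=> [xw|[Lx xw]]; last by apply: (cylinderE (SigSub (mem_set Lx)) w).2.
have Lx : Lambda x by case: xw => v [rv _] <-; exact: (coding_limit hc rv).
by split=> //; apply: (cylinderE (SigSub (mem_set Lx)) w).1.
Qed.

Lemma cylinder_closed w : closed (cylinder M x0 w).
Proof.
move=> x xw.
have Lx : Lambda x.
  apply: (coding_closed hc) => V /xw[y [/cylinder_set[Ly _] Vy]]; by exists y.
apply/cylinder_set; split=> //.
have [V Vx VP] := coding_continuous hc (size w) Lx.
by have [y [/cylinder_set[Ly yw] Vy]] := xw _ Vx; rewrite -(VP _ Vy Ly).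
Qed.

Lemma closed_P1borel (A : set (P1 R)) : closed A -> measurable (A : set (P1borel R)).
Proof.
move=> cA; rewrite -(setCK A); apply: measurableC.
by apply: sub_sigma_algebra; exact: closed_openC.
Qed.

Hypothesis uM : forall i, M i \in unitmx.

Definition cons_inf (a : letter g) (v : nat -> letter g) : nat -> letter g :=
  fun k => if k is m.+1 then v m else a.

Lemma iota_cons a v : reduced_inf (cons_inf a v) ->
  iota_rho M x0 (cons_inf a v) = moebius (letter_mx M a) (iota_rho M x0 v).
Proof.
move=> rav; have rv : reduced_inf v by move=> n; exact: (rav n.+1).
have ua := letter_mx_unit uM a.
pose s n := moebius (word_mx M (mkseq v n)) x0.
have lim1 : moebius (letter_mx M a) \o s @ \oo --> iota_rho M x0 (cons_inf a v).
  have := coding_cvg hc rav; rewrite -(cvg_shiftn 1%N); apply: cvg_trans.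
  apply: near_eq_cvg; apply: nearW => n.
  by rewrite /= addn1 mkseq_cons word_mx_cons moebiusM// word_mx_unit.
have lim2 : moebius (letter_mx M a) \o s @ \oo -->
    moebius (letter_mx M a) (iota_rho M x0 v).
  exact: cvg_comp (coding_cvg hc rv) (@moebius_continuous R _ ua (iota_rho M x0 v)).
by rewrite -(cvg_lim (@P1_hausdorff R) lim1) -(cvg_lim (@P1_hausdorff R) lim2).
Qed.

Lemma mkseq_cons_inf a v n : mkseq (cons_inf a v) n.+1 = a :: mkseq v n.
Proof. exact: mkseq_cons. Qed.

Lemma cylinder_cons a b w : reduced [:: a, b & w] ->
  cylinder M x0 [:: a, b & w] =
  moebius (letter_mx M a) @` cylinder M x0 (b :: w).
Proof.
rewrite reduced_cons => /andP[ba _]; apply/seteqP; split=> x.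
  move=> [v [rv vw] <-]; pose v' n := v n.+1.
  have vE : v = cons_inf (v 0%N) v' by apply/funext => -[].
  have rv' : reduced_inf v' by move=> n; exact: rv.
  have /(congr1 behead) /= vw' : a :: b :: w = v 0%N :: mkseq v' (size w).+1.
    by rewrite -mkseq_cons_inf -vE.
  have va : a = v 0%N by case: vw.
  exists (iota_rho M x0 v'); first by exists v'.
  by rewrite -iota_cons va -vE.
move=> [_ [v [rv vw] <-] <-].
have v0 : v 0%N = b by move: vw => -[<-].
have rav : reduced_inf (cons_inf a v) by move=> [|n] /=; [rewrite v0|exact: rv].
exists (cons_inf a v); last exact: iota_cons.
by split=> //; rewrite /word_prefix [size _]/= mkseq_cons_inf -vw.
Qed.

Context (mu : probability (P1borel R) R).
Hypothesis ps : patterson_sullivan M mu.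

Lemma cylinder_measurable w : measurable (cylinder M x0 w : set (P1borel R)).
Proof. by apply: closed_P1borel; exact: cylinder_closed. Qed.

Lemma cylinder_sub w : cylinder M x0 w `<=` Lambda.
Proof. by move=> x /cylinder_set[]. Qed.

Lemma null_letter a (B : set (P1borel R)) : measurable B -> B `<=` Lambda ->
  mu B = 0%E -> mu (moebius (letter_mx M a) @` B) = 0%E.
Proof.
move=> mB BL B0; have := ps.2 [:: a] B mB BL.
rewrite word_mx_cons word_mx_nil mulr1 => ->.
by apply: null_integral => // x _; rewrite lee_fin powR_ge0.
Qed.

Lemma letter_mxK a : cancel (moebius (letter_mx M a)) (moebius (letter_mx M (inv_letter a))).
Proof.
move=> x; rewrite -moebiusM ?letter_mx_unit// letter_mx_inv//.
exact: moebius1.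
Qed.

Lemma null_cylinder_cons a b w : reduced [:: a, b & w] ->
  mu (cylinder M x0 [:: a, b & w]) = 0%E -> mu (cylinder M x0 (b :: w)) = 0%E.
Proof.
move=> rw /(null_letter (inv_letter a) (cylinder_measurable _) (@cylinder_sub _)).
rewrite cylinder_cons// (_ : _ @` (_ @` _) = cylinder M x0 (b :: w))//.
apply/seteqP; split=> [_ [_ [x Cx <-] <-]|x Cx]; first by rewrite letter_mxK.
by exists (moebius (letter_mx M a) x); [exists x|rewrite letter_mxK].
Qed.

Lemma cylinder_letter_null a b : b != inv_letter a ->
  mu (cylinder M x0 [:: a]) = 0%E -> mu (cylinder M x0 [:: b]) = 0%E.
Proof.
move=> ba a0; apply: (@null_cylinder_cons a b [::]); first by rewrite /reduced /= andbT.
apply: (subset_measure0 (cylinder_measurable _) (cylinder_measurable [:: a]) _ a0).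
move=> x /cylinder_set[Lx e]; apply/cylinder_set; split=> //; by move: e; rewrite /mkseq /= => -[-> _].
Qed.

Hypothesis g2 : (2 <= g)%N.

(** Conformality makes the measures of the cylinders of the letters vanish together,
    since any two letters are linked by a chain of admissible transitions; they cannot all
    vanish, because their union is the limit set. *)
Lemma cylinder_pos w : reduced w -> mu (cylinder M x0 w) <> 0%E.
Proof.
have all_null a : mu (cylinder M x0 [:: a]) = 0%E -> forall b, mu (cylinder M x0 [:: b]) = 0%E.
  move=> a0 b; have [ba|] := eqVneq b (inv_letter a); last by move=> ba; exact: cylinder_letter_null ba a0.
  have [j ja] : exists j : 'I_g, j != a.1.
    have [e|ne] := eqVneq (Ordinal (ltnW g2)) a.1; last by exists (Ordinal (ltnW g2)).
    by exists (Ordinal g2); rewrite -e.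
  have ja0 : mu (cylinder M x0 [:: (j, false)]) = 0%E.
    apply: (cylinder_letter_null _ a0); apply: contraNneq ja => e.
    by rewrite -[j]/(j, false).1 e.
  apply: (cylinder_letter_null _ ja0); apply: contraNneq ja => e.
  by have := congr1 fst e; rewrite ba /= => ->.
have ex_pos : exists a, mu (cylinder M x0 [:: a]) <> 0%E.
  apply: contrapT => /forallNP all0.
  pose F k : set (P1borel R) :=
    if @unpickle ('I_g * bool)%type k is Some a then cylinder M x0 [:: a] else set0.
  have F0 k : mu.-negligible (F k).
    rewrite /F; case: unpickle => [a|]; last exact: negligible_set0.
    apply/negligibleP; first exact: cylinder_measurable.
    exact: contrapT (all0 a).
  have : mu.-negligible (limit_set M : set (P1borel R)).
    apply: (negligibleS _ (negligible_bigcup F0)) => x Lx.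
    exists (@pickle ('I_g * bool)%type (c x 0%N)) => //.
    by rewrite /F pickleK; apply/cylinder_set.
  move=> /negligibleP -/(_ (closed_P1borel (coding_closed hc))).
  by move=> L0; have /eqP := etrans (esym ps.1) L0; rewrite onee_eq0.
have pos a : mu (cylinder M x0 [:: a]) <> 0%E.
  by move=> a0; have [b] := ex_pos; apply; exact: all_null a0 b.
case: w => [_|a w].
  rewrite (_ : cylinder M x0 [::] = limit_set M); last first.
    by apply/seteqP; split=> x; [move=> /cylinder_sub|move=> Lx; apply/cylinder_set].
  by move=> L0; have /eqP := etrans (esym ps.1) L0; rewrite onee_eq0.
elim: w a => [|b w IH] a; first by move=> _; exact: pos.
move=> raw /(null_cylinder_cons raw); apply: IH.
by move: raw; rewrite reduced_cons => /andP[].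
Qed.

Lemma tau_chi w (a : CLambda M) : reduced w ->
  (forall x, (a : cfun _ _) x = chi x0 w x) -> tau mu a <> 0.
Proof.
move=> rw aw t0; apply: (cylinder_pos rw).
have : \int[mu]_(x in Lambda) complex.Re (valL_ 0 (a : cfun _ _) x) = 0.
  exact: (congr1 (fun z : C => complex.Re z) t0).
rewrite (@eq_Rintegral _ _ _ _ _ (\1_(cylinder M x0 w : set (P1borel R)))); last first.
  move=> x Lx; have -> : valL_ 0 (a : cfun _ _) x = chi x0 w (SigSub Lx).
    by rewrite -aw -[in RHS](valLK 0 (a : cfun _ _)).
  by rewrite /chi /= indicE; case: (_ \in _).
rewrite /Rintegral integral_indic; last 2 first.
  exact: closed_P1borel (coding_closed hc).
  exact: cylinder_measurable.
rewrite setIidl; last exact: cylinder_sub.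
move=> f0; rewrite -[LHS]fineK ?f0//.
by rewrite ge0_fin_numE// (le_lt_trans (probability_le1 _ _)) ?ltry//; exact: cylinder_measurable.
Qed.

End LimitSetSpace.

(** * GNS representations of C(X) *)

Section GNSRepresentation.
Context (R : realType) (X : topologicalType) (x1 : X).
Hypothesis cX : compact [set: X].
Local Notation C := R[i].
Local Notation A := (cfun_alg R X).
Context (tau : A -> C) (H : completeNormedModType C).
Context (ip : {dot H for (@Num.conj C)}) (eta : A -> H) (act : A -> H -> H).
Hypothesis gns : GNS tau ip eta act.

Let hip : hilbert_norm ip. Proof. by case: gns. Qed.
Let eta_lin : linear eta. Proof. by case: gns. Qed.
Let eta_ip a b : ip (eta a) (eta b) = tau (sa_mul (sa_star b) a).
Proof. by case: gns. Qed.
Let eta_dense : closure (range eta) = setT. Proof. by case: gns. Qed.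
Let act_bounded a : bounded_operator (act a).
Proof. by case: gns => _ _ _ _ /(_ a)[]. Qed.
Let act_eta a b : act a (eta b) = eta (sa_mul a b).
Proof. by case: gns => _ _ _ _ /(_ a)[_]. Qed.
Let act_lin a : linear (act a). Proof. by case: (act_bounded a). Qed.

Lemma etaD a b : eta (a + b) = eta a + eta b.
Proof. by have := eta_lin 1 a b; rewrite !scale1r. Qed.

Lemma eta0 : eta 0 = 0.
Proof. by have := etaD 0 0; rewrite addr0 -{1}[eta 0]addr0 => /addrI. Qed.

Lemma etaZ k a : eta (k *: a) = k *: eta a.
Proof. by have := eta_lin k a 0; rewrite !addr0 eta0 addr0. Qed.

Lemma etaB a b : eta (a - b) = eta a - eta b.
Proof. by rewrite -scaleN1r etaD etaZ scaleN1r. Qed.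

Lemma act0 a : act a 0 = 0.
Proof.
have := act_lin a 1 0 0; rewrite !scale1r !addr0 -{1}[act a 0]addr0.
by move=> /addrI.
Qed.

Lemma eta_cvg (x : H) : exists u : nat -> A, eta \o u @ \oo --> x.
Proof.
have [s [sE sx]] := dense_cvg x eta_dense.
have ex n : {a | eta a = s n} by apply: cid; have [a _ <-] := sE n; exists a.
exists (fun n => projT1 (ex n)); apply: (cvg_ext sx) => n /=.
by rewrite (projT2 (ex n)).
Qed.

(** The identities hold on the dense image of the algebra, by associativity and
    commutativity, and pass to limits. *)
Lemma GNS_star_representation : star_representation ip act.
Proof.
split=> //.
- move=> k a b x; have [u ux] := eta_cvg x.
  apply: normed_cvg_unique (bounded_cvg (act_bounded _) ux) _.
  have lim_a : (fun n => k *: act a (eta (u n))) @ \oo --> k *: act a x.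
    by apply: cvgZl_tmp; exact: bounded_cvg (act_bounded a) ux.
  have lim_b : (fun n => act b (eta (u n))) @ \oo --> act b x.
    exact: bounded_cvg (act_bounded b) ux.
  apply: (cvg_ext (cvgD lim_a lim_b)) => n.
  transitivity (k *: act a (eta (u n)) + act b (eta (u n))) => //.
  rewrite [RHS]/= !act_eta -eta_lin.
  congr eta; apply: cfunP => y.
  transitivity (k * (a y * u n y) + b y * u n y) => //.
  by rewrite mulrA -mulrDl.
- move=> a b x; have [u ux] := eta_cvg x.
  apply: normed_cvg_unique (bounded_cvg (act_bounded _) ux) _.
  apply: (cvg_ext (bounded_cvg (act_bounded a) (bounded_cvg (act_bounded b) ux))) => n /=.
  rewrite !act_eta.
  by congr eta; apply: cfunP => y /=; rewrite mulrA.
- move=> a x y; have [u ux] := eta_cvg x; have [v vy] := eta_cvg y.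
  have step b : ip (act a x) (eta b) = ip x (act (sa_star a) (eta b)).
    apply: normed_cvg_unique (cvg_ipl hip (bounded_cvg (act_bounded a) ux)) _.
    apply: (cvg_ext (cvg_ipl hip ux)) => n /=; rewrite !act_eta !eta_ip.
    have conjE (p q r : C) : (p^* * q)^* * r = q^* * (p * r).
      by rewrite rmorphM /= conjCK mulrCA mulrA.
    by congr tau; apply: cfunP => z; exact: conjE.
  apply: normed_cvg_unique (cvg_ipr hip vy) _.
  apply: (cvg_ext (cvg_ipr hip (bounded_cvg (act_bounded (sa_star a)) vy))) => n /=.
  by rewrite step.
Qed.

Let one_subproof : (fun=> 1) \in @continuous_pred R X.
Proof. by apply/mem_set => x; exact: cst_continuous. Qed.

Definition cfun_one : A := Cfun one_subproof.

Let tauE f : tau f = ip (eta f) (eta cfun_one).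
Proof. by rewrite eta_ip; congr tau; apply: cfunP => x /=; rewrite rmorph1 mul1r. Qed.

(** With s the supremum norm of a, the function s^2 - |a|^2 is the square of a continuous
    function b; so the norms of eta a and eta b have squares
    summing up to s^2 times the square of the norm of eta 1. *)
Lemma eta_norm_le a : `|eta a| <= (sa_norm a)%:C%C * `|eta cfun_one|.
Proof.
set s := sa_norm a; have s0 : 0 <= s := sup_norm_ge0 cX x1 a.
have le_s x : 0 <= s ^+ 2 - Normc.normc (a x) ^+ 2.
  by rewrite subr_ge0 ler_pXn2r ?nnegrE ?normc_ge0//; exact: sup_norm_ge.
have bP : (fun x => (Num.sqrt (s ^+ 2 - Normc.normc (a x) ^+ 2))%:C%C) \in @continuous_pred R X.
  apply/mem_set => x.
  have na : (fun y => Normc.normc (a y)) @ x --> Normc.normc (a x).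
    exact: cvg_comp (@cfun_continuous R X a x) (@normc_continuous R (a x)).
  have sq : (fun y => s ^+ 2 - Normc.normc (a y) ^+ 2) @ x --> s ^+ 2 - Normc.normc (a x) ^+ 2.
    apply: cvgB; first exact: cvg_cst.
    by rewrite expr2; under eq_fun do rewrite expr2; exact: cvgM.
  exact: cvg_comp (cvg_comp _ _ sq (@sqrt_continuous R _)) (@real_complex_continuous R _).
pose b : A := Cfun bP.
have eE : sa_mul (sa_star a) a + sa_mul (sa_star b) b = (s ^+ 2)%:C%C *: cfun_one.
  apply: cfunP => x; rewrite cfunD cfunZ /= mulr1.
  rewrite [X in _ + X](_ : _ = (s ^+ 2 - Normc.normc (a x) ^+ 2)%:C%C); last first.
    have conjR (r : R) : (r%:C%C)^* = r%:C%C :> C by exact: conjc_real.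
    by rewrite conjR -RtoCM -expr2 sqr_sqrtr.
  rewrite rmorphB /= addrC mulrC -normCK [`|_| ^+ 2](_ : _ = (Normc.normc (a x) ^+ 2)%:C%C) ?subrK//.
  by rewrite expr2 RtoCM -expr2.
have sum : `|eta a| ^+ 2 + `|eta b| ^+ 2 = (s%:C%C * `|eta cfun_one|) ^+ 2.
  rewrite -!hip !eta_ip !tauE -ipDl -etaD eE etaZ ipZl hip exprMn.
  by rewrite expr2 RtoCM -expr2.
have sC : 0 <= s%:C%C :> C by rewrite lecR.
by rewrite -(@ler_pXn2r _ 2)// ?nnegrE ?mulr_ge0// -sum lerDl exprn_ge0.
Qed.

End GNSRepresentation.

(** * The spectral triple of a Schottky group *)

Section SchottkyTriple.
Context (R : realType) (g : nat) (M : 'I_g -> 'M[R[i]]_2) (x0 : P1 R).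
Local Notation C := R[i].
Local Notation Lambda := (limit_set M).
Local Notation L := (set_type Lambda).
Local Notation A := (CLambda M).
Context (c : P1 R -> nat -> letter g).
Hypothesis hc : coding M x0 c.
Hypothesis uM : forall i, M i \in unitmx.
Context (mu : probability (P1borel R) R).
Hypothesis ps : patterson_sullivan M mu.
Hypothesis g2 : (2 <= g)%N.
Context (H : completeNormedModType C) (ip : {dot H for (@Num.conj C)}).
Context (eta : A -> H) (act : A -> H -> H).
Hypothesis gns : GNS (tau mu) ip eta act.

Local Notation depends_on := (depends_on (M := M) c).
Local Notation prefix_of := (prefix_of (M := M) c).
Local Notation W n := (eta @` Afilt x0 n).
Local Notation P := (proj_n ip eta x0).

Let hip : hilbert_norm ip. Proof. by case: gns. Qed.
Let rep : star_representation ip act := GNS_star_representation gns.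
Let act_eta a b : act a (eta b) = eta (sa_mul a b).
Proof. by case: gns => _ _ _ _ /(_ a)[_]. Qed.
Let AP n (a : A) : Afilt x0 n a <-> depends_on n (a : cfun _ _) := AfiltP hc n a.

Definition chi_cfun w : A :=
  Cfun (depends_on_continuous hc (chi_depends_on hc (leqnn (size w)))).

(** Multiplying by the characteristic function of a cylinder of length n isolates one value
    of a function that depends on n letters, and no cylinder is a null set. *)
Lemma eta_inj n (f : A) : depends_on n (f : cfun _ _) -> eta f = 0 -> f = 0.
Proof.
move=> fn f0; apply: cfunP => x; transitivity (0 : C) => //.
pose h : A := chi_cfun (prefix_of n x).
have hE y : (h : cfun _ _) y = (prefix_of n y == prefix_of n x)%:R.
  by rewrite /h /= (chiE hc) size_prefix_of.
have hf : sa_mul h f = (f : cfun _ _) x *: h.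
  apply: cfunP => y; rewrite cfunZ -[LHS]/(h y * f y) hE.
  by case: eqP => [/fn->|]; rewrite ?mulr1 ?mul1r ?mulr0 ?mul0r.
have hh : sa_mul (sa_star h) h = h.
  apply: cfunP => y; rewrite -[LHS]/((h y)^* * h y) !hE.
  by case: eqP => _; rewrite ?mulr1 ?mulr0// rmorph1.
have := act_eta h f; rewrite f0 (act0 gns) hf (etaZ gns) => /esym/eqP.
rewrite scaler_eq0 => /orP[/eqP->//|/eqP eh0].
have ip_tau : ip (eta h) (eta h) = tau mu (sa_mul (sa_star h) h) by case: gns.
exfalso; apply: (tau_chi hc uM ps g2 (reduced_prefix_of hc n x)) => [y|].
  exact: (erefl (h y)).
by rewrite -/h -hh -ip_tau eh0 ip0l.
Qed.

Lemma eta_sum I (r : seq I) (F : I -> A) :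
  eta (\sum_(i <- r) F i) = \sum_(i <- r) eta (F i).
Proof.
elim: r => [|i r IH]; first by rewrite !big_nil (eta0 gns).
by rewrite !big_cons (etaD gns) IH.
Qed.

Lemma lspan_eta m (b : 'I_m -> A) : lspan (range (eta \o b)) = eta @` lspan (range b).
Proof.
apply/seteqP; split=> y.
  move=> [p [k [s [sb ->]]]].
  have ex i : {j | eta (b j) = s i} by apply: cid; have [j _ <-] := sb i; exists j.
  exists (\sum_i k i *: b (projT1 (ex i))).
    by exists p, k, (fun i => b (projT1 (ex i))); split=> // i; exists (projT1 (ex i)).
  rewrite eta_sum; apply: eq_bigr => i _.
  by rewrite (etaZ gns) (projT2 (ex i)).
move=> [_ [p [k [s [sb ->]]]] <-]; exists p, k, (eta \o s); split.
  by move=> i; have [j _ ji] := sb i; exists j; rewrite /= ?ji.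
by rewrite eta_sum; apply: eq_bigr => i _; rewrite (etaZ gns).
Qed.

Lemma filtration_basis n : exists b : 'I_(lin_dim (Afilt x0 n : set A)) -> H,
  lspan (range b) = W n.
Proof.
by have [b bE] := Afilt_basis hc n; exists (eta \o b); rewrite lspan_eta [lspan _]bE.
Qed.

Lemma filtration_sub n : W n `<=` W n.+1.
Proof.
by move=> _ [a /AP an <-]; exists a => //; apply/AP; exact: depends_on_le an.
Qed.

Lemma positive_reduced (v : nat -> letter g) : (forall k, ~~ (v k).2) -> reduced_inf v.
Proof.
move=> vP n; apply/eqP => e; have := vP n.+1.
by rewrite e /= negbK (negPf (vP n)).
Qed.

Lemma point_of v : reduced_inf v -> exists x : L, forall k, prefix_of k x = mkseq v k.
Proof.
move=> rv; exists (SigSub (mem_set (coding_limit hc rv))) => k.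
exact: eq_mkseq (coding_inj hc rv) k.
Qed.

Let i0 : 'I_g := Ordinal (ltnW g2).
Let i1 : 'I_g := Ordinal g2.

(** The characteristic function of a cylinder of length n.+1 separates the words v and v', which
    first differ at place n; they are reduced since they contain no inverse of a generator. *)
Lemma filtration_strict n : exists2 x, W n.+1 x & ~ W n x.
Proof.
pose v (k : nat) : letter g := (i0, false).
pose v' k : letter g := if (k < n)%N then (i0, false) else (i1, false).
have [x xP] : exists x : L, forall k, prefix_of k x = mkseq v k.
  by apply: point_of; exact: positive_reduced.
have [y yP] : exists x : L, forall k, prefix_of k x = mkseq v' k.
  by apply: point_of; apply: positive_reduced => k; rewrite /v'; case: ifP.
have xy : prefix_of n x = prefix_of n y.
  rewrite xP yP; apply/eq_in_map => k; rewrite mem_iota /= => kn.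
  by rewrite /v' kn.
have xyS : prefix_of n.+1 y != prefix_of n.+1 x.
  apply/eqP => /(congr1 (last (i0, false))); rewrite xP yP !mkseqS !last_rcons.
  by rewrite /v' ltnn /v => -[].
pose h : A := chi_cfun (prefix_of n.+1 x).
have hE z : (h : cfun _ _) z = (prefix_of n.+1 z == prefix_of n.+1 x)%:R.
  by rewrite /h /= (chiE hc) size_prefix_of.
have hn : depends_on n.+1 (h : cfun _ _) by move=> z t; rewrite !hE => ->.
exists (eta h); first by exists h => //; apply/AP.
move=> [a /AP an ah].
have : a - h = 0.
  apply: (@eta_inj n.+1); last by rewrite (etaB gns) ah subrr.
  by move=> z t zt; rewrite !cfunB (hn _ _ zt) (depends_on_le (leqnSn n) an zt).
move=> /eqP; rewrite subr_eq0 => /eqP ah'.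
have := an _ _ xy; rewrite ah' !hE eqxx (negPf xyS) => /eqP.
by rewrite oner_eq0.
Qed.

Lemma filtration0_neq0 : exists2 x, W 0%N x & x != 0.
Proof.
pose o : A := cfun_one R L.
have on : depends_on 0 (o : cfun _ _) by [].
exists (eta o); first by exists o => //; apply/AP.
apply/eqP => o0; have [x _] : exists x : L, forall k, prefix_of k x = mkseq (fun=> (i0, false)) k.
  by apply: point_of; exact: positive_reduced.
have := congr1 (fun f : cfun R L => f x) (eta_inj on o0).
by move=> /eqP; rewrite -[X in X == _]/(1 : C) -[X in _ == X]/(0 : C) oner_eq0.
Qed.

Lemma proj_n_unique n x y : W n y -> (forall z, W n z -> ip (x - y) z = 0) -> P n x = y.
Proof.
move=> Wy xy; apply: xget_unique => [//|y' [Wy' xy']].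
have Wd : W n (y' - y).
  have [a /AP an <-] := Wy; have [a' /AP an' <-] := Wy'.
  exists (a' - a); last exact: (etaB gns).
  by apply/AP => z t zt; rewrite !cfunB (an _ _ zt) (an' _ _ zt).
apply/eqP; rewrite -subr_eq0; apply/eqP; apply: (ip_eq0 hip).
have /eqP := xy' _ Wd; have /eqP := xy _ Wd.
by rewrite !ipBl !subr_eq0 => /eqP <- /eqP ->; rewrite subrr.
Qed.

Section Basis.
Context (x1 : L) (e : nat -> H) (d : nat -> nat).
Hypothesis e_ortho : forall i j, ip (e i) (e j) = (i == j)%:R.
Hypothesis eW : forall n x, W n x <-> fourier_sum ip e (d n) x = x.

Lemma proj_n_fourier n x : P n x = fourier_sum ip e (d n) x.
Proof.
apply: proj_n_unique => [|z /eW <-]; first by apply/eW; exact: fourier_sumK.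
exact: (fourier_sum_orth e_ortho (d n) x (fun k => ip z (e k))).
Qed.

(** A vector is approximated by the image of a continuous function, and this function uniformly
    by a locally constant one, whose image lies in some W n. *)
Lemma basis_dense (x : H) (r : R) : 0 < r ->
  exists n y, fourier_sum ip e n y = y /\ `|x - y| < r%:C%C.
Proof.
move=> r0; have [r' r'E r'0] : exists2 s : R, r = s + s & 0 < s.
  by exists (r / 2); [rewrite -splitr|rewrite divr_gt0].
have [a xa] : exists a, `|x - eta a| < r'%:C%C.
  have dx : closure (range eta) x by have [_ _ _ -> _] := gns.
  have rC : 0 < r'%:C%C :> C by rewrite ltcR.
  have [_ [[a _ <-]]] := dx _ (nbhsx_ballx x _ rC).
  by rewrite -ball_normE => ?; exists a.
have [s s0 sE] := normC_real (eta (cfun_one R L)).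
have s1 : 0 < s + 1 by rewrite ltr_wpDl.
have [_ _ _ _ /(_ a _ (divr_gt0 r'0 s1))[b lb ab]] := loc_const_dense_star hc x1.
have [n bn] := (loc_constP hc b).1 lb.
exists (d n), (eta b); split; first by apply/eW; exists b => //; apply/AP.
rewrite -(subrK (eta a) x) -addrA r'E RtoCD.
apply: le_lt_trans (ler_normD _ _) _; rewrite ltrD// -(etaB gns).
apply: le_lt_trans (eta_norm_le x1 (Lambda_compact hc) gns _) _.
rewrite sE -RtoCM ltcR; apply: le_lt_trans (_ : _ <= sa_norm (a - b) * (s + 1)) _.
  rewrite ler_wpM2l ?lerDl//; exact: (sup_norm_ge0 (Lambda_compact hc) x1).
by rewrite -ltr_pdivlMr.
Qed.

(** Multiplication by a and by its conjugate both preserve W n, so it commutes with the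
    orthogonal projection. *)
Lemma proj_n_act m n (a : A) x : depends_on m (a : cfun _ _) -> (m <= n)%N ->
  P n (act a x) = act a (P n x).
Proof.
move=> am mn; have an := depends_on_le mn am.
have WP : W n (P n x) by rewrite proj_n_fourier; apply/eW; exact: fourier_sumK.
have W_act (b : A) (y : H) : depends_on n (b : cfun _ _) -> W n y -> W n (act b y).
  move=> bn [f /AP fn <-]; rewrite act_eta; exists (sa_mul b f) => //.
  by apply/AP => z t zt; rewrite /= (bn _ _ zt) (fn _ _ zt).
have [act_b _ _ act_adj] := rep.
apply: proj_n_unique => [|z Wz]; first exact: W_act.
have -> : act a x - act a (P n x) = act a (x - P n x).
  have := (act_b a).1 (-1) (P n x) x; rewrite !scaleN1r.
  by rewrite [- P n x + _]addrC [- act _ _ + _]addrC.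
rewrite act_adj; have : W n (act (sa_star a) z).
  by apply: W_act => // t u tu; rewrite /= (an _ _ tu).
move=> /eW <-; rewrite {1}proj_n_fourier.
exact: (fourier_sum_orth e_ortho (d n) x (fun k => ip _ (e k))).
Qed.

End Basis.

Theorem schottky_spectral_triple :
  spectral_triple ip (loc_const M) act (dirac_op ip eta x0) /\
  one_summable ip (dirac_op ip eta x0).
Proof.
pose N n := lin_dim (Afilt x0 n : set A).
have ex n : {b : 'I_(N n) -> H | lspan (range b) = W n} by apply: cid; exact: filtration_basis.
have [e [d [e_ortho [d0 d_mono] dN eW]]] := adapted_orthonormal_sequence hip
  (fun n => projT2 (ex n)) filtration_sub filtration_strict filtration0_neq0.
have [x1 _] : exists x1 : L, forall k, prefix_of k x1 = mkseq (fun=> (i0, false)) k.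
  by apply: point_of; exact: positive_reduced.
have e_dense := basis_dense x1 eW.
have PF := proj_n_fourier e_ortho eW.
have DE : dirac_op ip eta x0 = spectral_op N P by [].
rewrite DE; split; last exact: (spectral_op_one_summable hip e_ortho e_dense d0 d_mono dN PF).
split=> //.
- exact: cfun_cstar (Lambda_compact hc) x1.
- exact: (spectral_op_self_adjoint hip e_ortho e_dense N d0 d_mono PF).
- exact: (spectral_op_unbounded hip e_ortho e_dense d0 d_mono dN PF).
- exact: (spectral_op_compact_resolvent hip e_ortho e_dense d0 d_mono dN PF).
- exact: loc_const_dense_star hc x1.
- move=> a /(loc_constP hc)[m am].
  have [act_b _ _ _] := rep.
  have am_comm n x : (m <= n)%N -> P n (act a x) = act a (P n x).
    by move=> mn; exact: (proj_n_act e_ortho eW x am mn).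
  exact: (spectral_op_commutator hip e_ortho N d0 d_mono PF (act_b a) am_comm).
Qed.

End SchottkyTriple.

Theorem proposition1 (R : realType) (g : nat)
    (X : riemann_surface R)
    (M : 'I_g -> 'M[R[i]]_2) (p : P1 R -> X)
    (x0 : P1 R)
    (mu : probability (P1borel R) R)
    (H : completeNormedModType R[i]) (ip : {dot H for (@Num.conj R[i])})
    (eta : CLambda M -> H) (act : CLambda M -> H -> H) :
  (2 <= g)%N ->
  compact [set: X] ->
  schottky M ->
  uniformizes M p ->
  ~ limit_set M x0 ->
  patterson_sullivan M mu ->
  GNS (tau mu) ip eta act ->
  spectral_triple ip (loc_const M) act (dirac_op ip eta x0) /\
  one_summable ip (dirac_op ip eta x0).
Proof.
move=> g2 _ sM _ Lx0 ps gns.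
have [c hc] := schottky_coding (ltnW g2) sM Lx0.
by have [uM _ _ _] := sM; exact: (schottky_spectral_triple hc uM ps g2 gns).
Qed.
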